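(* Assume that $E\subset L_1$ is a quasi-Banach symmetric function space on $(0,1)$. Then the space $\mathcal{S}_E$ generated by the Calderón operator $S$ is the optimal symmetric quasi-Banach range for the martingale transform $T$ on $E$.
   Context: All functions are real-valued measurable functions on $(0,1)$ with Lebesgue measure $m$, identified when equal a.e.; $L_1=L_1(0,1)$. Decreasing rearrangement: $\mu(x)=\mu(\cdot;x)$, $\mu(t;x):=\inf\{s\ge 0: m(\{u:|x(u)|>s\})\le t\}$. A quasi-Banach symmetric function space on $(0,1)$ is a complete quasi-normed space $(E,\|\cdot\|_E)$ of measurable functions on $(0,1)$ such that: if $x\in E$ and $y$ is measurable with $|y|\le|x|$, then $y\in E$ and $\|y\|_E\le\|x\|_E$; if $x\in E$ and $y$ is measurable with $\mu(y)=\mu(x)$, then $y\in E$ and $\|y\|_E=\|x\|_E$. Calderón operator: $(Sx)(t)=\frac1t\int_0^t x(s)\,ds+\int_t^1\frac{x(s)}{s}\,ds$, $x\in L_1$. $L_{1,\infty}(0,1)$ is the space of measurable $x$ with $\sup_{0<t\le1}t\mu(t;x)<\infty$. Define $\mathcal{S}_E=\{x\in L_{1,\infty}(0,1):\exists y\in E,\ \mu(x)\le S\mu(y)\}$ with $\|x\|_{\mathcal{S}_E}=\inf\{\|y\|_E: y\in E,\ \mu(x)\le S\mu(y)\}$; this is a quasi-Banach symmetric function space. Martingale transform $T$: let $\mathcal{F}_n$, $n\ge0$, be the standard dyadic filtration on $[0,1]$ ($\mathcal F_n$ is generated by the intervals $((j-1)2^{-n},j2^{-n})$, $1\le j\le 2^n$),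 $\mathbb{E}_n$ the conditional expectation from $L_1$ onto $\mathcal F_n$, and $\mathbb E_{-1}=0$. Then $Tf=\sum_{m\ge0}(\mathbb{E}_{2m}f-\mathbb{E}_{2m-1}f)$, $f\in L_1$, with convergence in measure. Optimal range: for a linear operator $R$ defined on $E$, a quasi-Banach symmetric function space $G$ on $(0,1)$ is the optimal symmetric quasi-Banach range for $R$ on $E$ if it is the minimal receptacle of $R$ among quasi-Banach symmetric function spaces, i.e. $R:E\to G$ is bounded and $G\subset F$ for every quasi-Banach symmetric function space $F$ on $(0,1)$ such that $R:E\to F$ is bounded. *)

(* Defs.v *)
From mathcomp Require Import all_boot all_order all_algebra.
From mathcomp Require Import all_classical all_reals all_analysis.

Set Implicit Arguments.
Unset Strict Implicit.
Unset Printing Implicit Defensive.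

Import Order.TTheory GRing.Theory Num.Theory.
Import numFieldNormedType.Exports.

Local Open Scope classical_set_scope.
Local Open Scope ring_scope.

(* A function on (0,1) is represented by an arbitrary
   extension to R; only its values on (0,1), up to null sets, matter.
   "Measurable" is Borel measurable: every Lebesgue measurable function on (0,1)
   is a.e. equal to a Borel one, so the a.e. classes are the same. *)

Definition I01 (R : realType) : set R := `]0, 1[.
Arguments I01 : clear implicits.

Definition mfun01 (R : realType) (x : R -> R) : Prop :=
  measurable_fun (I01 R) x.

Definition L1 (R : realType) : set (R -> R) :=
  [set x | (@lebesgue_measure R).-integrable (I01 R) (EFin \o x)].

(* The set below is nonempty and bounded below by 0 whenever x is measurable
   and t > 0, so the real infimum is the genuine one there; for t <= 0 it may be
   empty, and rearrangements are only ever evaluated at t > 0. *)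
Definition rearr (R : realType) (x : R -> R) (t : R) : R :=
  inf [set s : R | 0 <= s /\
    (lebesgue_measure (I01 R `&` [set u | (s < `|x u|)%R]) <= t%:E)%E].

Definition calderon (R : realType) (x : R -> R) (t : R) : R :=
  t^-1 * \int[lebesgue_measure]_(s in `]0, t[) x s
  + \int[lebesgue_measure]_(s in `]t, 1[) (x s / s).

Definition weakL1 (R : realType) : set (R -> R) :=
  [set x | mfun01 x /\
    (ereal_sup [set (t * rearr x t)%:E | t in `]0%R, 1%R]] < +oo)%E].

(* A set of functions with a functional on it; the functional is meaningful
   only on the members of the set. *)
Record fspace (R : realType) := FSpace {
  fs_set :> (R -> R) -> Prop;
  fs_norm : (R -> R) -> R }.

(* [qn_ae] says that E is really a space of a.e. classes of functions. *)
Record is_quasi_normed_space (R : realType) (E : fspace R) : Prop := {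
  qn_measurable : forall x, E x -> mfun01 x;
  qn_ae : forall x y, E x -> mfun01 y ->
    ae_eq lebesgue_measure (I01 R) x y -> E y /\ fs_norm E y = fs_norm E x;
  qn_mem0 : E (cst 0);
  qn_memD : forall x y, E x -> E y -> E (x \+ y);
  qn_memZ : forall (a : R) x, E x -> E (a \*o x);
  qn_ge0 : forall x, E x -> 0 <= fs_norm E x;
  qn_eq0 : forall x, E x ->
    fs_norm E x = 0 <-> ae_eq lebesgue_measure (I01 R) x (cst 0);
  qn_homogeneous : forall (a : R) x, E x ->
    fs_norm E (a \*o x) = `|a| * fs_norm E x;
  qn_triangle : exists C : R, forall x y, E x -> E y ->
    fs_norm E (x \+ y) <= C * (fs_norm E x + fs_norm E y) }.

Definition is_complete (R : realType) (E : fspace R) : Prop :=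
  forall u : nat -> R -> R, (forall n, E (u n)) ->
    (forall e : R, 0 < e -> exists N : nat, forall m n : nat,
      (N <= m)%N -> (N <= n)%N -> fs_norm E (u m \- u n) < e) ->
    exists2 x, E x & (fun n => fs_norm E (u n \- x)) @ \oo --> (0 : R).

Record is_qB_symmetric (R : realType) (E : fspace R) : Prop := {
  qbs_quasi_normed : is_quasi_normed_space E;
  qbs_complete : is_complete E;
  qbs_ideal : forall x y, E x -> mfun01 y ->
    {ae lebesgue_measure, forall u, I01 R u -> `|y u| <= `|x u|} ->
    E y /\ fs_norm E y <= fs_norm E x;
  qbs_symmetric : forall x y, E x -> mfun01 y ->
    (forall t, I01 R t -> rearr y t = rearr x t) ->
    E y /\ fs_norm E y = fs_norm E x }.

(* S is only applied to rearrangements of integrable y below, so the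
   Rintegrals in [calderon] are finite. *)
Definition calderon_dominated (R : realType) (x y : R -> R) : Prop :=
  forall t, I01 R t -> rearr x t <= calderon (rearr y) t.

Definition calderon_space (R : realType) (E : fspace R) : fspace R :=
  FSpace [set x | weakL1 x /\ exists2 y, E y & calderon_dominated x y]
         (fun x => inf [set fs_norm E y | y in
                         [set y | E y /\ calderon_dominated x y]]).

Definition dyadic_interval (R : realType) (n j : nat) : set R :=
  `](j%:R / 2 ^+ n), (j.+1%:R / 2 ^+ n)[.
Arguments dyadic_interval : clear implicits.

Definition dyadic_filtration (R : realType) (n : nat) : set (set R) :=
  <<s I01 R, [set dyadic_interval R n j | j in [set j | (j < 2 ^ n)%N]] >>.
Arguments dyadic_filtration : clear implicits.

Definition is_cond_exp (R : realType) (F : set (set R)) (f g : R -> R) : Prop :=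
  [/\ forall B : set R, measurable B -> F (I01 R `&` g @^-1` B),
      L1 g &
      forall A, F A -> \int[lebesgue_measure]_(u in A) g u =
                       \int[lebesgue_measure]_(u in A) f u].

Definition cvg_in_measure01 (R : realType) (h : nat -> R -> R) (g : R -> R) :=
  forall e : R, 0 < e ->
    (fun n => lebesgue_measure (I01 R `&` [set u | e <= `|h n u - g u|]))
      @ \oo --> (0 : \bar R).

(* ce n stands for E_n f; the convention E_{-1} = 0 is built in here. *)
Definition ce_prev (R : realType) (ce : nat -> R -> R) (n : nat) : R -> R :=
  if n is k.+1 then ce k else cst 0.

(* T is given by its graph, Tf being determined only up to a.e. equality:
   [martingale_transform f g] reads "Tf = g". *)
Definition martingale_transform (R : realType) (f g : R -> R) : Prop :=
  [/\ L1 f, mfun01 g &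
  exists2 ce : nat -> R -> R,
    forall n, is_cond_exp (dyadic_filtration R n) f (ce n) &
    cvg_in_measure01
      (fun n u => \sum_(0 <= m < n) (ce m.*2 u - ce_prev ce m.*2 u)) g].

(* The operator is given by its graph; being defined on E is part of
   being bounded from E to G. *)
Definition bounded_operator (R : realType) (op : (R -> R) -> (R -> R) -> Prop)
    (E G : fspace R) : Prop :=
  exists C : R, forall f, E f ->
    exists g, [/\ op f g, G g & fs_norm G g <= C * fs_norm E f].

Definition optimal_symmetric_range (R : realType)
    (op : (R -> R) -> (R -> R) -> Prop) (E G : fspace R) : Prop :=
  [/\ is_qB_symmetric G,
      bounded_operator op E G &
      forall F : fspace R, is_qB_symmetric F -> bounded_operator op E F ->
        fs_set G `<=` fs_set F].

(* Main.v *)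
(** Write [S] for the Calderon operator, [rearr f] for the decreasing
    rearrangement, and [J_k] for the dyadic block (2^-(k+1), 2^-k).

    Boundedness.  A finite dyadic martingale transform satisfies a weak (1,1)
    bound, and an exponential bound on functions bounded by 1; both follow by
    evaluating a midpoint-concave Bellman function along the martingale.  Cutting
    [f] at the levels [rearr f (2^k t)], applying the weak bound to the top part
    and the exponential bound to each layer, gives
    [rearr (T f) t <= C * S (rearr f) t].

    The space [S_E] is complete because a rapidly convergent series of
    nonnegative functions converges in [E] to an upper bound of its partial sums;
    dilation by 2^i costs only a factor 2^i in [S], so the rearrangement of an
    infinite sum is dominated by [S] of one element of [E].

    Minimality.  For decreasing [y] in [E] let [f] be y(4^-m) on [J_(2m)] and 0 on
    the odd blocks.  Since [f] vanishes on [J_(2m-1)], the increment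
    E_(2m) f - E_(2m-1) f is half the average of [f] over (0, 4^-m) on that
    interval, so on [J_(2n)] the function [T f] is at least half the sum of these
    averages for [m <= n], which dominates a multiple of [S y].  The odd blocks are filled
    by moving this minorant of [T f] from [J_(2n)] to the smaller block [J_(2n+1)],
    which decreases its rearrangement. *)

Require Import Defs.
From mathcomp Require Import all_boot all_order all_algebra.
From mathcomp Require Import all_classical all_reals all_analysis.
From mathcomp Require Import measurable_realfun lra.

Set Implicit Arguments.
Unset Strict Implicit.
Unset Printing Implicit Defensive.

Import Order.TTheory GRing.Theory Num.Theory.
Import numFieldNormedType.Exports.

Local Open Scope classical_set_scope.
Local Open Scope ring_scope.

(** * Decreasing rearrangements *)

Section Rearrangement.
Context {R : realType}.
Implicit Types (x y z : R -> R) (A B : set R) (s t : R).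
Notation mu := (@lebesgue_measure R).

(** Exponential decay is what makes the layers summable. Layer k lives on a set of measure about 2^k
    t, and its exceptional set must have measure about 2^-k t. The weak (1,1) bound would charge a
    factor 4^k in height for this. The exponential bound charges only a multiple of k + 1, and Abel
    summation then turns the weighted differences of levels into the plain sum of [rearr f (2^k t)],
    a Riemann sum for [S (rearr f) t].

    Being defined on [E] is part of boundedness, so the convergence in measure of the series for T f
    has to be proved too. The weak bound handles a part of f that is small in L1; a third Bellman
    function, y^2 - x^2, handles the bounded rest through orthogonality of increments.

    The inclusion of [E] in L1 is given only as one of sets. Completeness makes it bounded, and this
    is what shows that the quasi-norm of S_E vanishes only at 0.

    Conditional expectations are determined only almost everywhere. The lower bound for T f
    therefore has to hold for every admissible sequence of versions and every limit g, since
    boundedness into F merely supplies some g. *)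

Lemma measurable_I01 : measurable (I01 R).
Proof. exact: measurable_itv. Qed.
Hint Resolve measurable_I01 : core.

Lemma in_I01 (t : R) : I01 R t <-> 0 < t < 1.
Proof. by rewrite /I01 /= in_itv /=. Qed.

Lemma mu_I01 : mu (I01 R) = 1%:E.
Proof. by rewrite /I01 lebesgue_measure_itv /= lte_fin ltr01 oppr0 adde0. Qed.

(** A real-valued measure, so that estimates stay within reach of [lra]. On [mset01] sets [fine]
    loses nothing, because the total mass is 1. *)
Definition mI A : R := fine (mu (I01 R `&` A)).

Definition mset01 A := measurable (I01 R `&` A).

Lemma mIE A : mset01 A -> mu (I01 R `&` A) = (mI A)%:E.
Proof.
move=> mA; rewrite fineK // ge0_fin_numE //.
apply: (@le_lt_trans _ _ (mu (I01 R))); last by rewrite mu_I01 ltry.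
by apply: le_measure; rewrite ?inE //; exact: subIsetl.
Qed.

Lemma mI_ge0 A : 0 <= mI A.
Proof. by apply: fine_ge0; exact: measure_ge0. Qed.

Lemma mset01U A B : mset01 A -> mset01 B -> mset01 (A `|` B).
Proof. by rewrite /mset01 setIUr; exact: measurableU. Qed.

Lemma mset01I A B : mset01 A -> mset01 B -> mset01 (A `&` B).
Proof.
rewrite /mset01 => mA mB.
by rewrite -[I01 R]setIid setIACA; exact: measurableI.
Qed.

Lemma mset01W A : measurable A -> mset01 A.
Proof. by move=> mA; exact: measurableI. Qed.

Lemma mset01_bigcup (F : nat -> set R) :
  (forall i, mset01 (F i)) -> mset01 (\bigcup_i F i).
Proof. by move=> mF; rewrite /mset01 setI_bigcupr; apply: bigcupT_measurable. Qed.

Lemma le_mI A B : mset01 A -> mset01 B -> (forall u, I01 R u -> A u -> B u) ->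
  mI A <= mI B.
Proof.
move=> mA mB AB; rewrite -lee_fin -!mIE //.
by apply: le_measure; rewrite ?inE // => u [Iu Au]; split => //; exact: AB.
Qed.

Lemma mI_le1 A : mset01 A -> mI A <= 1.
Proof.
move=> mA; rewrite -lee_fin -mIE // -mu_I01.
by apply: le_measure; rewrite ?inE //; exact: subIsetl.
Qed.

Lemma mI_setU A B : mset01 A -> mset01 B -> mI (A `|` B) <= mI A + mI B.
Proof.
move=> mA mB; rewrite -lee_fin EFinD -!mIE //; last exact: mset01U.
by rewrite setIUr; exact: measureU2.
Qed.

Lemma mI0 : mI set0 = 0.
Proof. by rewrite /mI setI0 measure0. Qed.

Lemma mset01_set1 u : mset01 [set u].
Proof. by apply: mset01W; exact: measurable_set1. Qed.

Lemma mI_set1 u : mI [set u] = 0.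
Proof.
apply/eqP; rewrite eq_le mI_ge0 andbT -lee_fin -mIE; last exact: mset01_set1.
rewrite -[leRHS](lebesgue_measure_set1 u).
apply: le_measure; rewrite ?inE; [exact: mset01_set1|exact: measurable_set1|exact: subIsetr].
Qed.

Lemma mI_itv t : 0 <= t <= 1 -> mI [set u | u < t] = t.
Proof.
move=> /andP[t0 t1]; rewrite /mI.
have -> : I01 R `&` [set u | u < t] = `]0, t[%classic.
  apply/seteqP; split => u /=; rewrite /I01 /= !in_itv /=.
    by case=> /andP[-> _] ->.
  by move=> /andP[-> ut]; split; rewrite ?ut // (lt_le_trans ut t1).
rewrite lebesgue_measure_itv /= lte_fin.
by case: ltP => [t0'|]; rewrite ?oppr0 ?adde0 //= => t0'; apply/eqP; rewrite eq_le t0' t0.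
Qed.

Lemma mI_bigcup (F : nat -> set R) (d : nat -> R) (D : R) :
  (forall i, mset01 (F i)) -> (forall i, mI (F i) <= d i) ->
  (forall n, \sum_(0 <= i < n) d i <= D) -> mI (\bigcup_i F i) <= D.
Proof.
move=> mF Fd dD; rewrite -lee_fin -mIE; last exact: mset01_bigcup.
rewrite setI_bigcupr.
apply: le_trans.
  by apply: le_mu_bigcup => //; apply: bigcupT_measurable.
apply: lime_le.
  by apply: is_cvg_nneseries => n _ _; exact: measure_ge0.
apply: nearW => n; rewrite (le_trans (y := (\sum_(0 <= i < n) (d i)%:E)%E)) //.
  by apply: lee_sum => i _; by have := mIE (mF i) => /= ->; rewrite lee_fin.
by rewrite sumEFin lee_fin.
Qed.

Definition dist x s : R := mI [set u | s < `|x u|].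

Lemma mfun01_abs x : mfun01 x -> mfun01 (fun u => `|x u|).
Proof. by move=> mx; apply: measurableT_comp. Qed.

Lemma mset01_gt x s : mfun01 x -> mset01 [set u | s < x u].
Proof.
move=> mx; have := mx measurable_I01 `]s, +oo[%classic (measurable_itv _).
by rewrite /mset01; congr (measurable (_ `&` _)); apply/seteqP; split => u /=; rewrite in_itv /= andbT.
Qed.

Lemma mset01_ge x s : mfun01 x -> mset01 [set u | s <= x u].
Proof.
move=> mx; have := mx measurable_I01 `[s, +oo[%classic (measurable_itv _).
by rewrite /mset01; congr (measurable (_ `&` _)); apply/seteqP; split => u /=; rewrite in_itv /= andbT.
Qed.

Lemma mset01_dist x s : mfun01 x -> mset01 [set u | s < `|x u|].
Proof. by move=> mx; apply: mset01_gt; exact: mfun01_abs. Qed.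

Lemma distE x s : mfun01 x -> mu (I01 R `&` [set u | s < `|x u|]) = (dist x s)%:E.
Proof. by move=> mx; rewrite mIE //; exact: mset01_dist. Qed.

Lemma dist_ge0 x s : 0 <= dist x s. Proof. exact: mI_ge0. Qed.

Lemma dist_le1 x s : mfun01 x -> dist x s <= 1.
Proof. by move=> mx; apply: mI_le1; exact: mset01_dist. Qed.

Lemma le_dist x s s' : mfun01 x -> s <= s' -> dist x s' <= dist x s.
Proof.
move=> mx ss; apply: le_mI; [exact: mset01_dist..|].
by move=> u _ /=; exact: le_lt_trans.
Qed.

Lemma cvg_dist_y x : mfun01 x -> (fun n => dist x n%:R) @ \oo --> (0 : R).
Proof.
move=> mx.
have H : (fun n => mu (I01 R `&` [set u | n%:R < `|x u|])) @ \oo --> (0%:E : \bar R).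
  have -> : 0%:E = mu set0 by rewrite measure0.
  have := @nonincreasing_cvg_mu _ _ R mu (fun n => I01 R `&` [set u | n%:R < `|x u|]).
  have -> : \bigcap_n (I01 R `&` [set u | n%:R < `|x u|]) = set0.
    rewrite -subset0 => u /= /(_ (Num.bound `|x u|)) /(_ I) [_ /=].
    by apply/negP; rewrite -leNgt ltW // archi_boundP.
  apply => //.
  - by have := distE 0%:R mx => /= ->; rewrite ltry.
  - by move=> i; exact: mset01_dist.
  - move=> n m nm; rewrite subsetEset => u [Iu /=] h; split => //=.
    by rewrite (le_lt_trans _ h) // ler_nat.
exact: (fine_cvg H).
Qed.

(** Right continuity of the distribution function: the set above level s is the increasing union of
    the sets above s + 1/(n+1), and the measure is continuous from below. *)
Lemma distP x s t : mfun01 x -> (forall s', s < s' -> dist x s' <= t) ->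
  dist x s <= t.
Proof.
move=> mx H.
have -> : dist x s = mI (\bigcup_n [set u | s + n.+1%:R^-1 < `|x u|]).
  congr mI; apply/seteqP; split => u /=.
    move=> su; exists (Num.bound (`|x u| - s)^-1) => //=.
    rewrite -ltrBrDl invf_plt ?posrE ?subr_gt0 //.
    by rewrite (lt_trans (archi_boundP _)) ?invr_ge0 ?subr_ge0 ?ltW // ltr_nat.
  by move=> [n _ /=]; apply: le_lt_trans; rewrite lerDl.
rewrite -lee_fin -mIE; last by apply: mset01_bigcup => i; exact: mset01_dist.
rewrite setI_bigcupr.
have := @nondecreasing_cvg_mu _ _ R mu (fun n => I01 R `&` [set u | s + n.+1%:R^-1 < `|x u|]).
move=> /(_ _ _ _)/cvg_lim <- //.
- apply: lime_le.
    apply: ereal_nondecreasing_is_cvgn => n m nm /=.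
    rewrite !distE // lee_fin le_dist // lerD2l lef_pV2 ?posrE //.
    by rewrite ler_nat.
  by apply: nearW => n /=; rewrite distE // lee_fin H // ltrDl.
- by move=> i; exact: mset01_dist.
- by apply: bigcupT_measurable => i; exact: mset01_dist.
- move=> n m nm; rewrite subsetEset => u [Iu /= h]; split => //=.
  by apply: le_lt_trans h; rewrite lerD2l lef_pV2 ?posrE // ler_nat.
Qed.

Lemma rearr_set_ne x t : mfun01 x -> 0 < t ->
  [set s | 0 <= s /\ (mu (I01 R `&` [set u | (s < `|x u|)%R]) <= t%:E)%E] !=set0.
Proof.
move=> mx t0.
have /cvgrPdist_lt /(_ t t0) [n _ /(_ n (leqnn n))] := cvg_dist_y mx.
rewrite /= sub0r normrN ger0_norm ?dist_ge0 // => nt.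
by exists n%:R; split => //; rewrite distE // lee_fin ltW.
Qed.

Lemma rearr_ge0 x t : 0 <= rearr x t.
Proof.
rewrite /rearr; have [->|/set0P ne] := eqVneq
  [set s | 0 <= s /\ (mu (I01 R `&` [set u | (s < `|x u|)%R]) <= t%:E)%E] set0.
  by rewrite inf0.
by apply: lb_le_inf => // s [].
Qed.

(** The Galois connection between rearrangement and distribution function; right continuity makes
    the infimum attained. Bounds on [rearr] are proved below by passing through it to bounds on
    [dist]. *)
Lemma rearr_leP x s t : mfun01 x -> 0 < t -> 0 <= s ->
  (rearr x t <= s) = (dist x s <= t).
Proof.
move=> mx t0 s0; apply/idP/idP => [h|h].
  apply: distP => // s' ss'.
  have hi : has_inf [set s | 0 <= s /\ (mu (I01 R `&` [set u | (s < `|x u|)%R]) <= t%:E)%E].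
    by split; [exact: rearr_set_ne|exists 0 => r []].
  have e0 : 0 < s' - rearr x t by rewrite subr_gt0 (le_lt_trans h).
  have [r [r0 +]] := inf_adherent e0 hi.
  rewrite distE // lee_fin -/(rearr x t) addrC subrK => rt rs'.
  by rewrite (le_trans _ rt) // le_dist // ltW.
apply: ge_inf; first by exists 0 => r [].
by split => //; rewrite distE // lee_fin.
Qed.

Lemma rearr_gtP x s t : mfun01 x -> 0 < t -> 0 <= s ->
  (s < rearr x t) = (t < dist x s).
Proof. by move=> mx t0 s0; rewrite !ltNge rearr_leP. Qed.

Lemma dist_rearr_le x t : mfun01 x -> 0 < t -> dist x (rearr x t) <= t.
Proof. by move=> mx t0; rewrite -rearr_leP // rearr_ge0. Qed.

Lemma le_rearr x s t : mfun01 x -> 0 < s -> s <= t -> rearr x t <= rearr x s.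
Proof.
move=> mx s0 st; rewrite rearr_leP ?rearr_ge0 ?(lt_le_trans s0) //.
by apply: le_trans st; exact: dist_rearr_le.
Qed.

Lemma rearr_ge1 x t : mfun01 x -> 1 <= t -> rearr x t = 0.
Proof.
move=> mx t1; apply/eqP; rewrite eq_le rearr_ge0 andbT rearr_leP //.
  by rewrite (le_trans _ t1) // dist_le1.
by rewrite (lt_le_trans _ t1).
Qed.

Lemma rearr_dist_le x y t : mfun01 x -> mfun01 y -> 0 < t ->
  (forall s, 0 <= s -> dist x s <= dist y s) -> rearr x t <= rearr y t.
Proof.
move=> mx my t0 H; rewrite rearr_leP ?rearr_ge0 //.
by rewrite (le_trans (H _ _)) ?rearr_ge0 // dist_rearr_le.
Qed.

Lemma rearr_dist_eq x y t : mfun01 x -> mfun01 y -> 0 < t ->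
  (forall s, 0 <= s -> dist x s = dist y s) -> rearr x t = rearr y t.
Proof.
move=> mx my t0 H; apply/eqP; rewrite eq_le.
by rewrite !rearr_dist_le // => s s0; rewrite H.
Qed.

Lemma mfun01_rearr x : mfun01 x -> mfun01 (rearr x).
Proof.
move=> mx.
apply: (measurability _ (RGenOInfty.measurableE R)) => _ [_ [s ->] <-].
have [s0|s0] := ltP s 0.
  rewrite (_ : _ `&` _ = I01 R) //; apply/seteqP; split => u /= => [[]//|Iu].
  by split => //; rewrite in_itv /= andbT (lt_le_trans s0) // rearr_ge0.
rewrite (_ : _ `&` _ = I01 R `&` `]-oo, dist x s[%classic).
  by apply: measurableI => //; exact: measurable_itv.
apply/seteqP; split => u /= [Iu]; rewrite !in_itv /= ?andbT => h; split => //.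
  by rewrite -rearr_gtP //; case/in_I01/andP : Iu.
by rewrite rearr_gtP //; case/in_I01/andP : Iu.
Qed.
Arguments mfun01_rearr : clear implicits.

Lemma dist_rearr x s : mfun01 x -> 0 <= s -> dist (rearr x) s = dist x s.
Proof.
move=> mx s0; rewrite -[RHS]mI_itv ?dist_ge0 ?dist_le1 // /dist /mI.
congr (fine (mu _)); apply/seteqP; split => u /= [Iu].
  rewrite ger0_norm ?rearr_ge0 // => h; split => //.
  by rewrite -rearr_gtP //; case/in_I01/andP : Iu.
rewrite ger0_norm ?rearr_ge0 // => h; split => //.
by rewrite rearr_gtP //; case/in_I01/andP : Iu.
Qed.

Lemma rearr_rearr x t : mfun01 x -> 0 < t -> rearr (rearr x) t = rearr x t.
Proof.
move=> mx t0; apply: rearr_dist_eq => //; first exact: mfun01_rearr.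
by move=> s s0; exact: dist_rearr.
Qed.

Lemma distD x y s s' : mfun01 x -> mfun01 y ->
  dist (x \+ y) (s + s') <= dist x s + dist y s'.
Proof.
move=> mx my; apply: le_trans (mI_setU (mset01_dist s mx) (mset01_dist s' my)).
apply: le_mI; first by apply: mset01_dist; exact: measurable_funD.
  by apply: mset01U; exact: mset01_dist.
move=> u _ /= h; have [|xs] := ltP s `|x u|; [by left|right].
have := ler_normD (x u) (y u); lra.
Qed.

Lemma rearrD x y s t : mfun01 x -> mfun01 y -> 0 < s -> 0 < t ->
  rearr (x \+ y) (s + t) <= rearr x s + rearr y t.
Proof.
move=> mx my s0 t0; rewrite rearr_leP ?addr_ge0 ?rearr_ge0 ?addr_gt0 //; last exact: measurable_funD.
by rewrite (le_trans (distD _ _ _ _)) // lerD // dist_rearr_le.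
Qed.

Lemma mfun01Z (a : R) x : mfun01 x -> mfun01 (a \*o x).
Proof. by move=> mx; exact: measurable_funM. Qed.

Lemma distZ (a : R) x s : 0 < `|a| -> dist (a \*o x) (`|a| * s) = dist x s.
Proof.
move=> a0; rewrite /dist /mI; congr (fine (mu _)).
by apply/seteqP; split => u /= [Iu h]; split => //; move: h; rewrite normrM ltr_pM2l.
Qed.

Lemma rearrZ (a : R) x t : mfun01 x -> 0 < t -> rearr (a \*o x) t = `|a| * rearr x t.
Proof.
move=> mx t0; have max := mfun01Z a mx.
have [->|a0] := eqVneq a 0.
  rewrite normr0 mul0r; apply/eqP; rewrite eq_le rearr_ge0 andbT rearr_leP //; last exact: mfun01Z.
  rewrite /dist (_ : [set _ | _] = set0) ?mI0 ?ltW //.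
  by rewrite -subset0 => u /=; rewrite mul0r normr0 ltxx.
have a0' : 0 < `|a| by rewrite normr_gt0.
apply/eqP; rewrite eq_le; apply/andP; split.
  by rewrite rearr_leP ?mulr_ge0 ?rearr_ge0 // distZ // dist_rearr_le.
rewrite -ler_pdivlMl // rearr_leP ?mulr_ge0 ?invr_ge0 ?rearr_ge0 ?(ltW a0') //.
by rewrite -(distZ _ _ a0') mulVKf ?gt_eqF // dist_rearr_le.
Qed.

(* [filterS] does not find the filter instance of [{ae lebesgue_measure, _}]. *)
Lemma ae01S (P Q : R -> Prop) : (forall u, P u -> Q u) ->
  {ae mu, forall u, P u} -> {ae mu, forall u, Q u}.
Proof.
move=> PQ [A [mA A0 H]]; exists A; split => // u /= nQ; apply: H => /= Pu.
exact/nQ/PQ.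
Qed.

Lemma le_dist_ae x y s : mfun01 x -> mfun01 y ->
  {ae mu, forall u, I01 R u -> `|y u| <= `|x u|} -> dist y s <= dist x s.
Proof.
move=> mx my [N [mN N0 H]].
apply: (@le_trans _ _ (mI ([set u | s < `|x u|] `|` N))).
  apply: le_mI; [exact: mset01_dist|by apply: mset01U; [exact: mset01_dist|exact: mset01W]|].
  move=> u Iu /= h; have [Nu|Nu] := pselect (N u); [by right|left].
  apply: (lt_le_trans h); apply: contrapT => h'; apply: Nu; apply: H => /=.
  by move=> /(_ Iu).
rewrite (le_trans (mI_setU _ _)) //; [exact: mset01_dist|exact: mset01W|].
rewrite (_ : mI N = 0) ?addr0 //; apply/eqP; rewrite eq_le mI_ge0 andbT.
rewrite -lee_fin -mIE; last exact: mset01W.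
have -> : 0%:E = mu N by rewrite N0.
by apply: le_measure; rewrite ?inE //; exact: measurableI.
Qed.

Lemma rearr_ae_le x y t : mfun01 x -> mfun01 y -> 0 < t ->
  {ae mu, forall u, I01 R u -> `|y u| <= `|x u|} -> rearr y t <= rearr x t.
Proof.
by move=> mx my t0 H; apply: rearr_dist_le => // s _; exact: le_dist_ae.
Qed.

Lemma dist0_ae x : mfun01 x -> dist x 0 = 0 -> ae_eq mu (I01 R) x (cst 0).
Proof.
move=> mx d0; exists (I01 R `&` [set u | 0 < `|x u|]); split.
- exact: mset01_dist.
- by have := distE 0 mx; rewrite d0.
- move=> u /= h; apply: contrapT => h'; apply: h => Iu.
  apply: contrapT => /eqP xu; apply: h'; split => //=; by rewrite normr_gt0.
Qed.

Lemma dist_ae0 x s : mfun01 x -> ae_eq mu (I01 R) x (cst 0) -> 0 <= s -> dist x s = 0.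
Proof.
move=> mx x0 s0; apply/eqP; rewrite eq_le dist_ge0 andbT.
apply: (@le_trans _ _ (dist (cst 0) s)).
  apply: le_dist_ae => //; first exact: measurable_cst.
  by apply: filterS x0 => u /= h Iu; rewrite h.
rewrite /dist (_ : [set _ | _] = set0) ?mI0 // -subset0 => u /=.
by rewrite normr0 ltNge s0.
Qed.

End Rearrangement.

(** * The Calderon operator on integrable functions *)

Section Integrals.
Context {R : realType}.
Implicit Types (x y z g h : R -> R) (A B : set R) (s t : R).
Notation mu := (@lebesgue_measure R).
Local Hint Resolve measurable_I01 : core.

Lemma measurable_I01_ocitv : @measurable _ (measurableTypeR R) (I01 R).
Proof. exact: measurable_I01. Qed.
Local Hint Resolve measurable_I01_ocitv : core.

Lemma mu_I01_lty : (mu (I01 R) < +oo)%E.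
Proof. by rewrite mu_I01 ltry. Qed.

Lemma L1E x : L1 x = mu.-integrable (I01 R) (EFin \o x).
Proof. by []. Qed.

(** The sum counts the multiples of d below a, a discrete layer-cake formula whose error is at most
    one step d. [layer_ge] is the opposite bound. *)
Lemma layer_le (a d : R) n : 0 <= a -> 0 < d ->
  \sum_(0 <= k < n) d * (nat_of_bool (k%:R * d < a)%R)%:R <= a + d.
Proof.
move=> a0 d0; elim: n => [|n IH]; first by rewrite big_geq // addr_ge0 // ltW.
rewrite big_nat_recr //=; have [h|h] := ltP; last by rewrite mulr0 addr0.
have : \sum_(0 <= k < n) d * (nat_of_bool (k%:R * d < a)%R)%:R <= \sum_(0 <= k < n) d.
  apply: ler_sum => k _; rewrite ler_piMr ?(ltW d0) //.
  by case: (_ < _); rewrite ?lexx ?ler01.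
rewrite sumr_const_nat subn0 -(mulr_natl d) mulr1 => H; lra.
Qed.

Lemma layer_ge (a d : R) n : 0 < d -> a <= n%:R * d ->
  a <= \sum_(0 <= k < n) d * (nat_of_bool (k%:R * d < a)%R)%:R.
Proof.
move=> d0; elim: n a => [|n IH] a; first by rewrite big_geq // mul0r.
have [h _|h h'] := leP a (n%:R * d).
  apply: (le_trans (IH _ h)); rewrite big_nat_recr //= lerDl mulr_ge0 //.
  exact: ltW.
rewrite (le_trans h') // big_nat_recr //= h mulr1 -natr1 mulrDl mul1r lerD2r.
have -> : n%:R * d = \sum_(0 <= i < n) d by rewrite sumr_const_nat subn0 mulr_natl.
rewrite !big_nat; apply: ler_sum => k kn.
rewrite (lt_trans _ h) ?mulr1 // ltr_pM2r // ltr_nat; by case/andP: kn.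
Qed.

(** Both integrals are compared with the step-d layer sums of the distribution functions. The error
    d is integrated over a set of measure 1, and d is arbitrary. *)
Lemma int_dist_le x y : mfun01 x -> mfun01 y ->
  (forall s, 0 <= s -> dist x s <= dist y s) ->
  (\int[mu]_(u in I01 R) `|x u|%:E <= \int[mu]_(u in I01 R) `|y u|%:E)%E.
Proof.
move=> mx my H; apply/lee_addgt0Pr => d d0.
pose S z k := I01 R `&` [set u | k%:R * d < `|z u|].
pose F z (k : nat) u : \bar R := (d * \1_(S z k) u)%:E.
have mS z k : mfun01 z -> measurable (S z k) by exact: mset01_dist.
have mF z k : mfun01 z -> measurable_fun (I01 R) (F z k).
  move=> mz; apply/measurable_EFinP/measurable_funM => //.
  by apply: measurable_indic; exact: mS.
have F0 z k u : (0 <= F z k u)%E.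
  by rewrite lee_fin mulr_ge0 // ltW.
have intF z k : mfun01 z -> (\int[mu]_(u in I01 R) F z k u = (d * dist z (k%:R * d))%:E)%E.
  move=> mz; rewrite /F.
  under eq_integral do rewrite EFinM.
  rewrite ge0_integralZl_EFin ?ltW //.
  - rewrite integral_indic //; last exact: mS.
    have -> : S z k `&` I01 R = S z k by rewrite setIC setIA setIid.
    by have := distE (k%:R * d) mz => /= ->; rewrite EFinM.
  - by apply/measurable_EFinP; apply: measurable_indic; exact: mS.
have FE z k u : I01 R u -> F z k u = (d * (nat_of_bool (k%:R * d < `|z u|)%R)%:R)%:E.
  move=> Iu; rewrite /F indicE; congr (_ * _%:R)%:E.
  by have [h|h] := boolP (k%:R * d < _)%R; [rewrite mem_set|rewrite memNset // => -[_ /=]; exact/negP].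
have part n : \sum_(0 <= k < n) d * dist y (k%:R * d) <= fine (\int[mu]_(u in I01 R) `|y u|%:E) + d \/ (\int[mu]_(u in I01 R) `|y u|%:E = +oo)%E.
  have [yoo|yoo] := eqVneq (\int[mu]_(u in I01 R) `|y u|%:E)%E +oo%E; [by right|left].
  have yfin : (\int[mu]_(u in I01 R) `|y u|%:E)%E \is a fin_num.
    by rewrite ge0_fin_numE ?lt_neqAle ?yoo ?leey //; apply: integral_ge0 => u _; rewrite lee_fin.
  rewrite -lee_fin EFinD fineK // -sumEFin.
  under eq_bigr do rewrite -intF //.
  rewrite -ge0_integral_sum //; last by move=> k; exact: mF.
  have -> : d%:E = (\int[mu]_(u in I01 R) (cst d%:E u))%E.
    by rewrite integral_cst //; have := @mu_I01 R => /= ->; rewrite mule1.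
  rewrite -ge0_integralD //; last 2 first.
  - by apply/measurable_EFinP; exact: mfun01_abs.
  - by move=> u _; rewrite lee_fin ltW.
  apply: ge0_le_integral => //.
  - by move=> u _; apply: sume_ge0.
  - by apply: emeasurable_sum => k; exact: mF.
  - by apply/measurable_EFinP; apply: measurable_funD => //; exact: mfun01_abs.
  move=> u Iu /=; rewrite (eq_bigr (fun k => (d * (nat_of_bool (k%:R * d < `|y u|)%R)%:R)%:E)); last by move=> k _; exact: FE.
  by rewrite sumEFin -EFinD lee_fin; exact: layer_le.
have [yoo|yoo] := eqVneq (\int[mu]_(u in I01 R) `|y u|%:E)%E +oo%E.
  by rewrite yoo leey.
have yfin : (\int[mu]_(u in I01 R) `|y u|%:E)%E \is a fin_num.
  by rewrite ge0_fin_numE ?lt_neqAle ?yoo ?leey //; apply: integral_ge0 => u _; rewrite lee_fin.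
apply: (@le_trans _ _ (\int[mu]_(u in I01 R) (\sum_(k <oo) F x k u))%E).
  apply: ge0_le_integral => //.
  - by apply/measurable_EFinP; exact: mfun01_abs.
  - by apply: ge0_emeasurable_sum => // k _; exact: mF.
  move=> u Iu /=; pose n := Num.bound (`|x u| / d).
  apply: (@le_trans _ _ (\sum_(0 <= k < n) F x k u)%E); last exact: nneseries_lim_ge.
  rewrite (eq_bigr (fun k => (d * (nat_of_bool (k%:R * d < `|x u|)%R)%:R)%:E)); last by move=> k _; exact: FE.
  rewrite sumEFin lee_fin; apply: layer_ge => //.
  by rewrite -ler_pdivrMr // ltW // archi_boundP // divr_ge0 // ltW.
rewrite integral_nneseries //; last by move=> k; exact: mF.
apply: lime_le; first by apply: is_cvg_nneseries => n _ _; exact: integral_ge0.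
apply: nearW => n; under eq_bigr do rewrite intF //.
rewrite sumEFin; case: (part n) => [h|/eqP]; last by rewrite (negbTE yoo).
rewrite -(fineK yfin) -EFinD lee_fin; apply: le_trans h.
by apply: ler_sum => k _; rewrite ler_pM2l //; apply: H; rewrite mulr_ge0 // ltW.
Qed.

Lemma L1_mfun x : L1 x -> mfun01 x.
Proof. by move=> /measurable_int/measurable_EFinP. Qed.

Lemma L1P x : mfun01 x -> (\int[mu]_(u in I01 R) `|x u|%:E < +oo)%E -> L1 x.
Proof. by move=> mx h; apply/integrableP; split => //; exact/measurable_EFinP. Qed.

Lemma L1_le x y : mfun01 x -> L1 y -> (forall u, I01 R u -> `|x u| <= `|y u|) -> L1 x.
Proof.
rewrite !L1E => mx iy h; by apply: le_integrable iy => //; exact/measurable_EFinP.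
Qed.

Lemma L1_cst (c : R) : L1 (cst c).
Proof.
rewrite L1E; apply: measurable_bounded_integrable => //.
  exact: mu_I01_lty.
by exists `|c|; split => // M cM u _; exact: ltW. Qed.

Lemma L1D x y : L1 x -> L1 y -> L1 (x \+ y).
Proof. by rewrite !L1E => ix iy; have := integrableD measurable_I01_ocitv ix iy. Qed.

Lemma L1B x y : L1 x -> L1 y -> L1 (x \- y).
Proof. by rewrite !L1E => ix iy; have := integrableB measurable_I01_ocitv ix iy. Qed.

Lemma L1Z (a : R) x : L1 x -> L1 (a \*o x).
Proof. by rewrite !L1E => ix; have := integrableZl measurable_I01_ocitv a ix. Qed.

Lemma L1_abs x : L1 x -> L1 (fun u => `|x u|).
Proof. by move=> ix; exact: (integrable_norm ix). Qed.

Lemma L1_sub x A : measurable A -> A `<=` I01 R -> L1 x -> mu.-integrable A (EFin \o x).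
Proof. by rewrite L1E => mA AI; apply: integrableS. Qed.

Definition I1 x : R := \int[mu]_(u in I01 R) x u.

Lemma I1_dist_le x y : L1 y -> mfun01 x -> (forall s, 0 <= s -> dist x s <= dist y s) ->
  L1 x /\ I1 (fun u => `|x u|) <= I1 (fun u => `|y u|).
Proof.
move=> iy mx H; have h := int_dist_le mx (L1_mfun iy) H.
have yoo : (\int[mu]_(u in I01 R) `|y u|%:E < +oo)%E by case/integrableP: iy.
split; first by apply: L1P => //; exact: le_lt_trans yoo.
rewrite /I1 /Rintegral fine_le //.
- by rewrite ge0_fin_numE ?(le_lt_trans h) //; apply: integral_ge0 => u _; rewrite lee_fin.
- by rewrite ge0_fin_numE //; apply: integral_ge0 => u _; rewrite lee_fin.
Qed.

Lemma le_I1 x y : L1 x -> L1 y -> (forall u, I01 R u -> x u <= y u) -> I1 x <= I1 y.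
Proof. by move=> ix iy h; apply: (le_Rintegral measurable_I01_ocitv ix iy h). Qed.

Lemma I1D x y : L1 x -> L1 y -> I1 (x \+ y) = I1 x + I1 y.
Proof. by rewrite !L1E => ix iy; apply: RintegralD. Qed.

Lemma I1Z (a : R) x : L1 x -> I1 (a \*o x) = a * I1 x.
Proof. by rewrite !L1E => ix; apply: RintegralZl. Qed.

Lemma I1_cst (c : R) : I1 (cst c) = c.
Proof. by rewrite /I1 Rintegral_cst //; have := @mu_I01 R => /= ->; rewrite mulr1. Qed.

Lemma L1_sum (F : nat -> R -> R) (r : seq nat) : (forall i, L1 (F i)) ->
  L1 (fun u => \sum_(i <- r) F i u).
Proof.
move=> iF; elim: r => [|i r IH].
  rewrite (_ : (fun _ => _) = cst 0); first exact: L1_cst.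
  by apply/funext => u; rewrite big_nil.
rewrite (_ : (fun _ => _) = F i \+ (fun u => \sum_(i <- r) F i u)).
  exact: L1D.
by apply/funext => u; rewrite big_cons.
Qed.

Lemma I1_sum (F : nat -> R -> R) (r : seq nat) : (forall i, L1 (F i)) ->
  I1 (fun u => \sum_(i <- r) F i u) = \sum_(i <- r) I1 (F i).
Proof.
move=> iF; elim: r => [|i r IH].
  rewrite big_nil (_ : (fun _ => _) = cst 0); first exact: I1_cst.
  by apply/funext => u; rewrite big_nil.
rewrite big_cons -IH (_ : (fun _ => _) = F i \+ (fun u => \sum_(i <- r) F i u)).
  by rewrite I1D //; exact: L1_sum.
by apply/funext => u; rewrite big_cons.
Qed.

Lemma I1_ge0 x : (forall u, I01 R u -> 0 <= x u) -> 0 <= I1 x.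
Proof. by move=> h; exact: Rintegral_ge0. Qed.

(** The Calderon operator is the integral operator with kernel 1/max(s,t). Linearity, monotonicity
    and the dilation bound are all read off from this kernel. *)
Definition ker t s : R := (Num.max s t)^-1.

Lemma ker_ge0 t s : 0 < t -> 0 <= ker t s.
Proof. by move=> t0; rewrite /ker invr_ge0 le_max (ltW t0) orbT. Qed.

Lemma ker_le t s : 0 < t -> ker t s <= t^-1.
Proof.
move=> t0; rewrite /ker lef_pV2 ?posrE // ?lt_max ?t0 ?orbT //.
by rewrite le_max lexx orbT.
Qed.

Lemma mfun01_ker t : 0 < t -> mfun01 (ker t).
Proof.
move=> t0; apply: nonincreasing_measurable => // a b ab.
rewrite /ker lef_pV2 ?posrE ?lt_max ?t0 ?orbT //.
by rewrite ge_max !le_max ab lexx orbT.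
Qed.

Lemma L1_ker t g : 0 < t -> L1 g -> L1 (fun s => g s * ker t s).
Proof.
move=> t0 ig; have mg := L1_mfun ig.
apply: (L1_le _ (L1Z t^-1 ig)).
  by apply: measurable_funM => //; exact: mfun01_ker.
move=> u Iu /=; rewrite !normrM mulrC ler_wpM2r //.
rewrite ger0_norm ?ker_ge0 // [leRHS]ger0_norm ?invr_ge0 ?(ltW t0) //.
exact: ker_le.
Qed.

Lemma calderonE t g : L1 g -> I01 R t -> calderon g t = I1 (fun s => g s * ker t s).
Proof.
move=> ig It; have /andP[t0 t1] : 0 < t < 1 by exact/in_I01.
have ik := L1_ker t0 ig.
have IE : I01 R = `]0, t[%classic `|` `[t, 1[%classic.
  apply/seteqP; split => u /=; rewrite /I01 /= !in_itv /=.
    by move=> /andP[-> ->]; rewrite andbT; case: (ltP u t) => h; [left|right].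
  case=> /andP[a b]; apply/andP; split => //.
    exact: lt_trans b t1.
  exact: lt_le_trans t0 a.
have s1 : `]0, t[%classic `<=` I01 R by rewrite IE; exact: subsetUl.
rewrite /I1 [in RHS]IE Rintegral_setU //; last 2 first.
- by rewrite -IE.
- apply/disj_setPRL => u /=; rewrite !in_itv /= => /andP[tu _]; apply/negP.
  by rewrite negb_and -!leNgt tu orbT.
rewrite /calderon; congr (_ + _).
  rewrite -RintegralZl //; last exact: L1_sub.
  apply: eq_Rintegral => u; rewrite inE /= in_itv /= => /andP[u0 ut].
  by rewrite /ker max_r ?ltW // mulrC.
rewrite Rintegral_itv_obnd_cbnd.
  apply: eq_Rintegral => u; rewrite inE /= in_itv /= => /andP[tu u1].
  by rewrite /ker max_l.
have : mu.-integrable `]t, 1[ (EFin \o (fun s => g s * ker t s)).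
  apply: (@L1_sub _ `]t, 1[%classic _ _ ik); first exact: measurable_itv.
  by move=> u /=; rewrite /I01 /= !in_itv /= => /andP[tu ->]; rewrite (lt_trans t0 tu).
apply: eq_integrable; first exact: measurable_itv.
move=> u; rewrite inE /= in_itv /= => /andP[tu u1].
by rewrite /ker max_l // ltW.
Qed.

Lemma calderon_ge0 t g : L1 g -> I01 R t -> (forall s, I01 R s -> 0 <= g s) -> 0 <= calderon g t.
Proof.
move=> ig It g0; rewrite calderonE //; apply: I1_ge0 => u Iu.
by rewrite mulr_ge0 ?g0 // ker_ge0 //; case/in_I01/andP : It.
Qed.

Lemma le_calderon t g h : L1 g -> L1 h -> I01 R t ->
  (forall s, I01 R s -> g s <= h s) -> calderon g t <= calderon h t.
Proof.
move=> ig ih It gh; have t0 : 0 < t by case/in_I01/andP : It.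
rewrite !calderonE //; apply: le_I1; [exact: L1_ker..|].
by move=> u Iu; rewrite ler_wpM2r ?ker_ge0 // gh.
Qed.

Lemma calderonD t g h : L1 g -> L1 h -> I01 R t ->
  calderon (g \+ h) t = calderon g t + calderon h t.
Proof.
move=> ig ih It; have t0 : 0 < t by case/in_I01/andP : It.
rewrite !calderonE //; last exact: L1D.
rewrite -I1D; [|exact: L1_ker..].
by congr I1; apply/funext => u /=; rewrite mulrDl.
Qed.

Lemma calderonZ t (a : R) g : L1 g -> I01 R t ->
  calderon (a \*o g) t = a * calderon g t.
Proof.
move=> ig It; have t0 : 0 < t by case/in_I01/andP : It.
rewrite !calderonE //; last exact: L1Z.
rewrite -I1Z; last exact: L1_ker.
by congr I1; apply/funext => u /=; rewrite mulrA.
Qed.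

(** For r <= 1 one has r max(s,t) <= max(s, r t), so the kernel at r t is at most 1/r times the
    kernel at t. *)
Lemma calderon_dil t (r : R) g : L1 g -> I01 R t -> 0 < r <= 1 ->
  (forall s, I01 R s -> 0 <= g s) -> calderon g (r * t) <= r^-1 * calderon g t.
Proof.
move=> ig It /andP[r0 r1] g0; have /andP[t0 t1] : 0 < t < 1 by exact/in_I01.
have Irt : I01 R (r * t).
  by apply/in_I01; rewrite mulr_gt0 //= (le_lt_trans _ t1) // ler_piMl // ltW.
have rt0 : 0 < r * t by rewrite mulr_gt0.
rewrite !calderonE // -I1Z; last exact: L1_ker.
apply: le_I1; [exact: L1_ker|by apply: L1Z; exact: L1_ker|].
move=> u Iu /=; rewrite mulrCA ler_wpM2l ?g0 //.
have /andP[u0 _] : 0 < u < 1 by exact/in_I01.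
rewrite /ker -invfM lef_pV2 ?posrE ?mulr_gt0 ?lt_max ?u0 //.
rewrite maxr_pMr ?(ltW r0) // ge_max !le_max lexx orbT andbT.
by rewrite ler_piMl // ltW.
Qed.

Lemma calderon_le_int t g : L1 g -> I01 R t ->
  (forall s, I01 R s -> 0 <= g s) -> t * calderon g t <= I1 g.
Proof.
move=> ig It g0; have /andP[t0 t1] : 0 < t < 1 by exact/in_I01.
rewrite calderonE // -I1Z; last exact: L1_ker.
apply: le_I1 => //; first by apply: L1Z; exact: L1_ker.
move=> u Iu /=; rewrite mulrCA ler_piMr ?g0 // -ler_pdivlMl // mulr1.
exact: ker_le.
Qed.

(** Nonnegative, nonincreasing and right continuous; for a monotone function the last clause is
    right continuity. Unlike the set of rearrangements of given functions, this class is visibly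
    stable under sums and nonnegative multiples. *)
Definition decr01 z := [/\ forall t, I01 R t -> 0 <= z t,
  forall s t, I01 R s -> I01 R t -> s <= t -> z t <= z s &
  forall t s, I01 R t -> s < z t -> exists t', [/\ I01 R t', t < t' & s < z t']].

Lemma decr01_rearr x : mfun01 x -> decr01 (rearr x).
Proof.
move=> mx; split.
- by move=> t _; exact: rearr_ge0.
- by move=> s t /in_I01/andP[s0 _] _ st; exact: le_rearr.
- move=> t s /in_I01/andP[t0 t1]; have [s0|s0] := ltP s 0.
    move=> _; exists ((t + 1) / 2); split; [apply/in_I01; lra|lra|].
    by rewrite (lt_le_trans s0) // rearr_ge0.
  rewrite rearr_gtP // => h; exists ((t + dist x s) / 2).
  have d1 := dist_le1 s mx.
  split; [apply/in_I01; lra|lra|]; rewrite rearr_gtP //; lra.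
Qed.

Lemma decr01D x y : decr01 x -> decr01 y -> decr01 (x \+ y).
Proof.
move=> [x0 xd xr] [y0 yd yr]; split => /=.
- by move=> t It; rewrite addr_ge0 ?x0 ?y0.
- by move=> s t Is It st; rewrite lerD ?xd ?yd.
- move=> t s It h; pose e := (x t + y t - s) / 2.
  have [a [Ia ta xa]] := xr t (x t - e) It ltac:(rewrite /e; lra).
  have [b [Ib tb yb]] := yr t (y t - e) It ltac:(rewrite /e; lra).
  have Im : I01 R (Num.min a b) by case: (leP a b).
  exists (Num.min a b); split => //; first by rewrite lt_min ta.
  have xa' : x a <= x (Num.min a b) by apply: xd => //; rewrite ge_min lexx.
  have yb' : y b <= y (Num.min a b) by apply: yd => //; rewrite ge_min lexx orbT.
  move: xa yb; rewrite /e; lra.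
Qed.

Lemma decr01Z (a : R) x : 0 <= a -> decr01 x -> decr01 (a \*o x).
Proof.
move=> a0 [x0 xd xr]; split => /=.
- by move=> t It; rewrite mulr_ge0 ?x0.
- by move=> s t Is It st; rewrite ler_wpM2l // xd.
- move=> t s It; have [->|an0] := eqVneq a 0.
    rewrite mul0r => s0; have /andP[t0 t1] : 0 < t < 1 by exact/in_I01.
    exists ((t + 1) / 2); split; [apply/in_I01; lra|lra|by rewrite mul0r].
  have {}a0 : 0 < a by rewrite lt_neqAle eq_sym an0.
  rewrite -ltr_pdivrMl // => /(xr _ _ It) [t' [It' tt' h]].
  by exists t'; split => //; rewrite -ltr_pdivrMl.
Qed.

(** If [rearr z t < z t], right continuity keeps z above the level [rearr z t] on an interval (0,
    t') with t' > t, and the distribution function at this level would exceed t. *)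
Lemma decr01_le_rearr z t : mfun01 z -> decr01 z -> I01 R t -> z t <= rearr z t.
Proof.
move=> mz [z0 zd zr] It; rewrite leNgt; apply/negP => /(zr _ _ It) [t' [It' tt' h]].
have /andP[t0 _] : 0 < t < 1 by exact/in_I01.
have := dist_rearr_le mz t0; apply/negP; rewrite -ltNge.
apply: (lt_le_trans tt'); have /andP[t'0 t'1] : 0 < t' < 1 by exact/in_I01.
have E : t' = mI [set u | u < t'] by rewrite mI_itv // (ltW t'0) ltW.
rewrite {1}E; apply: le_mI; [|exact: mset01_dist|].
  rewrite (_ : [set u | u < t'] = `]-oo, t'[%classic).
    by apply: mset01W; exact: measurable_itv.
  by apply/seteqP; split => u /=; rewrite in_itv.
move=> u Iu /= ut; rewrite ger0_norm ?z0 // (lt_le_trans h) // zd // ltW //.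
Qed.

End Integrals.

(** * Measurable sums of series and their tails *)

Section MeasurableLimit.
Context {R : realType}.
Implicit Types (d : nat -> R -> R) (e : nat -> R).
Notation mu := (@lebesgue_measure R).

Lemma sum_addl (F : nat -> R) K n :
  \sum_(K <= k < K + n) F k = \sum_(0 <= k < n) F (K + k)%N.
Proof.
have := @big_addn R 0 +%R 0%N (K + n)%N K xpredT F; rewrite add0n addKn => ->.
by apply: eq_bigr => k _; rewrite addnC.
Qed.

Lemma sum_half (t : R) n : 0 <= t -> \sum_(0 <= i < n) 2^-1 ^+ i.+1 * t <= t.
Proof.
move=> t0; suff -> : \sum_(0 <= i < n) 2^-1 ^+ i.+1 * t = t - 2^-1 ^+ n * t.
  by rewrite gerBl mulr_ge0 // exprn_ge0.
elim: n => [|n IH]; first by rewrite big_geq // expr0 mul1r subrr.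
by rewrite big_nat_recr //= IH exprS; lra.
Qed.

(** A limsup is measurable and defined everywhere, with no convergence hypothesis; it equals the sum
    wherever the series converges. An infinite limsup is sent to 0 by [fine]. *)
Definition lims d u : R := fine (limn_esup (fun n => (\sum_(0 <= k < n) d k u)%:E)).

Lemma mfun01_sum d n m : (forall k, mfun01 (d k)) -> mfun01 (fun u => \sum_(m <= k < n) d k u).
Proof. by move=> md; apply: measurable_sum => k; exact: md. Qed.

Lemma mfun01_lims d : (forall k, mfun01 (d k)) -> mfun01 (lims d).
Proof.
move=> md; apply: (@measurableT_comp _ _ _ _ _ _ fine) => //.
apply: measurable_fun_limn_esup => n; apply/measurable_EFinP; exact: mfun01_sum.
Qed.

Lemma lims_tail d e K B u : (forall k, (K <= k)%N -> `|d k u| <= e k) ->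
  (forall n, (K <= n)%N -> \sum_(K <= k < n) e k <= B) ->
  `|lims d u - \sum_(0 <= k < K) d k u| <= B.
Proof.
move=> de eB; pose d' k := d (K + k)%N u; pose e' k := e (K + k)%N.
have de' k : `|d' k| <= e' k by apply: de; exact: leq_addr.
have e'0 k : 0 <= e' k by exact: le_trans (de' k).
have se' n : series e' n <= B.
  rewrite /series /= (le_trans _ (eB (K + n)%N (leq_addr _ _))) //.
  by rewrite sum_addl.
have ce' : cvgn (series e').
  apply: nondecreasing_is_cvgn.
    by apply: nondecreasing_series => n _ _.
  by exists B => _ [n _ <-].
have cd' : cvgn (series d').
  by apply: normed_cvg; apply: (series_le_cvg _ _ _ ce') => n //=; exact: normr_ge0.
pose l := limn (series d').
have lB : `|l| <= B.
  have lN : (fun n => `|series d' n|) @ \oo --> `|l| by apply: cvg_norm; exact: cd'.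
  rewrite -(cvg_lim _ lN) //; apply: limr_le; first exact: cvgP lN.
  apply: nearW => n; apply: le_trans (se' n).
  by rewrite /series /= (le_trans (ler_norm_sum _ _ _)) // ler_sum.
have cS : (fun n => \sum_(0 <= k < n) d k u) @ \oo --> \sum_(0 <= k < K) d k u + l.
  rewrite -(cvg_shiftn K) /=.
  have -> : (fun n => \sum_(0 <= k < n + K) d k u) = (fun n => \sum_(0 <= k < K) d k u + series d' n).
    apply/funext => n; rewrite (big_cat_nat (n := K)) //= ?leq_addl //; congr (_ + _).
    by rewrite -{1}[K]add0n big_addn addnK /series /=; under eq_bigr do rewrite addnC.
  by apply: cvgD; [exact: cvg_cst|exact: cd'].
have -> : lims d u = \sum_(0 <= k < K) d k u + l.
  have cE : (fun n => (\sum_(0 <= k < n) d k u)%:E) @ \oo --> (\sum_(0 <= k < K) d k u + l)%:E.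
    by apply/fine_cvgP; split; [exact: nearW|exact: cS].
  by rewrite /lims; have [_ ->] := cvg_limn_einf_sup cE.
by rewrite addrC addKr.
Qed.

(** A Borel-Cantelli argument: off the union of the sets where |d k| > e k, of measure at most D,
    the tail is bounded pointwise by B. *)
Lemma dist_lims d e (dl : nat -> R) K B D : (forall k, mfun01 (d k)) ->
  (forall k, (K <= k)%N -> dist (d k) (e k) <= dl k) ->
  (forall n, (K <= n)%N -> \sum_(K <= k < n) e k <= B) ->
  (forall n, (K <= n)%N -> \sum_(K <= k < n) dl k <= D) ->
  dist (lims d \- (fun u => \sum_(0 <= k < K) d k u)) B <= D.
Proof.
move=> md dd eB dD.
have ml : mfun01 (lims d \- (fun u => \sum_(0 <= k < K) d k u)).
  by apply: measurable_funB; [exact: mfun01_lims|exact: mfun01_sum].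
apply: (@le_trans _ _ (mI (\bigcup_i [set u | e (K + i)%N < `|d (K + i)%N u|]))).
  apply: le_mI; first exact: mset01_dist.
    by apply: mset01_bigcup => i; exact: mset01_dist.
  move=> u Iu /= hu; apply: contrapT => h; move: hu; apply/negP; rewrite -leNgt.
  apply: (@lims_tail d e) => // k Kk; rewrite leNgt; apply/negP => h'; apply: h.
  by exists (k - K)%N => //=; rewrite subnKC.
apply: (@mI_bigcup _ _ (fun i => dl (K + i)%N)).
- by move=> i; exact: mset01_dist.
- by move=> i; apply: dd; exact: leq_addr.
- move=> n; rewrite (le_trans _ (dD (K + n)%N (leq_addr _ _))) //.
  by rewrite sum_addl.
Qed.

End MeasurableLimit.

(** * Series in a quasi-Banach symmetric space *)

Section SymmetricSpace.
Context {R : realType} (E : fspace R) (qE : is_qB_symmetric E).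
Implicit Types (x y : R -> R).
Notation mu := (@lebesgue_measure R).
Notation N := (fs_norm E).

Let qN : is_quasi_normed_space E := qbs_quasi_normed qE.

Lemma fs_mfun x : E x -> mfun01 x. Proof. exact: (qn_measurable qN). Qed.

Lemma fs_ge0 x : E x -> 0 <= N x. Proof. exact: (qn_ge0 qN). Qed.

Lemma fs_constant : exists C : R, 1 <= C /\
  forall x y, E x -> E y -> N (x \+ y) <= C * (N x + N y).
Proof.
have [C HC] := qn_triangle qN; exists (Num.max 1 C); split; first by rewrite le_max lexx.
move=> x y Ex Ey; apply: (le_trans (HC _ _ Ex Ey)).
by rewrite ler_wpM2r ?addr_ge0 ?fs_ge0 // le_max lexx orbT.
Qed.

Lemma fsN x : E x -> E (\- x) /\ N (\- x) = N x.
Proof.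
have -> : \- x = (-1) \*o x by apply/funext => u /=; rewrite mulN1r.
move=> Ex; split; first exact: (qn_memZ qN).
by rewrite (qn_homogeneous qN) // normrN normr1 mul1r.
Qed.

Lemma fsB x y : E x -> E y -> E (x \- y).
Proof. by move=> Ex Ey; apply: (qn_memD qN) => //; exact: (fsN Ey).1. Qed.

Lemma fsBC x y : E x -> E y -> N (x \- y) = N (y \- x).
Proof.
move=> Ex Ey; rewrite -(fsN (fsB Ey Ex)).2; congr N.
by apply/funext => u /=; rewrite opprB.
Qed.

Lemma fs_rearr x : E x -> E (rearr x) /\ N (rearr x) = N x.
Proof.
move=> Ex; have mx := fs_mfun Ex; apply: (qbs_symmetric qE) => //.
  exact: mfun01_rearr.
by move=> t /in_I01/andP[t0 _]; exact: rearr_rearr.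
Qed.

Lemma fs_sum (z : nat -> R -> R) m n : (forall i, E (z i)) ->
  E (fun u => \sum_(m <= i < n) z i u).
Proof.
move=> Ez; rewrite /index_iota; elim: (iota _ _) => [|i s IH].
  rewrite (_ : (fun _ => _) = cst 0); first exact: (qn_mem0 qN).
  by apply/funext => u; rewrite big_nil.
rewrite (_ : (fun _ => _) = z i \+ (fun u => \sum_(i <- s) z i u)).
  exact: (qn_memD qN).
by apply/funext => u; rewrite big_cons.
Qed.

(** Peeling off one term costs the quasi-triangle constant C on the rest. The ratio 1/(2C) absorbs
    it and still halves, so the bound does not depend on the number of terms. *)
Lemma fs_tail (C M : R) (z : nat -> R -> R) : 1 <= C ->
  (forall x y, E x -> E y -> N (x \+ y) <= C * (N x + N y)) ->
  (forall i, E (z i)) -> (forall i, N (z i) <= M * (2 * C)^-1 ^+ i) ->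
  forall n m, N (fun u => \sum_(m <= i < m + n) z i u) <= 2 * M * C * (2 * C)^-1 ^+ m.
Proof.
move=> C1 HC Ez Mz; have M0 : 0 <= M.
  by have := Mz 0%N; rewrite expr0 mulr1; apply: le_trans; exact: fs_ge0.
have C0 : 0 < C by lra.
elim=> [|n IH] m.
  rewrite (_ : (fun _ => _) = cst 0).
    rewrite (proj2 (qn_eq0 qN (qn_mem0 qN))); last exact: aeW.
    by rewrite !mulr_ge0 ?exprn_ge0 ?invr_ge0 ?mulr_ge0 ?(ltW C0).
  by apply/funext => u; rewrite addn0 big_geq.
rewrite (_ : (fun _ => _) = z m \+ (fun u => \sum_(m.+1 <= i < m.+1 + n) z i u)).
  apply: (le_trans (HC _ _ _ _)) => //; first exact: fs_sum.
  have := Mz m; have := IH m.+1; set a := N _; set b := N _.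
  rewrite exprS => h1 h2.
  have -> : 2 * M * C * (2 * C)^-1 ^+ m = C * (M * (2 * C)^-1 ^+ m + M * (2 * C)^-1 ^+ m) by lra.
  rewrite ler_pM2l // addrC lerD // (le_trans h1) //.
  set q := (2 * C)^-1; set p := q ^+ m.
  have -> : 2 * M * C * (q * p) = M * p * (2 * C * q) by lra.
  by rewrite mulfV ?mulr1 // gt_eqF // mulr_gt0.
by apply/funext => u /=; rewrite addSnnS big_ltn // -addSnnS leq_addr.
Qed.

Lemma geom_small (q a e : R) : 0 <= q < 1 -> 0 < e -> exists n, a * q ^+ n < e.
Proof.
move=> /andP[q0 q1] e0.
have : (fun n => a * q ^+ n) @ \oo --> a * 0.
  by apply: cvgM; [exact: cvg_cst|apply: cvg_expr; rewrite ger0_norm].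
rewrite mulr0 => /cvgrPdist_lt /(_ e e0) [n _ /(_ n (leqnn n))] /=.
by rewrite sub0r normrN => h; exists n; rewrite (le_lt_trans (ler_norm _)).
Qed.

(** This lemma replaces the monotone convergence theorem: completeness gives a limit in quasi-norm
    only, and the order bound is recovered from the ideal property. *)
Lemma fs_series (C M : R) (z : nat -> R -> R) : 1 <= C ->
  (forall x y, E x -> E y -> N (x \+ y) <= C * (N x + N y)) ->
  (forall i, E (z i)) -> (forall i u, I01 R u -> 0 <= z i u) ->
  (forall i, N (z i) <= M * (2 * C)^-1 ^+ i) ->
  exists Y, [/\ E Y, N Y <= 2 * C ^+ 2 * M &
    forall n, {ae mu, forall u, I01 R u -> \sum_(0 <= i < n) z i u <= Y u}].
Proof.
move=> C1 HC Ez z0 Mz; have C0 : 0 < C by lra.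
have M0 : 0 <= M.
  by have := Mz 0%N; rewrite expr0 mulr1; apply: le_trans; exact: fs_ge0.
have HT := fs_tail C1 HC Ez Mz.
pose S n u := \sum_(0 <= i < n) z i u.
have ES n : E (S n) by exact: fs_sum.
have SB m n : (m <= n)%N -> S n \- S m = (fun u => \sum_(m <= i < m + (n - m)) z i u).
  move=> mn; apply/funext => u /=; rewrite subnKC // /S (big_cat_nat (n := m)) //=.
  by rewrite addrAC subrr add0r.
pose q : R := (2 * C)^-1.
have q01 : 0 <= q < 1.
  by rewrite /q invr_ge0 mulr_ge0 ?(ltW C0) //= invf_lt1 ?mulr_gt0 //; lra.
have [Y EY SY] : exists2 Y, E Y & (fun n => N (S n \- Y)) @ \oo --> (0 : R).
  apply: (qbs_complete qE) => // e e0.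
  have [n0 hn0] := geom_small (2 * M * C) q01 e0; exists n0.
  have key m n : (n0 <= m)%N -> (m <= n)%N -> N (S n \- S m) < e.
    move=> n0m mn; rewrite SB //; apply: (le_lt_trans (HT _ _)); apply: le_lt_trans hn0.
    rewrite ler_wpM2l ?mulr_ge0 ?(ltW C0) //.
    by case/andP: q01 => q0 q1; rewrite ler_wiXn2l // ltW.
  move=> m n n0m n0n; case/orP: (leq_total m n) => mn; last exact: key.
  by rewrite fsBC //; exact: key.
exists Y; split => //.
  apply/ler_addgt0Pr => e e0.
  have /cvgrPdist_lt /(_ (e / C)) [] := SY; first by rewrite divr_gt0.
  move=> n _ /(_ n (leqnn n)) /=; rewrite sub0r normrN ger0_norm; last by apply/fs_ge0/fsB.
  move=> h.
  have -> : Y = (Y \- S n) \+ S n by apply/funext => u /=; rewrite subrK.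
  apply: (le_trans (HC _ _ _ _)) => //; first exact: fsB.
  rewrite fsBC //; have := HT n 0%N; rewrite expr0 mulr1 add0n -/(S n) => h2.
  have h3 : C * N (S n \- Y) <= e by rewrite -ler_pdivlMl // mulrC ltW.
  have : C * N (S n) <= C * (2 * M * C) by rewrite ler_pM2l.
  rewrite mulrDr expr2; lra.
(* Since the terms are nonnegative, the positive part w of S_n - Y is at most |S_m - Y| for all m >=
   n. Its quasi-norm is therefore below a null sequence, and w vanishes a.e. *)
move=> n; pose w u := Num.max 0 (S n u - Y u).
have mw : mfun01 w.
  apply: measurable_maxr => //; apply: measurable_funB; exact: fs_mfun.
have wle m : (n <= m)%N -> E w /\ N w <= N (S m \- Y).
  move=> nm; apply: (qbs_ideal qE) => //; first exact: fsB.
  apply: aeW => u Iu; rewrite ger0_norm ?le_max ?lexx // ge_max normr_ge0 /=.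
  apply: le_trans (ler_norm _); rewrite lerD2r /S [leRHS](big_cat_nat (n := n)) //=.
  by rewrite lerDl sumr_ge0 // => i _; exact: z0.
have Ew : E w by have [] := wle n (leqnn n).
have Nw : N w = 0.
  apply/eqP; rewrite eq_le fs_ge0 // andbT; apply/ler_addgt0Pr => e e0; rewrite add0r.
  have /cvgrPdist_lt /(_ e e0) [k _ /(_ (maxn k n))] := SY.
  rewrite /= leq_maxl sub0r normrN ger0_norm; last by apply/fs_ge0/fsB.
  move=> /(_ isT) /ltW.
  by apply: le_trans; apply: (wle _ _).2; exact: leq_maxr.
have w0 := proj1 (qn_eq0 qN Ew) Nw.
apply: filterS w0 => u /= wu Iu; have := wu Iu; rewrite /w => h.
have : S n u - Y u <= 0 by rewrite -h le_max lexx orbT.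
by rewrite subr_le0.
Qed.

Lemma ae_le_abs x y : (forall u, 0 <= x u) ->
  {ae mu, forall u, I01 R u -> x u <= y u} ->
  {ae mu, forall u, I01 R u -> `|x u| <= `|y u|}.
Proof.
move=> x0; apply: ae01S => u hu Iu; rewrite ger0_norm //.
exact: le_trans (hu Iu) (ler_norm _).
Qed.

(** Otherwise there are rearrangements of integral 1 with quasi-norms below (2C)^-n. Their series
    has an upper bound Y in E, hence in L1, whose absolute value would have integral at least n for
    every n. *)
Lemma fs_L1_bound : fs_set E `<=` @L1 R ->
  exists K : R, 0 <= K /\ forall x, E x -> I1 (rearr x) <= K * N x.
Proof.
move=> EL1; apply: contrapT => H.
have [C [C1 HC]] := fs_constant; have C0 : 0 < C by lra.
have ex n : exists x, E x /\ (2 * C) ^+ n * N x < I1 (rearr x).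
  apply: contrapT => h; apply: H; exists ((2 * C) ^+ n); split.
    by rewrite exprn_ge0 // mulr_ge0 // ltW.
  by move=> x Ex; rewrite leNgt; apply/negP => h'; apply: h; exists x.
have [x Hx] := choice ex.
have Ex n : E (x n) by have [] := Hx n.
pose J n := I1 (rearr (x n)).
have J0 n : 0 < J n.
  apply: le_lt_trans (Hx n).2.
  by rewrite mulr_ge0 ?fs_ge0 // exprn_ge0 // mulr_ge0 // ltW.
pose z n := (J n)^-1 \*o rearr (x n).
have Ez n : E (z n) by apply: (qn_memZ qN); exact: (fs_rearr (Ex n)).1.
have Iz n : I1 (z n) = 1.
  by rewrite I1Z ?mulVf ?gt_eqF ?J0 //; apply: EL1; exact: (fs_rearr (Ex n)).1.
have z0 n u : 0 <= z n u by rewrite mulr_ge0 ?rearr_ge0 // invr_ge0 ltW.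
have Mz i : N (z i) <= 1 * (2 * C)^-1 ^+ i.
  rewrite (qn_homogeneous qN); last exact: (fs_rearr (Ex i)).1.
  rewrite (fs_rearr (Ex i)).2 mul1r ger0_norm ?invr_ge0 ?(ltW (J0 i)) //.
  rewrite ler_pdivrMl // exprVn ler_pdivlMr ?exprn_gt0 ?mulr_gt0 // mulrC.
  by apply: ltW; exact: (Hx i).2.
have [Y [EY _ zY]] := fs_series C1 HC Ez (fun n u _ => z0 n u) Mz.
have YL := EL1 _ EY.
have h n : n%:R <= I1 (fun u => `|Y u|).
  pose S u := \sum_(0 <= i < n) z i u.
  have ES : E S by exact: fs_sum.
  have S0 u : 0 <= S u by apply: sumr_ge0.
  have IS : I1 S = n%:R.
    rewrite /S I1_sum; last by move=> i; exact: EL1.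
    by under eq_bigr do rewrite Iz; rewrite sumr_const_nat subn0.
  have dSY s : 0 <= s -> dist S s <= dist Y s.
    have aeSY : {ae mu, forall u, I01 R u -> `|S u| <= `|Y u|}.
      exact: (ae_le_abs S0 (zY n)).
    by move=> _; apply: le_dist_ae aeSY; exact: fs_mfun.
  have [_] := I1_dist_le YL (fs_mfun ES) dSY; rewrite -IS.
  by have -> : (fun u => `|S u|) = S by apply/funext => u; rewrite ger0_norm.
have := h (Num.bound (I1 (fun u => `|Y u|))); apply/negP; rewrite -ltNge.
by apply: archi_boundP; exact: I1_ge0.
Qed.

End SymmetricSpace.

Lemma quasi_triangle_arith (R : realType) (C e a b n1 n2 n : R) : 0 < C ->
  n1 < a + e / (4 * C) -> n2 < b + e / (4 * C) -> n <= C * (n1 + n2) ->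
  2 * n <= 2 * C * (a + b) + e.
Proof.
move=> C0; set s := e / (4 * C) => h1 h2 h3.
have Cs : C * s = e / 4 by rewrite /s invfM mulrCA (mulrCA C) mulfV ?gt_eqF ?mulr1.
have : C * (n1 + n2) <= C * (a + b + 2 * s) by rewrite ler_pM2l //; lra.
lra.
Qed.

(** * The space generated by the Calderon operator *)

Section CalderonSpace.
Context {R : realType} (E : fspace R) (qE : is_qB_symmetric E).
Context (EL1 : fs_set E `<=` @L1 R).
Implicit Types (x y : R -> R).
Notation mu := (@lebesgue_measure R).
Notation N := (fs_norm E).
Notation G := (calderon_space E).
Notation NG := (fs_norm (calderon_space E)).

#[local] Opaque rearr calderon.

Let qN : is_quasi_normed_space E := qbs_quasi_normed qE.

Lemma fs_rearr_L1 y : E y -> L1 (rearr y).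
Proof. by move=> Ey; apply: EL1; exact: (fs_rearr qE Ey).1. Qed.

(** The weak L1 condition follows from domination, because t S g(t) <= [I1 g] for g = [rearr y]. *)
Lemma calderon_spaceI x y : mfun01 x -> E y -> calderon_dominated x y -> G x.
Proof.
move=> mx Ey xy; split; last by exists y.
split=> //; apply: (@le_lt_trans _ _ (I1 (rearr y))%:E); last exact: ltry.
apply: ub_ereal_sup => _ [t + <-]; rewrite /= in_itv /= => /andP[t0 t1].
have iy := fs_rearr_L1 Ey; rewrite lee_fin.
have [t1'|t1'] := ltP t 1; last first.
  by rewrite rearr_ge1 // mulr0; apply: I1_ge0 => u _; exact: rearr_ge0.
have It : I01 R t by apply/in_I01; rewrite t0.
apply: (@le_trans _ _ (t * calderon (rearr y) t)); first by rewrite ler_pM2l // xy.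
by apply: calderon_le_int => // u _; exact: rearr_ge0.
Qed.

Lemma calderon_spaceE x : G x -> mfun01 x /\ exists y, E y /\ calderon_dominated x y.
Proof. by move=> [[mx _] [y Ey xy]]; split => //; exists y. Qed.

Lemma NG_ge0 x : 0 <= NG x.
Proof.
rewrite /=; set A := [set _ | _ in _].
have [->|/set0P ne] := eqVneq A set0; first by rewrite inf0.
by apply: lb_le_inf => // _ [y [Ey _] <-]; exact: (fs_ge0 qE).
Qed.

Lemma NG_le x y : E y -> calderon_dominated x y -> NG x <= N y.
Proof.
move=> Ey xy; apply: ge_inf; last by exists y.
by exists 0 => _ [z [Ez _] <-]; exact: (fs_ge0 qE).
Qed.

Lemma NG_lt x e : G x -> NG x < e -> exists y, [/\ E y, calderon_dominated x y & N y < e].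
Proof.
move=> /calderon_spaceE[_ [y0 [Ey0 xy0]]] xe.
have hi : has_inf [set N y | y in [set y | E y /\ calderon_dominated x y]].
  split; first by exists (N y0), y0.
  by exists 0 => _ [z [Ez _] <-]; exact: (fs_ge0 qE).
have e0 : 0 < e - NG x by rewrite subr_gt0.
have [_ [y [Ey xy] <-] h] := inf_adherent e0 hi.
by exists y; split => //; move: h; rewrite addrC subrK.
Qed.

#[local] Opaque calderon_space.

Lemma calderon_dominatedZ (a : R) x y : mfun01 x -> E y -> calderon_dominated x y ->
  calderon_dominated (a \*o x) (a \*o y).
Proof.
move=> mx Ey xy t It; have /andP[t0 _] : 0 < t < 1 by exact/in_I01.
have my := fs_mfun qE Ey; have iy := fs_rearr_L1 Ey.
rewrite rearrZ //.
have -> : calderon (rearr (a \*o y)) t = calderon (`|a| \*o rearr y) t.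
  have h s : I01 R s -> rearr (a \*o y) s = (`|a| \*o rearr y) s.
    by move=> /in_I01/andP[s0 _]; rewrite rearrZ.
  have ia : L1 (rearr (a \*o y)) by apply: fs_rearr_L1; exact: (qn_memZ qN).
  apply/eqP; rewrite eq_le; apply/andP; split; apply: le_calderon => //; try exact: L1Z.
    by move=> s Is; rewrite h.
  by move=> s Is; rewrite h.
by rewrite calderonZ // ler_wpM2l // xy.
Qed.

Lemma le_calderon_rearr z t : E z -> decr01 z -> I01 R t ->
  calderon z t <= calderon (rearr z) t.
Proof.
move=> Ez dz It; apply: le_calderon => //; [exact: EL1|exact: fs_rearr_L1|].
by move=> s Is; apply: decr01_le_rearr => //; exact: (fs_mfun qE).
Qed.

(** The rearrangement of the sum at t is bounded by those of the summands at t/2, and the dilation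
    costs the factor 2. The sum of the rearrangements is used, not y1 + y2: cancellation could make
    the latter small, while a decreasing function lies below its own rearrangement. *)
Lemma calderon_dominatedD x1 x2 y1 y2 : mfun01 x1 -> mfun01 x2 -> E y1 -> E y2 ->
  calderon_dominated x1 y1 -> calderon_dominated x2 y2 ->
  E (2 \*o (rearr y1 \+ rearr y2)) /\
  calderon_dominated (x1 \+ x2) (2 \*o (rearr y1 \+ rearr y2)).
Proof.
move=> mx1 mx2 Ey1 Ey2 h1 h2.
have [Er1 _] := fs_rearr qE Ey1; have [Er2 _] := fs_rearr qE Ey2.
have Es : E (rearr y1 \+ rearr y2) by exact: (qn_memD qN).
have E2 : E (2 \*o (rearr y1 \+ rearr y2)) by exact: (qn_memZ qN).
split; first exact: E2.
move=> t It; have /andP[t0 t1] : 0 < t < 1 by exact/in_I01.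
have d2 : decr01 (2 \*o (rearr y1 \+ rearr y2)).
  by apply: decr01Z => //; apply: decr01D; apply: decr01_rearr; exact: (fs_mfun qE).
apply: le_trans (le_calderon_rearr E2 d2 It).
rewrite calderonZ //; last exact: EL1.
rewrite calderonD //; [|exact: EL1..].
have Ih : I01 R (2^-1 * t) by apply/in_I01; lra.
have half : t = 2^-1 * t + 2^-1 * t by lra.
rewrite [in leLHS]half (le_trans (rearrD _ _ _ _)) //; [by rewrite mulr_gt0|by rewrite mulr_gt0|].
have key y : E y -> calderon (rearr y) (2^-1 * t) <= 2 * calderon (rearr y) t.
  move=> Ey; have := @calderon_dil R t 2^-1 (rearr y) (fs_rearr_L1 Ey) It.
  rewrite invrK; apply; first by apply/andP; split; lra.
  by move=> s _; exact: rearr_ge0.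
rewrite mulrDr; apply: lerD.
  exact: le_trans (h1 _ Ih) (key _ Ey1).
exact: le_trans (h2 _ Ih) (key _ Ey2).
Qed.

Lemma calderon_spaceZ (a : R) x : G x -> G (a \*o x).
Proof.
move=> /calderon_spaceE[mx [y [Ey xy]]].
apply: (@calderon_spaceI _ (a \*o y)); first exact: mfun01Z.
  exact: (qn_memZ qN).
exact: calderon_dominatedZ.
Qed.

Lemma calderon_spaceD x1 x2 : G x1 -> G x2 -> G (x1 \+ x2).
Proof.
move=> /calderon_spaceE[mx1 [y1 [Ey1 xy1]]] /calderon_spaceE[mx2 [y2 [Ey2 xy2]]].
have [E2 D2] := calderon_dominatedD mx1 mx2 Ey1 Ey2 xy1 xy2.
by apply: calderon_spaceI E2 D2; exact: measurable_funD.
Qed.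

Lemma NGZ_le (a : R) x : G x -> NG (a \*o x) <= `|a| * NG x.
Proof.
move=> Gx; have [mx _] := calderon_spaceE Gx.
apply/ler_addgt0Pr => e e0; have a1 : 0 < `|a| + 1 by have := normr_ge0 a; lra.
have [y [Ey xy yN]] := @NG_lt x (NG x + e / (`|a| + 1)) Gx ltac:(by rewrite ltrDl divr_gt0).
apply: (le_trans (NG_le _ (calderon_dominatedZ a mx Ey xy))); first exact: (qn_memZ qN).
rewrite (qn_homogeneous qN) //.
apply: (@le_trans _ _ (`|a| * (NG x + e / (`|a| + 1)))).
  by rewrite ler_wpM2l // ltW.
rewrite mulrDr lerD2l mulrA ler_pdivrMr // mulrDr mulr1 mulrC lerDl ltW //.
Qed.

Lemma dominated_le x x' y : calderon_dominated x y ->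
  (forall t, I01 R t -> rearr x' t <= rearr x t) -> calderon_dominated x' y.
Proof. by move=> xy h t It; exact: le_trans (h t It) (xy t It). Qed.

Lemma calderon_space_le x x' : G x -> mfun01 x' ->
  (forall t, I01 R t -> rearr x' t <= rearr x t) -> G x' /\ NG x' <= NG x.
Proof.
move=> Gx mx' h; have [mx [y [Ey xy]]] := calderon_spaceE Gx.
split; first by apply: calderon_spaceI Ey (dominated_le xy h).
apply/ler_addgt0Pr => e e0.
have [z [Ez xz zN]] := @NG_lt x (NG x + e) Gx ltac:(by rewrite ltrDl).
exact: le_trans (NG_le Ez (dominated_le xz h)) (ltW zN).
Qed.

Lemma calderon_space_eq x x' : G x -> mfun01 x' ->
  (forall t, I01 R t -> rearr x' t = rearr x t) -> G x' /\ NG x' = NG x.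
Proof.
move=> Gx mx' h; have [mx _] := calderon_spaceE Gx.
have [Gx' h1] : G x' /\ NG x' <= NG x by apply: (calderon_space_le Gx mx') => t It; rewrite h.
have [_ h2] : G x /\ NG x <= NG x' by apply: (calderon_space_le Gx' mx) => t It; rewrite h.
by split; [exact: Gx'|apply: le_anti; apply/andP; split; [exact: h1|exact: h2]].
Qed.

Lemma calderon_space0 x : mfun01 x -> ae_eq mu (I01 R) x (cst 0) -> G x /\ NG x = 0.
Proof.
move=> mx x0.
have D0 : calderon_dominated x (cst 0).
  move=> t It; have /andP[t0 _] : 0 < t < 1 by exact/in_I01.
  rewrite (@le_trans _ _ 0) //.
    by rewrite rearr_leP // dist_ae0 // ltW.
  apply: calderon_ge0 => //; first by apply: fs_rearr_L1; exact: (qn_mem0 qN).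
  by move=> s _; exact: rearr_ge0.
split; first by apply: calderon_spaceI D0 => //; exact: (qn_mem0 qN).
apply/eqP; rewrite eq_le NG_ge0 andbT; apply: (le_trans (NG_le (qn_mem0 qN) D0)).
by rewrite (proj2 (qn_eq0 qN (qn_mem0 qN))) //; exact: aeW.
Qed.

Lemma calderon_space_quasi_normed : is_quasi_normed_space G.
Proof.
split.
- by move=> x /calderon_spaceE[].
- move=> x y Gx my xy; have [mx _] := calderon_spaceE Gx.
  apply: calderon_space_eq => // t /in_I01/andP[t0 _].
  apply/eqP; rewrite eq_le; apply/andP; split; apply: rearr_ae_le => //.
    by apply: filterS xy => u h Iu; rewrite h.
  by apply: filterS xy => u h Iu; rewrite h.
- by apply: (@calderon_space0 (cst 0) _ _).1; [exact: measurable_cst|exact: aeW].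
- exact: calderon_spaceD.
- exact: calderon_spaceZ.
- by move=> x _; exact: NG_ge0.
- move=> x Gx; have [mx _] := calderon_spaceE Gx; split; last first.
    by move=> x0; exact: (calderon_space0 mx x0).2.
  move=> Nx; apply: dist0_ae => //; apply/eqP; rewrite eq_le dist_ge0 andbT.
  (* Definiteness: t [rearr x t] <= [I1 (rearr y)] <= K N(y) for every admissible y, and N(y) can be
     taken arbitrarily small. The denominator K + 1 below guards against K = 0. *)
  have [K [K0 HK]] := fs_L1_bound qE EL1.
  have r0 t : I01 R t -> rearr x t = 0.
    move=> It; have /andP[t0 _] : 0 < t < 1 by exact/in_I01.
    apply/eqP; rewrite eq_le rearr_ge0 andbT; apply/ler_addgt0Pr => e e0; rewrite add0r.
    have K1 : 0 < K + 1 by lra.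
    have [y [Ey xy yN]] := @NG_lt x (e * t / (K + 1)) Gx ltac:(by rewrite Nx !mulr_gt0 ?invr_gt0).
    apply: (le_trans (xy t It)); rewrite -(ler_pM2l t0).
    apply: (@le_trans _ _ (I1 (rearr y))).
      by apply: calderon_le_int => //; [exact: fs_rearr_L1|move=> s _; exact: rearr_ge0].
    apply: (le_trans (HK _ Ey)); apply: (@le_trans _ _ (K * (e * t / (K + 1)))).
      by rewrite ler_wpM2l // ltW.
    rewrite mulrA ler_pdivrMr // mulrDr mulr1 (mulrC t) (mulrC K) lerDl mulr_ge0 //; exact: ltW.
  apply/ler_addgt0Pr => e e0; rewrite add0r.
  have [e1|e1] := ltP e 1; last exact: le_trans (dist_le1 _ mx) e1.
  by rewrite -rearr_leP // r0 //; apply/in_I01; rewrite e0.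
- move=> a x Gx; apply/eqP; rewrite eq_le NGZ_le //=.
  have [->|a0] := eqVneq a 0; first by rewrite normr0 mul0r NG_ge0.
  rewrite -ler_pdivlMl ?normr_gt0 //.
  have {1}-> : x = a^-1 \*o (a \*o x) by apply/funext => u /=; rewrite mulKf.
  by apply: (le_trans (NGZ_le _ _)); [exact: calderon_spaceZ|rewrite normfV].
- have [C [C1 HC]] := fs_constant qE; exists (2 * C) => x1 x2 Gx1 Gx2.
  have [mx1 _] := calderon_spaceE Gx1; have [mx2 _] := calderon_spaceE Gx2.
  apply/ler_addgt0Pr => e e0.
  have C0 : 0 < 4 * C by lra.
  have d0 : 0 < e / (4 * C) by rewrite divr_gt0.
  have [y1 [Ey1 xy1 yN1]] := @NG_lt x1 (NG x1 + e / (4 * C)) Gx1 ltac:(by rewrite ltrDl).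
  have [y2 [Ey2 xy2 yN2]] := @NG_lt x2 (NG x2 + e / (4 * C)) Gx2 ltac:(by rewrite ltrDl).
  have [E2 D2] := calderon_dominatedD mx1 mx2 Ey1 Ey2 xy1 xy2.
  have [Er1 Nr1] := fs_rearr qE Ey1; have [Er2 Nr2] := fs_rearr qE Ey2.
  apply: (le_trans (NG_le E2 D2)).
  rewrite (qn_homogeneous qN); last exact: (qn_memD qN).
  rewrite ger0_norm //; apply: quasi_triangle_arith yN1 yN2 _; first by lra.
  by rewrite -Nr1 -Nr2; exact: HC.
Qed.

Lemma calderon_sum (F : nat -> R -> R) (r : seq nat) t : (forall i, L1 (F i)) -> I01 R t ->
  calderon (fun u => \sum_(i <- r) F i u) t = \sum_(i <- r) calderon (F i) t.
Proof.
move=> iF It; have t0 : 0 < t by case/in_I01/andP : It.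
rewrite calderonE //; last exact: L1_sum.
under [RHS]eq_bigr do rewrite calderonE //.
rewrite -I1_sum; last by move=> i; exact: L1_ker.
by congr I1; apply/funext => u; rewrite mulr_suml.
Qed.

Lemma decr01_sum (F : nat -> R -> R) (r : seq nat) : (forall i, decr01 (F i)) ->
  decr01 (fun u => \sum_(i <- r) F i u).
Proof.
move=> dF; elim: r => [|i r IH].
  rewrite (_ : (fun _ => _) = 0 \*o rearr (cst 0)).
    by apply: decr01Z => //; apply: decr01_rearr; exact: measurable_cst.
  by apply/funext => u; rewrite big_nil /= mul0r.
rewrite (_ : (fun _ => _) = F i \+ (fun u => \sum_(i <- r) F i u)).
  exact: decr01D.
by apply/funext => u; rewrite big_cons.
Qed.

(** Term K + i is evaluated at 2^-(i+1) t, so the exceptional sets add up to at most t. Returning to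
    t multiplies its Calderon bound by 2^(i+1), whence z i. The ratio 1/(4C) in the hypothesis pays
    for this factor and leaves the 1/(2C) needed by [fs_series]. *)
Lemma calderon_dominated_lims (C : R) (d y : nat -> R -> R) K : 1 <= C ->
  (forall x y, E x -> E y -> N (x \+ y) <= C * (N x + N y)) ->
  (forall k, mfun01 (d k)) -> (forall k, E (y k)) ->
  (forall k, calderon_dominated (d k) (y k)) ->
  (forall k, N (y k) <= (4 * C)^-1 ^+ k) ->
  exists Y, [/\ E Y, N Y <= 4 * C ^+ 2 * (4 * C)^-1 ^+ K &
    calderon_dominated (lims d \- (fun u => \sum_(0 <= k < K) d k u)) Y].
Proof.
move=> C1 HC md Ey dy yN; have C0 : 0 < C by lra.
pose z i := 2 ^+ i.+1 \*o rearr (y (K + i)%N).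
have Er i : E (rearr (y (K + i)%N)) by exact: (fs_rearr qE (Ey _)).1.
have Ez i : E (z i) by exact: (qn_memZ qN).
have z0 i u : I01 R u -> 0 <= z i u.
  by move=> _; rewrite /z /= mulr_ge0 ?rearr_ge0 // exprn_ge0.
have zN i : N (z i) <= 2 * (4 * C)^-1 ^+ K * (2 * C)^-1 ^+ i.
  rewrite (qn_homogeneous qN) // (fs_rearr qE (Ey _)).2 ger0_norm ?exprn_ge0 //.
  apply: (@le_trans _ _ (2 ^+ i.+1 * (4 * C)^-1 ^+ (K + i))).
    by rewrite ler_wpM2l // exprn_ge0.
  rewrite exprD exprS.
  have -> : (2 * C)^-1 = 2 * (4 * C)^-1.
    have -> : 4 * C = 2 * (2 * C) by lra.
    by rewrite (invfM 2 (2 * C)) mulrA mulfV // mul1r.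
  by rewrite exprMn; lra.
have [Y [EY YN zY]] := fs_series qE C1 HC Ez z0 zN.
exists Y; split => //; first by lra.
move=> t It; have /andP[t0 t1] : 0 < t < 1 by exact/in_I01.
have ml : mfun01 (lims d \- (fun u => \sum_(0 <= k < K) d k u)).
  by apply: measurable_funB; [exact: mfun01_lims|exact: mfun01_sum].
have iY := fs_rearr_L1 EY; have mY := fs_mfun qE EY.
have h2 i : 0 < (2^-1 : R) ^+ i.+1 <= (1 : R).
  by rewrite exprn_gt0 //= exprn_ile1 //; lra.
have Ih i : I01 R (2^-1 ^+ i.+1 * t).
  apply/in_I01; case/andP: (h2 i) => a b; rewrite mulr_gt0 //= (le_lt_trans _ t1) //.
  by rewrite ler_piMl // ltW.
rewrite rearr_leP //; last by apply: calderon_ge0 => // s _; exact: rearr_ge0.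
pose dl k := 2^-1 ^+ (k - K).+1 * t.
pose e k := calderon (rearr (y k)) (dl k).
apply: (@dist_lims _ d e dl) => //.
- move=> k Kk; rewrite -rearr_leP //.
  + by apply: dy; exact: Ih.
  + by rewrite mulr_gt0 // exprn_gt0.
  + apply: calderon_ge0; [exact: fs_rearr_L1|exact: Ih|].
    by move=> s _; exact: rearr_ge0.
- move=> n Kn; rewrite -(subnKC Kn) sum_addl.
  apply: (@le_trans _ _ (\sum_(0 <= i < n - K) calderon (z i) t)).
    apply: ler_sum => i _; rewrite /e /dl addKn calderonZ //; last exact: EL1.
    have -> : (2 : R) ^+ i.+1 = (2^-1 ^+ i.+1)^-1 by rewrite exprVn invrK.
    apply: calderon_dil => //; first exact: EL1.
    by move=> s _; exact: rearr_ge0.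
  rewrite -calderon_sum //; last by move=> i; exact: EL1.
  pose S u := \sum_(0 <= i < n - K) z i u.
  have ES : E S by exact: (fs_sum qE).
  have dS : decr01 S.
    apply: decr01_sum => i; apply: decr01Z; first by rewrite exprn_ge0.
    by apply: decr01_rearr; exact: (fs_mfun qE).
  apply: (le_trans (le_calderon_rearr ES dS It)).
  apply: le_calderon => //; first exact: fs_rearr_L1.
  move=> s /in_I01/andP[s0 _]; apply: rearr_ae_le => //; first exact: (fs_mfun qE).
  apply: ae01S (zY (n - K)%N) => u hu Iu.
  have S0 : 0 <= S u by apply: sumr_ge0 => i _; exact: z0.
  by rewrite ger0_norm // (le_trans (hu Iu)) // ler_norm.
- move=> n Kn; rewrite -(subnKC Kn) sum_addl.
  by under eq_bigr do rewrite /dl addKn; apply: sum_half; exact: ltW.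
Qed.

Lemma calderon_space_complete : is_complete G.
Proof.
move=> u Gu cu; have qG := calderon_space_quasi_normed.
have [C [C1 HC]] := fs_constant qE; have C0 : 0 < C by lra.
have GB x y : G x -> G y -> G (x \- y).
  move=> Gx Gy; rewrite (_ : x \- y = x \+ ((-1) \*o y)).
    by apply: calderon_spaceD => //; exact: calderon_spaceZ.
  by apply/funext => v /=; rewrite mulN1r.
pose q : R := (4 * C)^-1.
have q0 : 0 < q by rewrite invr_gt0 mulr_gt0.
have q1 : q < 1 by rewrite invf_lt1 ?mulr_gt0 //; lra.
have [Nk HN] := choice (fun k => cu (q ^+ k) (exprn_gt0 k q0)).
(* Cumulative sums give indices that are nondecreasing and still at least [Nk k]. *)
pose nk k := (\sum_(0 <= i < k.+1) Nk i)%N.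
have nkS k : (nk k <= nk k.+1)%N by rewrite /nk [leqRHS]big_nat_recr //= leq_addr.
have nkN k : (Nk k <= nk k)%N by rewrite /nk big_nat_recr //= leq_addl.
pose d k := u (nk k.+1) \- u (nk k).
have mu_ n : mfun01 (u n) by case: (calderon_spaceE (Gu n)).
have md k : mfun01 (d k) by apply: measurable_funB; exact: mu_.
have ex k : exists y, [/\ E y, calderon_dominated (d k) y & N y < q ^+ k].
  apply: NG_lt; first exact: GB.
  by apply: HN => //; exact: leq_trans (nkN k) (nkS k).
have [y Hy] := choice ex.
have Ey k : E (y k) by case: (Hy k).
have dy k : calderon_dominated (d k) (y k) by case: (Hy k).
have yN k : N (y k) <= q ^+ k by case: (Hy k) => _ _ /ltW.
pose x := u (nk 0%N) \+ lims d.
have tele K v : \sum_(0 <= k < K) d k v = u (nk K) v - u (nk 0%N) v.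
  by rewrite /d telescope_sumr.
have tail K : G (u (nk K) \- x) /\ NG (u (nk K) \- x) <= 4 * C ^+ 2 * q ^+ K.
  have [Y [EY YN HY]] := calderon_dominated_lims K C1 HC md Ey dy yN.
  have ml : mfun01 (u (nk K) \- x).
    by apply: measurable_funB; [exact: mu_|apply: measurable_funD; [exact: mu_|exact: mfun01_lims]].
  have D : calderon_dominated (u (nk K) \- x) Y.
    apply: dominated_le HY _ => t /in_I01/andP[t0 _].
    apply: rearr_ae_le => //.
      by apply: measurable_funB; [exact: mfun01_lims|exact: mfun01_sum].
    apply: aeW => v Iv.
    have -> : (u (nk K) \- x) v = - (lims d v - \sum_(0 <= k < K) d k v).
      by rewrite tele /x /=; lra.
    by rewrite normrN.
  split; first exact: calderon_spaceI ml EY D.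
  exact: le_trans (NG_le EY D) YN.
have Gx : G x.
  rewrite (_ : x = u (nk 0%N) \- (u (nk 0%N) \- x)); first by apply: GB => //; exact: (tail 0%N).1.
  by apply/funext => v /=; rewrite subKr.
exists x => //.
have [C' HC'] := qn_triangle qG.
pose D := Num.max 1 C'.
have D1 : 1 <= D by rewrite le_max lexx.
have HD a b : G a -> G b -> NG (a \+ b) <= D * (NG a + NG b).
  move=> Ga Gb; apply: (le_trans (HC' _ _ Ga Gb)).
  by rewrite ler_wpM2r ?addr_ge0 ?NG_ge0 // le_max lexx orbT.
apply/cvgrPdist_lt => e e0.
have [K hK] := @geom_small _ q (D * (1 + 4 * C ^+ 2)) e ltac:(by rewrite (ltW q0)) e0.
exists (nk K) => // n /= Kn; rewrite sub0r normrN ger0_norm ?NG_ge0 //.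
have -> : u n \- x = (u n \- u (nk K)) \+ (u (nk K) \- x).
  by apply/funext => v /=; lra.
apply: (le_lt_trans (HD _ _ _ _)); [exact: GB|exact: (tail K).1|].
apply: le_lt_trans hK; rewrite -mulrA ler_wpM2l //; first by lra.
rewrite mulrDl mul1r lerD //; last exact: (tail K).2.
apply: ltW; apply: HN => //; exact: leq_trans (nkN K) _.
Qed.

Lemma calderon_space_qB_symmetric : is_qB_symmetric G.
Proof.
split.
- exact: calderon_space_quasi_normed.
- exact: calderon_space_complete.
- move=> x y Gx my h; have [mx _] := calderon_spaceE Gx.
  by apply: calderon_space_le => // t /in_I01/andP[t0 _]; exact: rearr_ae_le.
- exact: calderon_space_eq.
Qed.

End CalderonSpace.

(** * Bellman functions for finite martingale transforms *)

Section Bellman.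
Context {R : realType}.
Implicit Types (th : nat -> bool) (a : nat -> nat -> R) (W : R -> R -> R).

Definition dyadic_mart a := forall k j, (j < 2 ^ k)%N ->
  a k j = (a k.+1 j.*2 + a k.+1 j.*2.+1) / 2.

(** The transform with multipliers 0 or 1, on arrays indexed by generation and position; [j./2] is
    the parent of j. *)
Fixpoint mtransf th a k j : R :=
  if k is k'.+1 then mtransf th a k' j./2 + (th k)%:R * (a k j - a k' j./2)
  else (th 0%N)%:R * a 0%N j.

(** The two inequalities are the two possible steps of a transform: with multiplier 0 only x moves,
    with multiplier 1 both coordinates move by the same h. They make the mean of W over a generation
    nonincreasing. *)
Definition midpoint_concave (D : set R) W := forall x h y, D (x + h) -> D (x - h) ->
  W (x + h) y + W (x - h) y <= 2 * W x y /\
  W (x + h) (y + h) + W (x - h) (y - h) <= 2 * W x y.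

Lemma sum_double (F : nat -> R) n :
  \sum_(0 <= j < n.*2) F j = \sum_(0 <= j < n) (F j.*2 + F j.*2.+1).
Proof.
elim: n => [|n IH]; first by rewrite !big_geq.
by rewrite doubleS !big_nat_recr //= IH -addrA.
Qed.

Lemma mtransf_step D W th a k : dyadic_mart a -> midpoint_concave D W ->
  (forall j, (j < 2 ^ k.+1)%N -> D (a k.+1 j)) ->
  \sum_(0 <= j < 2 ^ k.+1) W (a k.+1 j) (mtransf th a k.+1 j) <=
  2 * \sum_(0 <= j < 2 ^ k) W (a k j) (mtransf th a k j).
Proof.
move=> ma mW Da; rewrite expnS mul2n sum_double mulr_sumr.
rewrite !big_nat; apply: ler_sum => j /= jk.
have h1 : (j.*2 < 2 ^ k.+1)%N by rewrite expnS mul2n ltn_double.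
have h2 : (j.*2.+1 < 2 ^ k.+1)%N by rewrite expnS mul2n ltn_Sdouble.
rewrite doubleK uphalf_double.
pose h := a k.+1 j.*2 - a k j.
have e1 : a k.+1 j.*2 = a k j + h by rewrite /h addrC subrK.
have e2 : a k.+1 j.*2.+1 = a k j - h by rewrite /h (ma k j jk); lra.
have := Da _ h1; have := Da _ h2; rewrite e1 e2 => D2 D1.
have [] := mW (a k j) h (mtransf th a k j) D1 D2.
have -> : a k j + h - a k j = h by lra.
have -> : a k j - h - a k j = - h by lra.
by case: (th k.+1); rewrite ?mul1r ?mul0r ?addr0.
Qed.

Lemma mtransf_le D W th a k m : dyadic_mart a -> midpoint_concave D W ->
  (forall k j, (j < 2 ^ k)%N -> D (a k j)) ->
  \sum_(0 <= j < 2 ^ (k + m)) W (a (k + m)%N j) (mtransf th a (k + m) j) <=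
  2 ^+ m * \sum_(0 <= j < 2 ^ k) W (a k j) (mtransf th a k j).
Proof.
move=> ma mW Da; elim: m => [|m IH]; first by rewrite addn0 expr0 mul1r.
rewrite addnS (le_trans (mtransf_step _ ma mW _)) //; first exact: Da.
by rewrite exprS -mulrA ler_pM2l.
Qed.

(* Burkholder's function for the weak type (1,1) inequality. *)
Definition bellman_weak (x y : R) : R :=
  if `|x| + `|y| <= 1 then y ^+ 2 - x ^+ 2 else 1 - 2 * `|x|.

Lemma bellman_weak_le x y : bellman_weak x y <= 1 - 2 * `|x|.
Proof.
rewrite /bellman_weak; case: ifPn => // h.
rewrite -(real_normK (num_real y)) -(real_normK (num_real x)).
have := normr_ge0 x; have := normr_ge0 y; nra.
Qed.

(** From a point of the diamond |x| + |y| <= 1, the tangent plane of y^2 - x^2 majorizes the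
    function in all directions with |k| <= |h|. Adding this for two opposite directions gives
    midpoint concavity there. *)
Lemma bellman_weak_tangent x y h k : `|x| + `|y| <= 1 -> `|k| <= `|h| ->
  bellman_weak (x + h) (y + k) <= y ^+ 2 - x ^+ 2 + 2 * (y * k - x * h).
Proof.
move=> xy kh; have kh2 : k ^+ 2 <= h ^+ 2.
  by rewrite -(real_normK (num_real k)) -(real_normK (num_real h)) ler_sqr ?nnegrE.
rewrite /bellman_weak; case: ifPn => [_|]; first by nra.
rewrite -ltNge => XY.
suff : forall x y h k X Y : R, X = x + h -> Y = y + k -> 0 <= X -> `|x| + `|y| <= 1 ->
    k ^+ 2 <= h ^+ 2 -> `|k| <= `|h| -> 1 < `|X| + `|Y| ->
    1 - 2 * `|X| <= y ^+ 2 - x ^+ 2 + 2 * (y * k - x * h).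
  move=> H; have [X0|X0] := leP 0 (x + h); first exact: (H x y h k).
  have := H (- x) y (- h) k (- (x + h)) (y + k) (opprD x h) erefl.
  rewrite !normrN !sqrrN mulrNN; apply => //; lra.
move=> {xy kh kh2 XY} {}x {}y {}h {}k X Y XE YE X0 xy kh2 kh XY.
rewrite (ger0_norm X0) in XY *.
(* After this identity the claim reads (X - 1)^2 - Y^2 <= h^2 - k^2. If X - 1 <= |Y| the left side
   is nonpositive. Otherwise x <= 1 - |y| gives h >= X - 1 + |y|, while |k| <= |Y| + |y|. *)
have -> : y ^+ 2 - x ^+ 2 + 2 * (y * k - x * h) = Y ^+ 2 - X ^+ 2 + h ^+ 2 - k ^+ 2.
  by rewrite XE YE; lra.
have Y2 : `|Y| ^+ 2 = Y ^+ 2 by rewrite real_normK ?num_real.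
have [X1|X1] := leP (X - 1) `|Y|.
  have : (X - 1) ^+ 2 <= Y ^+ 2 by rewrite -Y2; nra.
  nra.
have Yk : `|k| <= `|Y| + `|y| by have := ler_normB Y y; rewrite YE addrAC subrr add0r.
have xX : x <= `|x| by exact: ler_norm.
have h0 : X - 1 + `|y| <= h by lra.
have := normr_ge0 y; have := normr_ge0 Y; move: h0 => h0 Y0 y0.
have k2 : `|k| ^+ 2 = k ^+ 2 by rewrite real_normK ?num_real.
have : k ^+ 2 <= (`|Y| + `|y|) ^+ 2 by rewrite -k2; have := normr_ge0 k; nra.
have : (X - 1 + `|y|) ^+ 2 <= h ^+ 2 by nra.
rewrite -Y2; nra.
Qed.

Lemma bellman_weak_concave : midpoint_concave setT bellman_weak.
Proof.
suff H x h y k : `|k| <= `|h| ->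
    bellman_weak (x + h) (y + k) + bellman_weak (x - h) (y - k) <= 2 * bellman_weak x y.
  move=> x h y _ _; split; last exact: H.
  by have := H x h y 0; rewrite addr0 subr0; apply; rewrite normr0.
move=> kh; rewrite {3}/bellman_weak; case: ifPn => [xy|_].
  have := bellman_weak_tangent xy kh.
  have := @bellman_weak_tangent x y (- h) (- k) xy; rewrite !normrN => /(_ kh); lra.
(* Outside the diamond the function equals 1 - 2|x|, a concave function of x that majorizes it
   everywhere. *)
have := bellman_weak_le (x + h) (y + k); have := bellman_weak_le (x - h) (y - k).
have := ler_normD (x + h) (x - h).
have -> : x + h + (x - h) = 2 * x by lra.
rewrite normrM (ger0_norm (ler0n _ 2)); lra.
Qed.

Lemma bellman_weak_ge x y : (nat_of_bool (1 <= `|y|))%:R - 2 * `|x| <= bellman_weak x y.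
Proof.
rewrite /bellman_weak -(real_normK (num_real y)) -(real_normK (num_real x)).
have := normr_ge0 x; have := normr_ge0 y.
move: `|x| `|y| => {}x {}y y0 x0.
by case: ifPn => h; have [h1|h1] := leP 1 y; rewrite ?mulr1n ?mulr0n; nra.
Qed.

Lemma bellman_weak_start x (b : bool) : bellman_weak x (b%:R * x) <= 0.
Proof.
rewrite /bellman_weak -(real_normK (num_real (_ * x))) -(real_normK (num_real x)).
have := normr_ge0 x; case: b; rewrite ?mul1r ?mul0r ?normr0; move: `|x| => {}x x0.
  by case: ifPn; rewrite -?ltNge; nra.
by case: ifPn; rewrite -?ltNge; nra.
Qed.

Lemma midpoint_concave_scale D W (s : R) : midpoint_concave D W ->
  midpoint_concave [set x | D (s * x)] (fun x y => W (s * x) (s * y)).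
Proof.
move=> mW x h y /=; rewrite !mulrDr !mulrN => D1 D2.
exact: mW.
Qed.

Lemma mtransf_weak th a N (l : R) : dyadic_mart a -> 0 < l ->
  \sum_(0 <= j < 2 ^ N) (nat_of_bool (l <= `|mtransf th a N j|))%:R <=
  2 / l * \sum_(0 <= j < 2 ^ N) `|a N j|.
Proof.
move=> ma l0.
have mW := @midpoint_concave_scale _ _ l^-1 bellman_weak_concave.
have := @mtransf_le _ _ th a 0 N ma mW (fun _ _ _ => I).
rewrite add0n expn0 big_nat1 /= mulrCA => h.
have {h} : \sum_(0 <= j < 2 ^ N) bellman_weak (l^-1 * a N j) (l^-1 * mtransf th a N j) <= 0.
  apply: (le_trans h); rewrite -[leRHS](mulr0 (2 ^+ N)) ler_wpM2l ?exprn_ge0 //.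
  exact: bellman_weak_start.
have : \sum_(0 <= j < 2 ^ N) ((nat_of_bool (l <= `|mtransf th a N j|))%:R - 2 / l * `|a N j|) <=
   \sum_(0 <= j < 2 ^ N) bellman_weak (l^-1 * a N j) (l^-1 * mtransf th a N j).
  apply: ler_sum => j _; apply: le_trans (bellman_weak_ge _ _).
  by rewrite !normrM (gtr0_norm (_ : 0 < l^-1)) ?invr_gt0 // mulrA ler_pdivlMl // mulr1.
rewrite sumrB -mulr_sumr; lra.
Qed.

Definition bellman_sq (x y : R) : R := y ^+ 2 - x ^+ 2.

Lemma bellman_sq_concave : midpoint_concave setT bellman_sq.
Proof. by move=> x h y _ _; rewrite /bellman_sq; split; nra. Qed.

(** The iteration starts at a generation where the transform is still 0. Only the growth of the
    square sums after that generation enters, and this becomes small. *)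
Lemma mtransf_sq th a k m : dyadic_mart a ->
  (forall j, mtransf th a k j = 0) ->
  \sum_(0 <= j < 2 ^ (k + m)) mtransf th a (k + m) j ^+ 2 <=
  \sum_(0 <= j < 2 ^ (k + m)) a (k + m)%N j ^+ 2 -
  2 ^+ m * \sum_(0 <= j < 2 ^ k) a k j ^+ 2.
Proof.
move=> ma t0; have := @mtransf_le _ _ th a k m ma bellman_sq_concave (fun _ _ _ => I).
rewrite /bellman_sq sumrB.
have -> : \sum_(0 <= j < 2 ^ k) (mtransf th a k j ^+ 2 - a k j ^+ 2) =
   - \sum_(0 <= j < 2 ^ k) a k j ^+ 2.
  by rewrite -sumrN; apply: eq_bigr => j _; rewrite t0 expr0n sub0r.
lra.
Qed.

Lemma mtransf0 th a k j : (forall i, (i <= k)%N -> th i = false) -> mtransf th a k j = 0.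
Proof.
elim: k j => [|k IH] j h /=; first by rewrite h // mul0r.
by rewrite IH ?h ?mul0r ?addr0 // => i ik; rewrite h // leqW.
Qed.

Definition ch (x : R) : R := (expR x + expR (- x)) / 2.

Lemma expR_le2 (k : R) : `|k| <= 1 / 2 -> expR k <= 1 + k + 2 * k ^+ 2.
Proof.
rewrite ler_norml => /andP[k1 k2].
have : 1 - k <= expR (- k) by exact: expR_ge1Dx.
rewrite expRN -[leRHS]div1r ler_pdivlMr ?expR_gt0 // => h.
have e0 := expR_gt0 k; nra.
Qed.

Lemma ch_bounds (k : R) : `|k| <= 1 / 2 -> 1 <= ch k <= 1 + 2 * k ^+ 2.
Proof.
move=> hk; rewrite /ch; have := expR_le2 hk.
have := @expR_le2 (- k); rewrite normrN => /(_ hk).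
have := expR_ge1Dx k; have := expR_ge1Dx (- k); rewrite sqrrN => *.
by apply/andP; split; lra.
Qed.

Lemma sh_bound (k : R) : `|k| <= 1 / 2 -> `|(expR k - expR (- k)) / 2| <= 2 * `|k|.
Proof.
wlog k0 : k / 0 <= k => [H|].
  have [k0|k0] := leP 0 k; first exact: H.
  move=> hk; have := H (- k); rewrite opprK normrN => /(_ ltac:(lra) hk).
  by rewrite -(normrN ((_ - _) / 2)) -mulNr opprB.
rewrite (ger0_norm k0) => k1; have := @expR_le2 k; rewrite (ger0_norm k0) => /(_ k1).
have := expR_ge1Dx k; have := expR_ge1Dx (- k) => h1 h2 h3.
have h4 : expR (- k) <= 1 by rewrite -expR0 ler_expR oppr_le0.
by rewrite ger0_norm; nra.
Qed.

(** This equals ch(y/8) (2 - x^2) - 2. The concavity of 2 - x^2 in x compensates the convexity of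
    ch(y/8) in y; dividing y by 8 makes the second-order and cross terms small enough. *)
Definition bellman_exp (x y : R) : R :=
  (ch (y / 8) - 1) * (2 - x ^+ 2) - x ^+ 2.

(** Here p, p' stand for exp(y/8), exp(-y/8) and q, q' for exp(h/8), exp(-h/8); q = q' = 1 is the
    step in which y stays. In the half-sums u, c and half-differences v, d the claim is polynomial:
    the gain 2 h^2 u from the factor 2 - x^2 outweighs the losses in [t1] and [t3]. *)
Lemma bellman_exp_arith (x h p p' q q' : R) : 0 < p -> 0 < p' ->
  `|x| <= 1 -> 1 <= (q + q') / 2 <= 1 + 2 * (h / 8) ^+ 2 ->
  `|(q - q') / 2| <= 2 * `|h / 8| ->
  ((p * q + p' * q') / 2 - 1) * (2 - (x + h) ^+ 2) - (x + h) ^+ 2 +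
  (((p * q' + p' * q) / 2 - 1) * (2 - (x - h) ^+ 2) - (x - h) ^+ 2) <=
  2 * (((p + p') / 2 - 1) * (2 - x ^+ 2) - x ^+ 2).
Proof.
move=> p0 p'0 x1 /andP[c1 c2] sk.
pose c := (q + q') / 2; pose d := (q - q') / 2.
have qE : q = c + d by rewrite /c /d; lra.
have q'E : q' = c - d by rewrite /c /d; lra.
rewrite -/c in c1 c2; rewrite -/d in sk; rewrite qE q'E.
pose u := (p + p') / 2; pose v := (p - p') / 2.
have pE : p = u + v by rewrite /u /v; lra.
have p'E : p' = u - v by rewrite /u /v; lra.
have uv : `|v| <= u by rewrite ler_norml /u /v; apply/andP; split; lra.
rewrite pE p'E.
have u0 : 0 <= u by exact: le_trans (normr_ge0 v) uv.
have x2 : 0 <= x ^+ 2 by exact: sqr_ge0.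
have hh : `|h| ^+ 2 = h ^+ 2 by rewrite real_normK ?num_real.
have t1 : (2 - x ^+ 2) * u * (c - 1) <= 2 * u * (2 * (h / 8) ^+ 2).
  have x21 : x ^+ 2 <= 1 by rewrite -(real_normK (num_real x)) expr_le1.
  apply: ler_pM; [apply: mulr_ge0 => //; lra|lra|apply: ler_wpM2r => //; lra|lra].
have t2 : h ^+ 2 * u <= h ^+ 2 * (u * c).
  by rewrite ler_wpM2l ?sqr_ge0 // ler_peMr.
have t3 : `|x * h * (v * d)| <= `|h| * (u * (2 * `|h / 8|)).
  rewrite normrM; apply: ler_pM => //.
    by rewrite normrM ler_piMl.
  by rewrite normrM ler_pM.
have {}t3 : - (x * h * (v * d)) <= h ^+ 2 * u / 4.
  have h8 : `|h / 8| = `|h| / 8 by rewrite normrM (ger0_norm (_ : 0 <= 8^-1)) // invr_ge0.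
  rewrite h8 in t3; have := ler_norm (- (x * h * (v * d))); rewrite normrN.
  move=> /le_trans/(_ t3); rewrite -hh; lra.
have hu : 0 <= h ^+ 2 * u by rewrite mulr_ge0 ?sqr_ge0.
lra.
Qed.

Lemma bellman_exp_concave : midpoint_concave [set x | `|x| <= 1] bellman_exp.
Proof.
move=> x h y /= h1 h2.
have x1 : `|x| <= 1.
  have -> : x = ((x + h) + (x - h)) / 2 by lra.
  rewrite normrM (ger0_norm (_ : 0 <= 2^-1)) ?invr_ge0 // ler_pdivrMr //.
  by rewrite (le_trans (ler_normD _ _)) //; lra.
have hh : `|h / 8| <= 1 / 2.
  have : `|h| <= 1.
    have -> : h = ((x + h) - (x - h)) / 2 by lra.
    rewrite normrM (ger0_norm (_ : 0 <= 2^-1)) ?invr_ge0 // ler_pdivrMr //.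
    by rewrite (le_trans (ler_normB _ _)) //; lra.
  by rewrite normrM (ger0_norm (_ : 0 <= 8^-1)) ?invr_ge0 //; lra.
have chk := ch_bounds hh; have shk := sh_bound hh.
rewrite /bellman_exp /ch; split.
  have := @bellman_exp_arith x h (expR (y / 8)) (expR (- (y / 8))) 1 1
    (expR_gt0 _) (expR_gt0 _) x1.
  rewrite !mulr1 (subrr 1) mul0r normr0; apply.
    by apply/andP; split; [lra|have := sqr_ge0 (h / 8); lra].
  by rewrite mulr_ge0.
have := @bellman_exp_arith x h (expR (y / 8)) (expR (- (y / 8)))
   (expR (h / 8)) (expR (- (h / 8))) (expR_gt0 _) (expR_gt0 _) x1 chk shk.
by rewrite (mulrDl y h) (mulrBl _ y h) !opprD opprK !expRD.
Qed.

Lemma bellman_exp_ge x y : `|x| <= 1 -> ch (y / 8) - 1 - x ^+ 2 <= bellman_exp x y.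
Proof.
move=> x1; rewrite /bellman_exp lerD2r.
have : x ^+ 2 <= 1 by rewrite -(real_normK (num_real x)) expr_le1.
have : 1 <= ch (y / 8).
  by rewrite /ch; have := expR_ge1Dx (y / 8); have := expR_ge1Dx (- (y / 8)); lra.
nra.
Qed.

Lemma bellman_exp_start x (b : bool) : `|x| <= 1 -> bellman_exp x (b%:R * x) <= 0.
Proof.
move=> x1; have x21 : x ^+ 2 <= 1 by rewrite -(real_normK (num_real x)) expr_le1.
rewrite /bellman_exp; case: b; rewrite ?mul1r ?mul0r; last first.
  by rewrite /ch oppr0 expR0; have := sqr_ge0 x; lra.
have hx : `|x / 8| <= 1 / 2.
  by rewrite normrM (ger0_norm (_ : 0 <= 8^-1)) ?invr_ge0 //; lra.
have /andP[c1 c2] := ch_bounds hx; have := sqr_ge0 x; nra.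
Qed.

Lemma ch_mono (x y : R) : 0 <= x -> x <= `|y| -> ch x <= ch y.
Proof.
move=> x0 xy; have -> : ch y = ch `|y|.
  by case: (ger0P y) => // _; rewrite /ch opprK addrC.
rewrite /ch ler_pM2r ?invr_gt0 //.
rewrite !expRN; have ex : 1 <= expR x by rewrite -expR0 ler_expR.
have ey : expR x <= expR `|y| by rewrite ler_expR.
move: ex ey; move: (expR x) (expR `|y|) => u v u1 uv.
have u0 : 0 < u by lra.
have v0 : 0 < v by lra.
have uU : u * u^-1 = 1 by rewrite mulfV // gt_eqF.
have vV : v * v^-1 = 1 by rewrite mulfV // gt_eqF.
rewrite -subr_ge0.
have -> : v + v^-1 - (u + u^-1) = (v - u) * (1 - u^-1 * v^-1).
  have : (v - u) * (1 - u^-1 * v^-1) = v - u - u^-1 * (v * v^-1) + (u * u^-1) * v^-1 by lra.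
  by rewrite vV uU; lra.
apply: mulr_ge0; first by lra.
by rewrite subr_ge0 -invfM invf_le1 ?mulr_gt0 //; nra.
Qed.

Lemma mtransf_exp th a N (A l : R) : dyadic_mart a -> 0 < A -> 0 <= l ->
  (forall k j, (j < 2 ^ k)%N -> `|a k j| <= A) ->
  (ch (l / 8) - 1) *
    \sum_(0 <= j < 2 ^ N) (nat_of_bool (l * A <= `|mtransf th a N j|))%:R <=
  A^-1 * \sum_(0 <= j < 2 ^ N) `|a N j|.
Proof.
move=> ma A0 l0 aA; have A'0 : 0 < A^-1 by rewrite invr_gt0.
have mW := @midpoint_concave_scale _ _ A^-1 bellman_exp_concave.
have aA' k j : (j < 2 ^ k)%N -> `|A^-1 * a k j| <= 1.
  by move=> jk; rewrite normrM (gtr0_norm A'0) ler_pdivrMl // mulr1 aA.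
have := @mtransf_le _ _ th a 0 N ma mW aA'.
rewrite add0n expn0 big_nat1 /= mulrCA => h.
have {h} : \sum_(0 <= j < 2 ^ N) bellman_exp (A^-1 * a N j) (A^-1 * mtransf th a N j) <= 0.
  apply: (le_trans h); rewrite -[leRHS](mulr0 (2 ^+ N)) ler_wpM2l ?exprn_ge0 //.
  by apply: bellman_exp_start; exact: aA'.
have : \sum_(0 <= j < 2 ^ N) ((ch (l / 8) - 1) * (nat_of_bool (l * A <= `|mtransf th a N j|))%:R - A^-1 * `|a N j|) <=
   \sum_(0 <= j < 2 ^ N) bellman_exp (A^-1 * a N j) (A^-1 * mtransf th a N j).
  rewrite !big_nat; apply: ler_sum => j /= jN.
  apply: le_trans (bellman_exp_ge _ (aA' _ _ jN)); apply: lerB.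
    have c1 : 1 <= ch (A^-1 * mtransf th a N j / 8).
      set z := _ / 8; rewrite /ch; have := expR_ge1Dx z; have := expR_ge1Dx (- z); lra.
    case: (leP (l * A)) => h /=; last by rewrite mulr0; lra.
    rewrite mulr1 lerB //; apply: ch_mono; first by rewrite divr_ge0.
    rewrite normrM (ger0_norm (_ : 0 <= 8^-1)) ?invr_ge0 // ler_pM2r ?invr_gt0 //.
    by rewrite normrM (gtr0_norm A'0) mulrC ler_pdivlMr.
  (* A square of a number of modulus at most 1 is below its modulus. Hence the right side is an L1
     norm, which will see the measure of the support of a layer. *)
  have := aA' _ _ jN; rewrite -(real_normK (num_real (A^-1 * _))) normrM (gtr0_norm A'0).
  set z := A^-1 * _ => z1; have : 0 <= z by rewrite mulr_ge0 // ltW.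
  by move=> z0; rewrite expr2 ler_piMl.
rewrite sumrB -!mulr_sumr; lra.
Qed.

(** The constant is 248 = 8 * 31, and exp(31) >= 32 follows from exp(x) >= 1 + x. Then ch is at
    least 16 * 32^k, which exceeds 8 * 4^k + 1. *)
Lemma ch_ge k : 8 * 4 ^+ k + 1 <= ch (248 * k.+1%:R / 8).
Proof.
have -> : 248 * k.+1%:R / 8 = 31 * k.+1%:R :> R by lra.
rewrite /ch expRM_natr.
have e31 : (32 : R) <= expR 31 by have := expR_ge1Dx (31 : R); lra.
have h1 : (32 : R) ^+ k.+1 <= expR 31 ^+ k.+1 by rewrite lerXn2r ?nnegrE // expR_ge0.
have h2 : (4 : R) ^+ k <= 32 ^+ k by rewrite lerXn2r ?nnegrE //; lra.
have h3 : (1 : R) <= 4 ^+ k by rewrite exprn_ege1 //; lra.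
have := expR_gt0 (- (31 * k.+1%:R) : R).
rewrite exprS in h1; lra.
Qed.

End Bellman.

(** * Averages over dyadic intervals and distributional bounds for finite transforms *)

Section DyadicAverages.
Context {R : realType}.
Implicit Types (f g : R -> R) (k j : nat) (th : nat -> bool).
Notation mu := (@lebesgue_measure R).
Local Hint Resolve measurable_I01 measurable_I01_ocitv : core.

Lemma Rintegral_split f (a b c : R) : a < b -> b < c ->
  mu.-integrable `]a, c[ (EFin \o f) ->
  \int[mu]_(u in `]a, c[) f u = \int[mu]_(u in `]a, b[) f u + \int[mu]_(u in `]b, c[) f u.
Proof.
move=> ab bc fi.
have IE : `]a, c[%classic = `]a, b[%classic `|` `[b, c[%classic :> set R.
  apply/seteqP; split => u /=; rewrite !in_itv /=.
    by move=> /andP[-> ->]; rewrite andbT; case: (ltP u b) => h; [left|right].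
  case=> /andP[h1 h2]; apply/andP; split => //.
    exact: lt_trans h2 bc.
  exact: lt_le_trans ab h1.
rewrite [in LHS]IE Rintegral_setU //; last 2 first.
- by rewrite -IE.
- apply/disj_setPRL => u /=; rewrite !in_itv /= => /andP[bu _]; apply/negP.
  by rewrite negb_and -!leNgt bu orbT.
congr (_ + _); rewrite Rintegral_itv_obnd_cbnd //.
apply: (integrableS _ _ _ fi) => // u /=; rewrite !in_itv /= => /andP[bu ->].
by rewrite (lt_trans ab bu).
Qed.

Definition lo k j : R := j%:R / 2 ^+ k.

Lemma lo_double k j : lo k.+1 j.*2 = lo k j.
Proof.
by rewrite /lo exprS invfM mulrA -mul2n natrM (mulrC 2 j%:R) mulfK.
Qed.

Lemma lo_lt k j j' : (j < j')%N -> lo k j < lo k j'.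
Proof. by move=> jj; rewrite /lo ltr_pM2r ?invr_gt0 ?exprn_gt0 // ltr_nat. Qed.

Lemma loS k j : lo k j.+1 = lo k j + (2 ^+ k)^-1.
Proof. by rewrite /lo -natr1 mulrDl mul1r. Qed.

Lemma dyadicE k j : dyadic_interval R k j = `]lo k j, lo k j.+1[%classic.
Proof. by []. Qed.

Lemma lo0 k : lo k 0 = 0. Proof. by rewrite /lo mul0r. Qed.

Lemma lo1 k : lo k (2 ^ k) = 1.
Proof. by rewrite /lo natrX mulfV // expf_neq0. Qed.

Lemma dyadic_sub k j : (j < 2 ^ k)%N -> dyadic_interval R k j `<=` I01 R.
Proof.
move=> jk u; rewrite dyadicE /= in_itv /= => /andP[h1 h2]; apply/in_I01; apply/andP; split.
  by apply: le_lt_trans h1; rewrite /lo divr_ge0 // exprn_ge0.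
apply: (lt_le_trans h2); rewrite -(lo1 k).
by rewrite /lo ler_pM2r ?invr_gt0 ?exprn_gt0 // ler_nat.
Qed.

Lemma measurable_dyadic k j : measurable (dyadic_interval R k j).
Proof. exact: measurable_itv. Qed.
Local Hint Resolve measurable_dyadic : core.

Lemma measurable_dyadic_ocitv k j : @measurable _ (measurableTypeR R) (dyadic_interval R k j).
Proof. exact: measurable_itv. Qed.
Local Hint Resolve measurable_dyadic_ocitv : core.

Lemma mu_dyadic k j : mu (dyadic_interval R k j) = ((2 ^+ k)^-1)%:E.
Proof.
rewrite dyadicE lebesgue_measure_itv /= lte_fin lo_lt //.
by rewrite -EFinB loS addrAC subrr add0r.
Qed.

Lemma mI_dyadic k j : (j < 2 ^ k)%N -> mI (dyadic_interval R k j) = (2 ^+ k)^-1.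
Proof. by move=> jk; rewrite /mI setIidr ?mu_dyadic //; exact: dyadic_sub. Qed.

Definition dint f k j : R := \int[mu]_(u in dyadic_interval R k j) f u.

Definition avg f k j : R := 2 ^+ k * dint f k j.

Lemma L1_dyadic f k j : L1 f -> (j < 2 ^ k)%N ->
  mu.-integrable (dyadic_interval R k j) (EFin \o f).
Proof. by move=> fi jk; apply: L1_sub => //; exact: dyadic_sub. Qed.

Lemma dint_split f k j : L1 f -> (j < 2 ^ k)%N ->
  dint f k j = dint f k.+1 j.*2 + dint f k.+1 j.*2.+1.
Proof.
move=> fi jk; rewrite /dint !dyadicE.
have -> : `]lo k j, lo k j.+1[%classic = `]lo k.+1 j.*2, lo k.+1 j.*2.+2[%classic :> set R.
  by rewrite -[in RHS]doubleS !lo_double.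
apply: Rintegral_split; [exact: lo_lt|exact: lo_lt|].
by rewrite -doubleS !lo_double; exact: L1_dyadic.
Qed.

Lemma avg_mart f : L1 f -> dyadic_mart (avg f).
Proof.
move=> fi k j jk; rewrite /avg (dint_split fi jk) exprS; lra.
Qed.

Lemma avg00 f : avg f 0 0 = I1 f.
Proof. by rewrite /avg expr0 mul1r /dint dyadicE /lo !expr0 !divr1. Qed.

Lemma sum_avg f k : L1 f -> \sum_(0 <= j < 2 ^ k) avg f k j = 2 ^+ k * I1 f.
Proof.
move=> fi; elim: k => [|k IH]; first by rewrite expn0 big_nat1 avg00 expr0 mul1r.
rewrite expnS mul2n sum_double exprS -mulrA -IH mulr_sumr !big_nat; apply: eq_bigr => j /= jk.
rewrite (avg_mart fi jk); lra.
Qed.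

Lemma le_avg f g k j : L1 f -> L1 g -> (j < 2 ^ k)%N ->
  (forall u, I01 R u -> f u <= g u) -> avg f k j <= avg g k j.
Proof.
move=> fi gi jk fg; rewrite /avg ler_pM2l ?exprn_gt0 //.
apply: le_Rintegral => //; [exact: L1_dyadic..|].
by move=> u hu; apply: fg; exact: dyadic_sub hu.
Qed.

Lemma avgD f g k j : L1 f -> L1 g -> (j < 2 ^ k)%N ->
  avg (f \+ g) k j = avg f k j + avg g k j.
Proof.
move=> fi gi jk; rewrite /avg -mulrDr; congr (_ * _).
by apply: RintegralD => //; exact: L1_dyadic.
Qed.

Lemma avg_cst (c : R) k j : avg (cst c) k j = c.
Proof.
rewrite /avg /dint Rintegral_cst //; have := mu_dyadic k j => /= -> /=.
by rewrite mulrCA mulfV ?mulr1 // expf_neq0.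
Qed.

Lemma avg_norm f k j : L1 f -> (j < 2 ^ k)%N ->
  `|avg f k j| <= avg (fun u => `|f u|) k j.
Proof.
move=> fi jk; rewrite /avg normrM ger0_norm ?exprn_ge0 // ler_pM2l ?exprn_gt0 //.
by apply: le_normr_Rintegral => //; exact: L1_dyadic.
Qed.

Lemma avg_bounded f (A : R) k j : L1 f -> (j < 2 ^ k)%N ->
  (forall u, I01 R u -> `|f u| <= A) -> `|avg f k j| <= A.
Proof.
move=> fi jk fA; apply: (le_trans (avg_norm fi jk)); rewrite -[leRHS](avg_cst A k j).
by apply: le_avg => //; [exact: L1_abs|exact: L1_cst].
Qed.

Lemma sum_avg_norm f k : L1 f ->
  \sum_(0 <= j < 2 ^ k) `|avg f k j| <= 2 ^+ k * I1 (fun u => `|f u|).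
Proof.
move=> fi; rewrite -(sum_avg _ (L1_abs fi)) !big_nat.
by apply: ler_sum => j jk; exact: avg_norm.
Qed.

Lemma half_lt k j : (j < 2 ^ k.+1)%N -> (j./2 < 2 ^ k)%N.
Proof. by rewrite ltn_half_double -mul2n -expnS. Qed.

Lemma dyadic_half k j : dyadic_interval R k.+1 j `<=` dyadic_interval R k j./2.
Proof.
move=> u; rewrite !dyadicE /= !in_itv /= => /andP[h1 h2].
rewrite -(lo_double k j./2) -(lo_double k j./2.+1) doubleS; apply/andP; split.
  apply: le_lt_trans h1; rewrite /lo ler_pM2r ?invr_gt0 ?exprn_gt0 // ler_nat.
  by rewrite -[leqRHS]odd_double_half leq_addl.
apply: (lt_le_trans h2); rewrite /lo ler_pM2r ?invr_gt0 ?exprn_gt0 // ler_nat.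
by rewrite -[in leqLHS](odd_double_half j) -addSn -add2n leq_add2r; case: (odd j).
Qed.

(** All that is used about the conditional expectations: their values on the open dyadic intervals.
    At the endpoints they stay arbitrary. *)
Definition averages f (ce : nat -> R -> R) := forall k j u,
  (j < 2 ^ k)%N -> dyadic_interval R k j u -> ce k u = avg f k j.

Definition trans th (ce : nat -> R -> R) N u : R :=
  \sum_(0 <= k < N.+1) (th k)%:R * (ce k u - ce_prev ce k u).

Lemma trans_mtransf f ce th N j u : averages f ce -> (j < 2 ^ N)%N ->
  dyadic_interval R N j u -> trans th ce N u = mtransf th (avg f) N j.
Proof.
move=> fce; elim: N j => [|N IH] j jN hu.
  rewrite /trans big_nat1 /= subr0 (fce _ _ _ jN hu).
  by move: jN; rewrite expn0 ltnS leqn0 => /eqP->.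
rewrite /trans big_nat_recr //= -/(trans th ce N u) (IH j./2) //; last first.
- exact: dyadic_half.
- exact: half_lt.
rewrite (fce _ _ _ jN hu) (fce N j./2) //; [exact: half_lt|exact: dyadic_half].
Qed.

Lemma mI_dyadic_split (A : set R) k j : mset01 A -> (j < 2 ^ k)%N ->
  mI (A `&` dyadic_interval R k j) <=
  mI (A `&` dyadic_interval R k.+1 j.*2) + mI (A `&` dyadic_interval R k.+1 j.*2.+1).
Proof.
move=> mA jk.
have mD k' j' : mset01 (A `&` dyadic_interval R k' j').
  by apply: mset01I => //; exact: mset01W.
have m1 := mset01_set1 (lo k.+1 j.*2.+1).
apply: (@le_trans _ _ (mI ((A `&` dyadic_interval R k.+1 j.*2 `|` A `&` dyadic_interval R k.+1 j.*2.+1) `|` [set lo k.+1 j.*2.+1]))).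
  apply: le_mI => //; first by apply: mset01U => //; exact: mset01U.
  move=> u Iu [Au]; rewrite !dyadicE /= !in_itv /=.
  rewrite -(lo_double k j) -(lo_double k j.+1) doubleS => /andP[h1 h2].
  by rewrite h1 h2 andbT /=; case: ltgtP => h; [left; left|left; right|right].
rewrite (le_trans (mI_setU _ m1)) //; first exact: mset01U.
by rewrite mI_set1 addr0; exact: mI_setU.
Qed.

Lemma mI_cover (A : set R) k : mset01 A ->
  mI A <= \sum_(0 <= j < 2 ^ k) mI (A `&` dyadic_interval R k j).
Proof.
move=> mA; elim: k => [|k IH].
  rewrite expn0 big_nat1 dyadicE /lo !expr0 !divr1; apply: le_mI => //.
  by apply: mset01I => //; apply: mset01W; exact: measurable_itv.
apply: (le_trans IH); rewrite expnS mul2n sum_double !big_nat.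
by apply: ler_sum => j /= jk; exact: mI_dyadic_split.
Qed.

Lemma mI_trans_ge f ce th N (l : R) : averages f ce -> mfun01 (trans th ce N) ->
  mI [set u | l <= `|trans th ce N u|] <=
  (2 ^+ N)^-1 * \sum_(0 <= j < 2 ^ N) (nat_of_bool (l <= `|mtransf th (avg f) N j|))%:R.
Proof.
move=> fce mt.
have mA : mset01 [set u | l <= `|trans th ce N u|] by apply: mset01_ge; exact: mfun01_abs.
apply: (le_trans (mI_cover N mA)); rewrite mulr_sumr !big_nat.
apply: ler_sum => j /= jN.
have mD : mset01 (dyadic_interval R N j) by exact: mset01W.
case: (leP l) => h.
  rewrite mulr1 -(mI_dyadic jN); apply: le_mI => //; first exact: mset01I.
  by move=> u _ [].
rewrite mulr0 (_ : _ `&` _ = set0) ?mI0 // -subset0 => u [/= hl hu].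
by move: h; rewrite -(trans_mtransf th fce jN hu) ltNge hl.
Qed.

Lemma trans_weak f ce th N (l : R) : averages f ce -> mfun01 (trans th ce N) ->
  L1 f -> 0 < l ->
  mI [set u | l <= `|trans th ce N u|] <= 2 / l * I1 (fun u => `|f u|).
Proof.
move=> fce mt fi l0; apply: (le_trans (mI_trans_ge l fce mt)).
have := mtransf_weak th N (avg_mart fi) l0; have := sum_avg_norm N fi => h1 h2.
rewrite ler_pdivrMl //; apply: (le_trans h2).
by rewrite [leRHS]mulrCA ler_pM2l // divr_gt0.
Qed.

Lemma trans_exp f ce th N (A l : R) : averages f ce -> mfun01 (trans th ce N) ->
  L1 f -> 0 < A -> 0 <= l -> (forall u, I01 R u -> `|f u| <= A) ->
  (ch (l / 8) - 1) * mI [set u | l * A <= `|trans th ce N u|] <=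
  A^-1 * I1 (fun u => `|f u|).
Proof.
move=> fce mt fi A0 l0 fA.
have := @mtransf_exp _ th _ N A l (avg_mart fi) A0 l0 (fun k j jk => avg_bounded fi jk fA).
have := mI_trans_ge (l * A) fce mt; have := sum_avg_norm N fi.
have p0 : 0 < (2 : R) ^+ N by rewrite exprn_gt0.
rewrite ler_pdivlMl //; set S := \sum_(0 <= j < _) _; set T := \sum_(0 <= j < _) _.
move=> h1 h2 h3; rewrite -(ler_pM2l p0) mulrCA.
have c0 : 0 <= ch (l / 8) - 1.
  by rewrite /ch; have := expR_ge1Dx (l / 8); have := expR_ge1Dx (- (l / 8)); lra.
apply: (@le_trans _ _ ((ch (l / 8) - 1) * S)); first by rewrite ler_wpM2l.
by apply: (le_trans h3); rewrite [leRHS]mulrCA ler_pM2l ?invr_gt0.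
Qed.

(** The square of the L2 norm of E_k f. *)
Definition energy f k : R := (2 ^+ k)^-1 * \sum_(0 <= j < 2 ^ k) avg f k j ^+ 2.

Lemma energy_le f (A : R) k : L1 f -> (forall u, I01 R u -> `|f u| <= A) ->
  energy f k <= A ^+ 2.
Proof.
move=> fi fA; rewrite /energy ler_pdivrMl ?exprn_gt0 //.
apply: (@le_trans _ _ (\sum_(0 <= j < 2 ^ k) A ^+ 2)).
  rewrite !big_nat; apply: ler_sum => j /= jk; rewrite -(real_normK (num_real (avg _ _ _))).
  have := avg_bounded fi jk fA; have := normr_ge0 (avg f k j); nra.
by rewrite sumr_const_nat subn0 -(mulr_natl (A ^+ 2)) natrX.
Qed.

(** Chebyshev's inequality for the L2 bound; the second alternative sets aside negative levels,
    where squaring is not monotone. *)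
Lemma trans_sq f ce th k m (l : R) : averages f ce -> mfun01 (trans th ce (k + m)) ->
  L1 f -> (forall i, (i <= k)%N -> th i = false) ->
  l ^+ 2 * mI [set u | l <= `|trans th ce (k + m) u|] <= energy f (k + m) - energy f k
  \/ l < 0.
Proof.
move=> fce mt fi th0; have [l0|l0] := ltP l 0; [by right|left].
have := @mtransf_sq _ th _ k m (avg_mart fi) (fun j => mtransf0 _ j th0).
have := mI_trans_ge l fce mt; rewrite /energy.
have p0 : 0 < (2 : R) ^+ (k + m) by rewrite exprn_gt0.
set T := \sum_(0 <= j < _) _; set X := \sum_(0 <= j < _) _ => h1.
set Y := \sum_(0 <= j < 2 ^ k) _; set Z := \sum_(0 <= j < _) _ => h2.
have h3 : l ^+ 2 * T <= X.
  rewrite /T /X mulr_sumr; apply: ler_sum => j _; case: (leP l) => h; rewrite ?mulr0 ?sqr_ge0 //.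
  by rewrite mulr1 -(real_normK (num_real (mtransf _ _ _ _))) ler_sqr ?nnegrE.
apply: (@le_trans _ _ (l ^+ 2 * ((2 ^+ (k + m))^-1 * T))).
  by rewrite ler_wpM2l ?sqr_ge0.
rewrite mulrCA -(ler_pM2l p0) mulVKf ?gt_eqF // mulrBr mulVKf ?gt_eqF //.
rewrite exprD mulrACA mulfV ?gt_eqF // mul1r.
exact: le_trans h3 h2.
Qed.

End DyadicAverages.

(** * Dyadic conditional expectations and convergence in measure *)

Section ConditionalExpectation.
Context {R : realType}.
Implicit Types (f g : R -> R) (k j : nat) (A : set R).
Notation mu := (@lebesgue_measure R).
Local Hint Resolve measurable_I01 measurable_I01_ocitv measurable_dyadic measurable_dyadic_ocitv : core.

Lemma filtration_dyadic k j : (j < 2 ^ k)%N -> dyadic_filtration R k (dyadic_interval R k j).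
Proof. by move=> jk; apply: sub_sigma_algebra; exists j. Qed.

Lemma dyadic_inj k j j' u : dyadic_interval R k j u -> dyadic_interval R k j' u -> j = j'.
Proof.
rewrite !dyadicE /= !in_itv /= => /andP[a1 b1] /andP[a2 b2].
apply/eqP; rewrite eqn_leq; apply/andP; split; rewrite leqNgt; apply/negP => h.
  have : lo k j'.+1 <= lo k j :> R.
    by rewrite /lo ler_pM2r ?invr_gt0 ?exprn_gt0 // ler_nat.
  lra.
have : lo k j.+1 <= lo k j' :> R.
  by rewrite /lo ler_pM2r ?invr_gt0 ?exprn_gt0 // ler_nat.
lra.
Qed.

(** Good sets principle: the sets that contain or miss a given dyadic interval form a sigma-algebra,
    so dyadic intervals are atoms. *)
Lemma filtration_atom k j A : (j < 2 ^ k)%N -> dyadic_filtration R k A ->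
  dyadic_interval R k j `<=` A \/ A `&` dyadic_interval R k j = set0.
Proof.
move=> jk; apply: (@smallest_sub _ (sigma_algebra (I01 R)) _
  [set A | dyadic_interval R k j `<=` A \/ A `&` dyadic_interval R k j = set0]).
  split.
  - by right; rewrite set0I.
  - move=> B [h|h]; [right|left].
      by rewrite -subset0 => u [[_ nBu] /h].
    move=> u hu; split; first exact: dyadic_sub hu.
    by move=> Bu; have : (B `&` dyadic_interval R k j) u by []; rewrite h.
  - move=> B h; have [[i hi]|H] := pselect (exists i, dyadic_interval R k j `<=` B i).
      by left => u /hi Bu; exists i.
    right; rewrite -subset0 => u [[i _ Bu] hu]; case: (h i) => [hi|hi].
      by apply: H; exists i.
    by have : (B i `&` dyadic_interval R k j) u by []; rewrite hi.
move=> _ [i ik <-] /=; have [->|ij] := eqVneq i j; [by left|right].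
rewrite -subset0 => u [h1 h2]; move/negP: ij; apply; apply/eqP.
exact: dyadic_inj h1 h2.
Qed.

Lemma filtration_measurable k A : dyadic_filtration R k A -> measurable A /\ A `<=` I01 R.
Proof.
apply: (@smallest_sub _ (sigma_algebra (I01 R)) _ [set A | measurable A /\ A `<=` I01 R]).
  split.
  - by split; [exact: measurable0|exact: sub0set].
  - move=> B [mB BI]; split; last by move=> u [].
    exact: (measurableD measurable_I01 mB).
  - move=> B h; split; first by apply: bigcupT_measurable => i; case: (h i).
    by move=> u [i _ Bu]; exact: (h i).2.
by move=> _ [i ik <-] /=; split => //; exact: dyadic_sub.
Qed.

(** The level set of [ce k] through u belongs to the filtration and meets the atom of u, hence
    contains it. So [ce k] is constant there, and the integral identity fixes the constant. *)
Lemma cond_exp_averages f (ce : nat -> R -> R) :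
  (forall n, is_cond_exp (dyadic_filtration R n) f (ce n)) -> averages f ce.
Proof.
move=> H k j u jk hu; have [h1 h2 h3] := H k.
have F1 := h1 [set ce k u] (measurable_set1 _).
have hv v : dyadic_interval R k j v -> ce k v = ce k u.
  case: (filtration_atom jk F1) => [h|h]; first by move=> /h[].
  have : (I01 R `&` ce k @^-1` [set ce k u] `&` dyadic_interval R k j) u.
    by split => //; split => //; exact: dyadic_sub hu.
  by rewrite h.
have := h3 _ (filtration_dyadic jk).
rewrite -/(dint f k j) /avg => <-.
rewrite (@eq_Rintegral _ _ _ _ _ (cst (ce k u))); last first.
  by move=> v /set_mem /hv.
rewrite Rintegral_cst //; have := @mu_dyadic R k j => /= -> /=.
by rewrite mulrCA mulfV ?mulr1 // expf_neq0.
Qed.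

(** An explicit version of E_k f. The value 0 at the dyadic endpoints keeps its preimages exactly
    inside the filtration, since the endpoints together form a complement of atoms. *)
Definition step f k u : R :=
  let j := Num.truncn (2 ^+ k * u) in
  if u \in dyadic_interval R k j then avg f k j else 0.

Lemma step_dyadic f k j u : dyadic_interval R k j u -> step f k u = avg f k j.
Proof.
move=> hu; rewrite /step; suff -> : Num.truncn (2 ^+ k * u) = j by rewrite mem_set.
apply: truncn_def; move: hu; rewrite dyadicE /= in_itv /= /lo => /andP[h1 h2].
rewrite mulrC; apply/andP; split.
  by rewrite -ler_pdivrMr ?exprn_gt0 // ltW.
by rewrite -ltr_pdivlMr ?exprn_gt0.
Qed.

Lemma step_out f k u : I01 R u -> (forall j, (j < 2 ^ k)%N -> ~ dyadic_interval R k j u) ->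
  step f k u = 0.
Proof.
move=> /in_I01/andP[u0 u1] h; rewrite /step; case: ifPn => // /set_mem hu.
exfalso; apply: (h _ _ hu); rewrite -(ltr_nat R).
have /andP[h1 _] := @truncn_itv _ (2 ^+ k * u) ltac:(by rewrite mulr_ge0 ?ltW).
by apply: (le_lt_trans h1); rewrite natrX -[ltRHS]mulr1 ltr_pM2l.
Qed.

Lemma step_averages f : averages f (step f).
Proof. by move=> k j u _; exact: step_dyadic. Qed.

Lemma step_preimage f k (B : set R) :
  dyadic_filtration R k (I01 R `&` step f k @^-1` B).
Proof.
pose C j := if (j < 2 ^ k)%N then dyadic_interval R k j else set0.
pose C' j := if (j < 2 ^ k)%N && (avg f k j \in B) then dyadic_interval R k j else set0.
have FC : dyadic_filtration R k (\bigcup_j C j).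
  apply: sigma_algebra_bigcup => j; rewrite /C; case: ifPn => jk.
    exact: filtration_dyadic.
  exact: sigma_algebra0.
have FC' : dyadic_filtration R k (\bigcup_j C' j).
  apply: sigma_algebra_bigcup => j; rewrite /C'; case: ifPn => [/andP[jk _]|_].
    exact: filtration_dyadic.
  exact: sigma_algebra0.
have FO : dyadic_filtration R k (if 0 \in B then I01 R `\` \bigcup_j C j else set0).
  by case: ifPn => _; [exact: sigma_algebraCD|exact: sigma_algebra0].
suff -> : I01 R `&` step f k @^-1` B =
    \bigcup_i bigcup2 (\bigcup_j C' j) (if 0 \in B then I01 R `\` \bigcup_j C j else set0) i.
  apply: sigma_algebra_bigcup => -[|[|i]] //=; exact: sigma_algebra0.
rewrite bigcup2E; apply/seteqP; split => u.
  move=> [Iu /= Bu]; have [[j [jk hu]]|H] := pselect (exists j, (j < 2 ^ k)%N /\ dyadic_interval R k j u).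
    left; exists j => //; rewrite /C' jk /=.
    by rewrite -(step_dyadic f hu) mem_set.
  right; rewrite (step_out f Iu) in Bu; last by move=> j jk hu; apply: H; exists j.
  rewrite mem_set //; split => // -[j _]; rewrite /C; case: ifPn => // jk hu.
  by apply: H; exists j.
case=> [[j _]|].
  rewrite /C'; case: ifPn => // /andP[jk /set_mem Bj] hu; split; first exact: dyadic_sub hu.
  by rewrite /= (step_dyadic f hu).
case: ifPn => // /set_mem B0 [Iu h]; split => //=; rewrite step_out // => j jk hu.
by apply: h; exists j => //; rewrite /C jk.
Qed.

Lemma mfun01_step f k : mfun01 (step f k).
Proof. move=> mD B mB; have [H _] := filtration_measurable (@step_preimage f k B).
exact: H. Qed.

Lemma avg_step f k j : (j < 2 ^ k)%N -> avg (step f k) k j = avg f k j.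
Proof.
move=> jk; rewrite -[RHS](avg_cst _ k j) /avg /dint; congr (_ * _).
by apply: eq_Rintegral => u /set_mem hu; rewrite (step_dyadic f hu).
Qed.

Lemma step_le f k (M : R) u : (forall j, (j < 2 ^ k)%N -> `|avg f k j| <= M) -> 0 <= M ->
  I01 R u -> `|step f k u| <= M.
Proof.
move=> hM M0 Iu; have [[j [jk hu]]|H] := pselect (exists j, (j < 2 ^ k)%N /\ dyadic_interval R k j u).
  by rewrite (step_dyadic f hu) hM.
by rewrite step_out ?normr0 // => j jk hu; apply: H; exists j.
Qed.

Lemma L1_step f k : L1 f -> L1 (step f k).
Proof.
move=> fi; pose M := \sum_(0 <= j < 2 ^ k) `|avg f k j|.
have M0 : 0 <= M by apply: sumr_ge0.
have hM j : (j < 2 ^ k)%N -> `|avg f k j| <= M.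
  move=> jk; rewrite /M (bigD1_seq j) ?mem_index_iota ?iota_uniq //=.
  by rewrite lerDl sumr_ge0.
apply: (L1_le _ (L1_cst M)); first exact: mfun01_step.
by move=> u Iu; rewrite (ger0_norm M0); exact: step_le.
Qed.

Lemma mfun01_patch f A : measurable A -> mfun01 f -> mfun01 (f \_ A).
Proof.
move=> mA mf; apply/measurable_restrict; [exact: mA|exact: measurable_I01|].
apply: (measurable_funS _ _ mf); [exact: measurable_I01|exact: subIsetl].
Qed.

Lemma L1_patch f A : measurable A -> L1 f -> L1 (f \_ A).
Proof.
move=> mA fi; apply: (L1_le _ fi); first by apply: mfun01_patch => //; exact: L1_mfun.
by move=> u _; rewrite patchE; case: ifPn => // _; rewrite normr0.
Qed.

Lemma avg_patch_eq f g A k j : (j < 2 ^ k)%N -> dyadic_filtration R k A ->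
  avg f k j = avg g k j -> avg (f \_ A) k j = avg (g \_ A) k j.
Proof.
move=> jk FA fg; case: (filtration_atom jk FA) => h.
  have E (h' : R -> R) : avg (h' \_ A) k j = avg h' k j.
    rewrite /avg /dint; congr (_ * _); apply: eq_Rintegral => u /set_mem /h Au.
    by rewrite patchE mem_set.
  by rewrite !E.
have E (h' : R -> R) : avg (h' \_ A) k j = 0.
  rewrite -[RHS](avg_cst _ k j) /avg /dint; congr (_ * _).
  apply: eq_Rintegral => u /set_mem hu; rewrite patchE memNset // => Au.
  by have : (A `&` dyadic_interval R k j) u by []; rewrite h.
by rewrite !E.
Qed.

Lemma cond_exp_step f k : L1 f -> is_cond_exp (dyadic_filtration R k) f (step f k).
Proof.
move=> fi; split.
- by move=> B _; exact: step_preimage.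
- exact: L1_step.
move=> A FA; have [mA AI] := filtration_measurable FA.
have E g : \int[mu]_(u in A) g u = I1 (g \_ A).
  by rewrite -[in LHS](setIidr AI) Rintegral_mkcondr.
rewrite !E; have p0 : (2 : R) ^+ k != 0 by rewrite expf_neq0.
apply: (mulfI p0); rewrite -!sum_avg; [|exact: L1_patch|by apply: L1_patch => //; exact: L1_step].
rewrite !big_nat; apply: eq_bigr => j /= jk.
by apply: avg_patch_eq => //; exact: avg_step.
Qed.

Lemma stepD f g k u : L1 f -> L1 g -> I01 R u ->
  step (f \+ g) k u = step f k u + step g k u.
Proof.
move=> fi gi Iu; have [[j [jk hu]]|H] := pselect (exists j, (j < 2 ^ k)%N /\ dyadic_interval R k j u).
  by rewrite !(step_dyadic _ hu) avgD.
by rewrite !step_out ?addr0 // => j jk hu; apply: H; exists j.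
Qed.

Lemma transD f g th N u : L1 f -> L1 g -> I01 R u ->
  trans th (step (f \+ g)) N u = trans th (step f) N u + trans th (step g) N u.
Proof.
move=> fi gi Iu; rewrite /trans -big_split /=; apply: eq_bigr => k _.
rewrite -mulrDr; congr (_ * _); rewrite stepD //.
by case: k => [|k] /=; rewrite ?stepD //; lra.
Qed.

Lemma mfun01_trans f th N : mfun01 (trans th (step f) N).
Proof.
apply: (@mfun01_sum _ (fun k u => (th k)%:R * (step f k u - ce_prev (step f) k u))) => k.
apply: (@mfun01Z _ _ (fun u => step f k u - ce_prev (step f) k u)).
apply: measurable_funB; first exact: mfun01_step.
by case: k => [|k] /=; [exact: measurable_cst|exact: mfun01_step].
Qed.

Definition partial_transf (ce : nat -> R -> R) n u : R :=
  \sum_(0 <= m < n) (ce m.*2 u - ce_prev ce m.*2 u).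

Lemma mfun01_partial_transf ce n : (forall k, mfun01 (ce k)) ->
  mfun01 (partial_transf ce n).
Proof.
move=> mce; apply: (@mfun01_sum _ (fun k u => ce k.*2 u - ce_prev ce k.*2 u)) => k.
apply: measurable_funB; first exact: mce.
by case: k.*2 => [|?] /=; [exact: measurable_cst|exact: mce].
Qed.

(** The multipliers that keep the even increments lying between the m-th and the n-th partial sum of
    T. *)
Definition window m n i := ~~ odd i && (m <= i./2 < n)%N.

Lemma partial_window ce m n u : (m <= n)%N ->
  partial_transf ce n u - partial_transf ce m u = trans (window m n) ce n.*2 u.
Proof.
move=> mn; rewrite /trans big_nat_recr //= sum_double.
(* [trans] includes the generation [n.*2], which lies just outside the window; dropping it leaves an
   even number of terms to be paired. *)
have -> : window m n n.*2 = false by rewrite /window doubleK ltnn !andbF.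
rewrite mul0r addr0 /partial_transf (big_cat_nat (n := m)) //= addrAC subrr add0r.
rewrite [RHS](big_cat_nat (n := m)) //= [X in _ = X + _]big1_seq ?add0r; last first.
  move=> i; rewrite mem_index_iota => /andP[_ /andP[_ im]].
  rewrite /window doubleK /= odd_double /= (leqNgt m) im /= mul0r add0r.
  by rewrite mul0r.
rewrite !big_nat; apply: eq_bigr => i /= /andP[mi inn].
by rewrite /window doubleK /= odd_double /= mi inn /= mul1r mul0r addr0.
Qed.

Lemma mI_geD (x y : R -> R) (l l' : R) : mfun01 x -> mfun01 y ->
  mI [set u | l + l' <= `|x u + y u|] <=
  mI [set u | l <= `|x u|] + mI [set u | l' <= `|y u|].
Proof.
move=> mx my.
have m1 : mset01 [set u | l <= `|x u|] by apply: mset01_ge; exact: mfun01_abs.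
have m2 : mset01 [set u | l' <= `|y u|] by apply: mset01_ge; exact: mfun01_abs.
apply: le_trans (mI_setU m1 m2); apply: le_mI; last 1 first.
- move=> u _ /= h; have [|xs] := leP l `|x u|; [by left|right].
  have := ler_normD (x u) (y u); lra.
- by apply: mset01_ge; apply: mfun01_abs; exact: measurable_funD.
- exact: mset01U.
Qed.

Lemma energy_nd f k m : L1 f -> energy f k <= energy f (k + m).
Proof.
move=> fi; have := @mtransf_sq _ (fun=> false) _ k m (avg_mart fi) (fun j => mtransf0 _ j (fun _ _ => erefl)).
have : 0 <= \sum_(0 <= j < 2 ^ (k + m)) mtransf (fun=> false) (avg f) (k + m) j ^+ 2.
  by apply: sumr_ge0 => j _; exact: sqr_ge0.
rewrite /energy; set S := \sum_(0 <= j < _) _; set T := \sum_(0 <= j < _) _.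
set V := \sum_(0 <= j < _) _ => h1 h2.
rewrite ler_pdivlMl // exprD mulrACA mulfV ?expf_neq0 // mul1r; lra.
Qed.

Lemma energy_cauchy f (A e : R) : L1 f -> (forall u, I01 R u -> `|f u| <= A) -> 0 < e ->
  exists K, forall k m, (K <= k)%N -> energy f (k + m) - energy f k <= e.
Proof.
move=> fi fA e0.
have nd : nondecreasing_seq (energy f).
  by apply/nondecreasing_seqP => k; rewrite -addn1; exact: energy_nd.
have cv : cvgn (energy f).
  apply: nondecreasing_is_cvgn => //.
  by exists (A ^+ 2) => _ [k _ <-]; exact: energy_le.
have /cvgrPdist_lt /(_ e e0) [K _ hK] := cv.
exists K => k m Kk; have := nondecreasing_cvgn_le nd cv (k + m)%N.
have := hK k Kk; rewrite /= ltr_norml => /andP[_ h1] h2; lra.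
Qed.

Definition clip (M v : R) : R := Num.max (- M) (Num.min M v).

Lemma clip_norm M v : 0 <= M -> `|clip M v| <= M.
Proof.
move=> M0; rewrite /clip ler_norml le_max lexx /= ge_max ge_min lexx andbT; lra.
Qed.

Lemma clip_id M v : `|v| <= M -> clip M v = v.
Proof.
rewrite ler_norml => /andP[h1 h2]; rewrite /clip; case: (leP M v) => h; last first.
  by rewrite max_r.
have <- : M = v by lra.
by rewrite max_r //; lra.
Qed.

Lemma clip_sub M v : 0 <= M -> `|v - clip M v| = Num.max 0 (`|v| - M).
Proof.
move=> M0; have [h|h] := leP `|v| M.
  by rewrite clip_id // subrr normr0 max_l // subr_le0.
rewrite max_r; last by rewrite subr_ge0 ltW.
rewrite /clip; case: (ger0P v) h => v0 h.
  by rewrite (min_l (ltW h)) max_r ?ger0_norm //; lra.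
rewrite min_r; last by lra.
by rewrite max_l; [rewrite ltr0_norm; lra|lra].
Qed.

Lemma mfun01_clip M f : mfun01 f -> mfun01 (fun u => clip M (f u)).
Proof.
move=> mf; apply: measurable_maxr; first exact: measurable_cst.
by apply: measurable_minr => //; exact: measurable_cst.
Qed.

Lemma L1_clip M f : 0 <= M -> L1 f -> L1 (fun u => clip M (f u)).
Proof.
move=> M0 fi; apply: (L1_le _ (L1_cst M)); first by apply: mfun01_clip; exact: L1_mfun.
by move=> u _; rewrite (ger0_norm M0) clip_norm.
Qed.

Lemma clip_tail f (e : R) : L1 f -> 0 < e -> exists M, 0 <= M /\
  I1 (fun u => `|f u - clip M (f u)|) < e.
Proof.
move=> fi e0; have mf := L1_mfun fi.
have [_ _] := @dominated_convergence _ _ _ mu (I01 R) measurable_I01_ocitv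
  (fun n u => (`|f u - clip n%:R (f u)|)%:E) (cst 0%E) (fun u => (`|f u|)%:E)
  ltac:(by move=> n; apply/measurable_EFinP; apply: mfun01_abs; apply: measurable_funB => //; exact: mfun01_clip)
  ltac:(exact: measurable_cst)
  ltac:(apply: aeW => u Iu; apply/fine_cvgP; split; [exact: nearW|
    apply: cvg_near_cst; exists (Num.bound `|f u|) => // n /= hn;
    rewrite clip_id ?subrr ?normr0 //; apply: (le_trans (ltW (archi_boundP (normr_ge0 _)))); by rewrite ler_nat])
  (L1_abs fi)
  ltac:(apply: aeW => u n Iu; rewrite /= lee_fin normr_id clip_sub // ge_max normr_ge0 /= gerBl //).
rewrite integral0 => /fine_cvgP[_] /cvgrPdist_lt /(_ e e0) [n _ /(_ n (leqnn n))] /=.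
rewrite sub0r normrN => h; exists n%:R; split => //.
exact: le_lt_trans (ler_norm _) h.
Qed.

(** f is clipped so that the remainder f1 has L1 norm below e^2/8; at level e/2 the weak bound then
    gives at most e/2. For the bounded part f2, Chebyshev at level e/2 needs an energy increment of
    at most e^3/8. *)
Lemma partial_cauchy f (e : R) : L1 f -> 0 < e -> exists N, forall m n,
  (N <= m)%N -> (m <= n)%N ->
  mI [set u | e <= `|partial_transf (step f) n u - partial_transf (step f) m u|] <= e.
Proof.
move=> fi e0.
have E1 : 2 / (e / 2) = 4 / e by rewrite invfM invrK; lra.
have E2 : e / 2 + e / 2 = e by lra.
have E3 : e ^+ 3 / 8 <= (e / 2) ^+ 2 * (e / 2) by lra.
have E4 (a : R) : a < e ^+ 2 / 8 -> 4 * a <= e / 2 * e by lra.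
have E5 (a b c : R) : a <= b + c -> c <= e / 2 -> b <= e / 2 -> a <= e by lra.
have E6 : 0 < e / 2 by lra.
have e8 : 0 < e ^+ 2 / 8 by rewrite divr_gt0 // exprn_gt0.
have [M [M0 hM]] := clip_tail fi e8.
pose f2 u := clip M (f u); pose f1 := f \- f2.
have f2i : L1 f2 by exact: L1_clip.
have f1i : L1 f1 by exact: L1B.
have ff : f = f1 \+ f2 by apply/funext => u; rewrite /f1 /= subrK.
have f2A u : I01 R u -> `|f2 u| <= M by move=> _; exact: clip_norm.
have e8' : 0 < e ^+ 3 / 8 by rewrite divr_gt0 // exprn_gt0.
have [K HK] := energy_cauchy f2i f2A e8'.
exists K.+1 => m n Km mn.
have m0 : (0 < m)%N by exact: leq_trans Km.
have h1 := @trans_weak _ f1 _ (window m n) n.*2 (e / 2) (step_averages f1) (mfun01_trans _ _ _) f1i E6.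
(* The window starts at generation [m.*2], so the transform is still zero at generation [m.*2.-1];
   the predecessor is genuine because m > 0. *)
pose k := m.*2.-1.
have kn : (k + (n.*2 - k) = n.*2)%N.
  by rewrite subnKC // /k (leq_trans (leq_pred _)) // leq_double.
have Kk : (K <= k)%N.
  rewrite /k -ltnS prednK ?double_gt0 // (leq_trans Km) // -addnn leq_addr //.
have th0 i : (i <= k)%N -> window m n i = false.
  move=> ik; rewrite /window; case: (boolP (odd i)) => //= io.
  have im : (i < m.*2)%N by rewrite -[m.*2]prednK ?double_gt0 // ltnS.
  by rewrite (leqNgt m) ltn_half_double im.
have h2 := @trans_sq _ f2 _ (window m n) k (n.*2 - k) (e / 2) (step_averages f2) (mfun01_trans _ _ _) f2i th0.
rewrite kn in h2; case: h2 => [h2|]; last by rewrite ltNge (ltW E6).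
have := HK k (n.*2 - k)%N Kk; rewrite kn => h3.
have h4 : mI [set u | e / 2 <= `|trans (window m n) (step f2) n.*2 u|] <= e / 2.
  have q0 : 0 < (e / 2) ^+ 2 by rewrite exprn_gt0 // divr_gt0.
  by rewrite -(ler_pM2l q0) (le_trans h2) // (le_trans h3).
have h5 : mI [set u | e / 2 <= `|trans (window m n) (step f1) n.*2 u|] <= e / 2.
  apply: (le_trans h1).
  by rewrite E1 mulrAC ler_pdivrMr //; apply: E4; exact: hM.
have := @mI_geD (trans (window m n) (step f1) n.*2) (trans (window m n) (step f2) n.*2) (e / 2) (e / 2) (mfun01_trans _ _ _) (mfun01_trans _ _ _).
rewrite E2 => h6; apply: (@le_trans _ _ (mI [set u | e <=
  `|trans (window m n) (step f1) n.*2 u + trans (window m n) (step f2) n.*2 u|])); last exact: E5 h6 h4 h5.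
have mP i : mfun01 (partial_transf (step f) i).
  by apply: mfun01_partial_transf; exact: mfun01_step.
apply: le_mI.
- by apply: mset01_ge; apply: mfun01_abs; apply: measurable_funB; exact: mP.
- by apply: mset01_ge; apply: mfun01_abs; apply: measurable_funD; exact: mfun01_trans.
move=> u Iu /=; rewrite partial_window // {1}ff transD //.
Qed.

(** Completeness for convergence in measure: along a fast subsequence consecutive differences exceed
    2^-k only on sets of measure at most 2^-k, so the telescoping series has tails small in
    measure. *)
Lemma measure_cauchy_limit (h : nat -> R -> R) : (forall n, mfun01 (h n)) ->
  (forall e : R, 0 < e -> exists N, forall m n, (N <= m)%N -> (m <= n)%N ->
     mI [set u | e <= `|h n u - h m u|] <= e) ->
  exists g, mfun01 g /\ forall e : R, 0 < e -> exists N, forall n, (N <= n)%N ->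
     mI [set u | e <= `|h n u - g u|] <= e.
Proof.
move=> mh ch_; pose q : R := 2^-1.
have q0 : 0 < q by rewrite invr_gt0.
have [Nk HN] := choice (fun k => ch_ (q ^+ k) (exprn_gt0 k q0)).
pose nk k := (\sum_(0 <= i < k.+1) Nk i)%N.
have nkS k : (nk k <= nk k.+1)%N by rewrite /nk [leqRHS]big_nat_recr //= leq_addr.
have nkN k : (Nk k <= nk k)%N by rewrite /nk big_nat_recr //= leq_addl.
pose d k := h (nk k.+1) \- h (nk k).
have md k : mfun01 (d k) by apply: measurable_funB; exact: mh.
have tele K v : \sum_(0 <= k < K) d k v = h (nk K) v - h (nk 0%N) v.
  by rewrite /d telescope_sumr.
pose g := h (nk 0%N) \+ lims d.
have mg : mfun01 g by apply: measurable_funD; [exact: mh|exact: mfun01_lims].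
exists g; split => // e e0.
have dd k : dist (d k) (q ^+ k) <= q ^+ k.
  apply: (@le_trans _ _ (mI [set u | q ^+ k <= `|h (nk k.+1) u - h (nk k) u|])).
    apply: le_mI; [exact: mset01_dist| |by move=> u _ /= /ltW].
    by apply: mset01_ge; apply: mfun01_abs; exact: md.
  by apply: HN.
have geo K n : (K <= n)%N -> \sum_(K <= k < n) q ^+ k <= 2 * q ^+ K.
  move=> Kn; rewrite -(subnKC Kn) sum_addl.
  have -> : \sum_(0 <= k < n - K) q ^+ (K + k) = \sum_(0 <= k < n - K) 2^-1 ^+ k.+1 * (2 * q ^+ K).
    by apply: eq_bigr => k _; rewrite exprD exprS /q; lra.
  by apply: sum_half; rewrite mulr_ge0 // exprn_ge0 // ltW.
have tail K : dist (lims d \- (fun u => \sum_(0 <= k < K) d k u)) (2 * q ^+ K) <= 2 * q ^+ K.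
  by apply: (@dist_lims _ d (fun k => q ^+ k) (fun k => q ^+ k)) => //; exact: geo.
have [K hK] := @geom_small _ q 2 (e / 2) ltac:(by apply/andP; split; rewrite /q; lra) ltac:(lra).
exists (nk K) => n Kn.
have h1 : mI [set u | q ^+ K <= `|h n u - h (nk K) u|] <= q ^+ K by apply: HN.
pose w1 := h n \- h (nk K); pose w2 := (fun u => \sum_(0 <= k < K) d k u) \- lims d.
have mw1 : mfun01 w1 by apply: measurable_funB; exact: mh.
have mw2 : mfun01 w2 by apply: measurable_funB; [exact: mfun01_sum|exact: mfun01_lims].
have E : [set u | e <= `|h n u - g u|] = [set u | e / 2 + e / 2 <= `|w1 u + w2 u|].
  apply/seteqP; split => u /=; rewrite /w1 /w2 /= tele /g /=;
  have -> : h n u - h (nk K) u + (h (nk K) u - h (nk 0%N) u - lims d u) =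
     h n u - (h (nk 0%N) u + lims d u) by lra.
    by move=> h2; lra.
  by move=> h2; lra.
rewrite E; apply: (le_trans (mI_geD (e / 2) (e / 2) mw1 mw2)).
have h2 : mI [set u | e / 2 <= `|w1 u|] <= q ^+ K.
  apply: le_trans h1; apply: le_mI; [by apply: mset01_ge; exact: mfun01_abs..|].
  move=> u _ /=; apply: le_trans; lra.
have h3 : mI [set u | e / 2 <= `|w2 u|] <= 2 * q ^+ K.
  apply: le_trans (tail K); apply: le_mI.
  - by apply: mset01_ge; exact: mfun01_abs.
  - by apply: mset01_dist; apply: measurable_funB; [exact: mfun01_lims|exact: mfun01_sum].
  by move=> u _ /=; rewrite distrC; apply: lt_le_trans.
lra.
Qed.

End ConditionalExpectation.

(** * The Calderon bound for the martingale transform *)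

Section CalderonEstimate.
Context {R : realType}.
Implicit Types (f g : R -> R) (k j : nat) (A : set R).
Notation mu := (@lebesgue_measure R).
Local Hint Resolve measurable_I01 measurable_I01_ocitv : core.
#[local] Opaque rearr calderon.

Lemma clip0 (v : R) : clip 0 v = 0.
Proof. by apply/eqP; rewrite -normr_le0 clip_norm. Qed.

Lemma clip_out (M v : R) : 0 <= M -> M < `|v| -> clip M v = if 0 <= v then M else - M.
Proof.
rewrite /clip => M0; case: (ger0P v) => v0 h.
  by rewrite min_l ?max_r //; lra.
by rewrite min_r ?max_l //; lra.
Qed.

Lemma clip_diff (a b v : R) : 0 <= b -> b <= a ->
  `|clip a v - clip b v| <= (a - b) * (nat_of_bool (b < `|v|)%R)%:R.
Proof.
move=> b0 ba; case: (leP `|v| b) => h.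
  by rewrite !clip_id ?subrr ?normr0 ?mulr0 // (le_trans h).
rewrite mulr1 (clip_out b0 h); case: (leP `|v| a) => h'.
  rewrite clip_id //; case: (ger0P v) h h' => v0 h h'; rewrite ler_norml; apply/andP; split; lra.
rewrite clip_out //; last exact: le_trans ba.
by case: (0 <= v); rewrite ler_norml; apply/andP; split; lra.
Qed.

Lemma I1_supp f A (a : R) : L1 f -> mset01 A -> 0 <= a ->
  (forall u, I01 R u -> `|f u| <= a) -> (forall u, I01 R u -> ~ A u -> f u = 0) ->
  I1 (fun u => `|f u|) <= a * mI A.
Proof.
move=> fi mA a0 fa f0.
have mi : mu.-integrable (I01 R) (EFin \o (\1_(I01 R `&` A) : R -> R)).
  rewrite -L1E; apply: (L1_le _ (L1_cst 1)).
    by apply: measurable_indic.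
  by move=> u _; rewrite normr1 ger0_norm // indicE; case: (_ \in _).
have -> : mI A = I1 (\1_(I01 R `&` A) : R -> R).
  by rewrite /I1 /Rintegral integral_indic // setIC setIA setIid.
rewrite -I1Z //; apply: le_I1; [exact: L1_abs|exact: L1Z|].
move=> u Iu /=; rewrite indicE; have [Au|nA] := pselect (A u).
  by rewrite mem_set // mulr1 fa.
by rewrite f0 // normr0 mulr_ge0.
Qed.

Lemma step0 k u : step (cst 0 : R -> R) k u = 0.
Proof. by rewrite /step avg_cst; case: ifP. Qed.

Lemma trans0 th N u : trans th (step (cst 0 : R -> R)) N u = 0.
Proof.
rewrite /trans big1_seq // => -[|k] _ /=; rewrite !step0 ?subr0 ?mulr0 //.
Qed.

Lemma dist_le_mI (x : R -> R) s : mfun01 x -> dist x s <= mI [set u | s <= `|x u|].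
Proof.
move=> mx; apply: le_mI; [exact: mset01_dist| |by move=> u _ /= /ltW].
by apply: mset01_ge; exact: mfun01_abs.
Qed.

Lemma dist_transD th N f g (s s' : R) : L1 f -> L1 g ->
  dist (trans th (step (f \+ g)) N) (s + s') <=
  dist (trans th (step f) N) s + dist (trans th (step g) N) s'.
Proof.
move=> fi gi; apply: le_trans (distD _ _ (mfun01_trans f th N) (mfun01_trans g th N)).
apply: le_dist_ae; [|exact: mfun01_trans|].
  by apply: measurable_funD; exact: mfun01_trans.
by apply: aeW => u Iu; rewrite transD.
Qed.

Lemma layer_arith (S x y e : R) : x <= 2 * S -> y <= 4 * S ->
  y + e + 248 * x <= 500 * S + e.
Proof. lra. Qed.

Section Layers.
Context (f : R -> R) (fi : L1 f) (ri : L1 (rearr f)) (t : R) (It : I01 R t).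
Context (th : nat -> bool) (N : nat).

Let t0 : 0 < t. Proof. by case/in_I01/andP : It. Qed.
Let mf : mfun01 f. Proof. exact: L1_mfun. Qed.
(** With levels taken at 2^k t, layer k is supported on a set of measure at most 2^(k+1) t, and the
    levels reach 0 as soon as 2^k t >= 1. *)
Let kap k : R := rearr f (2 ^+ k * t).
Let c k : R -> R := fun u => clip (kap k) (f u).
Let S : R := calderon (rearr f) t.
Let tr (x : R -> R) := trans th (step x) N.

Let tk0 k : 0 < 2 ^+ k * t. Proof. by rewrite mulr_gt0 // exprn_gt0. Qed.
Let kap0 k : 0 <= kap k. Proof. exact: rearr_ge0. Qed.
Let kapS k : kap k.+1 <= kap k.
Proof. by apply: le_rearr => //; rewrite exprS -mulrA ler_peMl ?(ltW (tk0 k)) // ler1n. Qed.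
Let ci k : L1 (c k). Proof. exact: L1_clip. Qed.
Let S0 : 0 <= S. Proof. by apply: calderon_ge0 => // s _; exact: rearr_ge0. Qed.

(** The part of |f| above level [rearr f t] has the same distribution as the positive part of
    [rearr f - rearr f t]. The latter lives on (0, t), where the Calderon kernel at t is exactly
    1/t. *)
Lemma clip_top : I1 (fun u => `|f u - c 0%N u|) <= t * S.
Proof.
pose y u := Num.max 0 (rearr f u - kap 0%N).
have my : mfun01 y.
  apply: measurable_maxr; first exact: measurable_cst.
  by apply: measurable_funB; [exact: mfun01_rearr|exact: measurable_cst].
have yi : L1 y.
  apply: (L1_le my ri) => u _; have := kap0 0; have := rearr_ge0 f u.
  by rewrite /y => h1 h2; rewrite !ger0_norm ?le_max ?lexx // ge_max h1 /=; lra.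
have mx : mfun01 (f \- c 0%N) by apply: L1_mfun; exact: L1B.
have dxy s : 0 <= s -> dist (f \- c 0%N) s <= dist y s.
  move=> s0; have e1 : dist (f \- c 0%N) s = dist f (s + kap 0%N).
    congr mI; apply/seteqP; split => u /=; rewrite /c clip_sub // lt_max (ltNge s 0) s0 /=; lra.
  have e2 : dist y s = dist (rearr f) (s + kap 0%N).
    congr mI; apply/seteqP; split => u /=; rewrite /y (ger0_norm (rearr_ge0 f u)) ger0_norm ?le_max ?lexx // lt_max (ltNge s 0) s0 /=; lra.
  by rewrite e1 e2 dist_rearr // addr_ge0.
have [_ h] := I1_dist_le yi mx dxy; apply: (le_trans h).
rewrite /S calderonE // -I1Z; last exact: L1_ker.
apply: le_I1; [exact: L1_abs|by apply: L1Z; exact: L1_ker|].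
move=> u /in_I01/andP[u0 u1] /=.
rewrite ger0_norm ?le_max ?lexx // /y.
have hr := rearr_ge0 f u; rewrite mulrCA; case: (leP u t) => ut.
  by rewrite /ker (max_r ut) mulfV ?gt_eqF // mulr1 ge_max hr /= gerBl.
have : rearr f u <= kap 0%N by rewrite /kap expr0 mul1r le_rearr // ltW.
by move=> h1; rewrite max_l ?subr_le0 // !mulr_ge0 ?ker_ge0 // ltW.
Qed.

(** On the interval from 2^n t / 2 to 2^n t the rearrangement is at least [kap n] and the kernel at
    least 1/(2^n t), so the integral over it is at least [kap n / 2]. *)
Lemma kap_int n : 2 ^+ n * (t / 2) <= 1 ->
  (\sum_(0 <= k < n) kap k) / 2 <=
  \int[mu]_(u in `]0, (2 ^+ n * (t / 2))[) (rearr f u * ker t u).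
Proof.
have ki := L1_ker t0 ri.
have h0 : 0 < t / 2 by rewrite divr_gt0.
elim: n => [|n IH] hn.
  rewrite big_geq // mul0r; apply: Rintegral_ge0 => u _.
  by rewrite mulr_ge0 ?rearr_ge0 ?ker_ge0.
have b0 : 0 < 2 ^+ n * (t / 2) by rewrite mulr_gt0 // exprn_gt0.
have bS : 2 ^+ n.+1 * (t / 2) = 2 * (2 ^+ n * (t / 2)) by rewrite exprS; lra.
have bb : 2 ^+ n * (t / 2) < 2 ^+ n.+1 * (t / 2) by rewrite bS; lra.
have sub : `]0, (2 ^+ n.+1 * (t / 2))[%classic `<=` I01 R.
  move=> u /=; rewrite in_itv /= => /andP[u0 u1]; apply/in_I01.
  by rewrite u0 (lt_le_trans u1).
rewrite (Rintegral_split b0 bb); last first.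
  by apply: L1_sub => //; exact: measurable_itv.
rewrite big_nat_recr //= mulrDl lerD //; first by apply: IH; rewrite (le_trans _ hn) // ltW.
set J := `]_, _[%classic.
have mJ : @measurable _ (measurableTypeR R) J by exact: measurable_itv.
have JI : J `<=` I01 R.
  move=> u; rewrite /J /= in_itv /= => /andP[u0 u1]; apply: sub => /=.
  by rewrite in_itv /= u1 (lt_trans b0).
have -> : kap n / 2 = \int[mu]_(u in J) (cst (kap n / (2 ^+ n * t)) u).
  rewrite Rintegral_cst //.
  have hJ : mu J = (2 ^+ n * (t / 2))%:E.
    rewrite /J lebesgue_measure_itv /= lte_fin bb -EFinB bS; congr EFin; lra.
  move: hJ => /= ->; rewrite /= -mulrA; congr (_ * _).
  by rewrite [2 ^+ n * (t / 2)]mulrA mulKf ?gt_eqF.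
apply: le_Rintegral => //.
- by apply: L1_sub => //; exact: L1_cst.
- exact: L1_sub.
move=> u Ju; have Iu := JI _ Ju; move: Ju; rewrite /J /= in_itv /= => /andP[u0 u1].
have uu : 0 < u by case/in_I01/andP : Iu.
have un : u <= 2 ^+ n * t by rewrite ltW // (lt_le_trans u1) // bS; lra.
apply: ler_pM => //; first by rewrite invr_ge0 ltW.
  exact: le_rearr.
rewrite /ker lef_pV2 ?posrE ?lt_max ?uu // ge_max un /=.
by rewrite ler_peMl ?(ltW t0) // exprn_ege1 // ler1n.
Qed.

Lemma sum_kap n : \sum_(0 <= k < n) kap k <= 2 * S.
Proof.
have ki := L1_ker t0 ri.
elim: n => [|n IH]; first by rewrite big_geq // mulr_ge0.
have [h|h] := leP (2 ^+ n.+1 * (t / 2)) 1; last first.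
  rewrite big_nat_recr //= [kap n]rearr_ge1 ?addr0 //.
  by move: h; rewrite exprS => h; lra.
have := kap_int h; rewrite ler_pdivrMr // mulrC => /le_trans; apply.
rewrite ler_pM2l // /S calderonE //.
set J := `]_, _[%classic.
have mJ : @measurable _ (measurableTypeR R) J by exact: measurable_itv.
have JI : J `<=` I01 R.
  move=> u; rewrite /J /= in_itv /= => /andP[u0 u1]; apply/in_I01.
  by rewrite u0 (lt_le_trans u1).
rewrite -[J](setIidr JI) Rintegral_mkcondr; apply: le_I1 => //; first exact: L1_patch.
move=> u Iu; rewrite patchE; case: ifP => // _.
by rewrite mulr_ge0 ?rearr_ge0 ?ker_ge0.
Qed.

(** The exponential bound must gain the factor 8 * 4^k: dividing the support bound 2^(k+1) t by it
    gives 2^-(k+1) t/2, and these sum to at most t/2. A height proportional to k + 1 achieves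
    this. *)
Lemma dist_layer k : dist (tr (c k \- c k.+1)) (248 * k.+1%:R * (kap k - kap k.+1)) <=
  2^-1 ^+ k.+1 * (t / 2).
Proof.
have r0 : 0 <= 2^-1 ^+ k.+1 * (t / 2).
  by rewrite mulr_ge0 ?exprn_ge0 ?invr_ge0 // divr_ge0 // ltW.
have hi : L1 (c k \- c k.+1) by exact: L1B.
have hb u : `|(c k \- c k.+1) u| <= (kap k - kap k.+1) * (nat_of_bool (kap k.+1 < `|f u|)%R)%:R.
  exact: clip_diff.
(* An empty layer is treated apart, since the exponential bound divides by the height. *)
have [a0|an] := eqVneq (kap k) (kap k.+1).
  have -> : c k \- c k.+1 = cst 0.
    by apply/funext => u; rewrite /c /= a0 subrr.
  rewrite a0 subrr mulr0 /tr dist_ae0 //; first exact: mfun01_trans.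
  by apply: aeW => u _; exact: trans0.
have a0 : 0 < kap k - kap k.+1 by rewrite subr_gt0 lt_neqAle eq_sym an kapS.
have l0 : 0 <= (248 * k.+1%:R : R) by apply: mulr_ge0; exact: ler0n.
have ha u : I01 R u -> `|(c k \- c k.+1) u| <= kap k - kap k.+1.
  move=> _; apply: (le_trans (hb u)); rewrite ler_piMr ?(ltW a0) //.
  by case: (_ < _).
have h1 := @trans_exp _ _ _ th N _ _ (step_averages (c k \- c k.+1)) (mfun01_trans _ _ _) hi a0 l0 ha.
have h2 : I1 (fun u => `|(c k \- c k.+1) u|) <= (kap k - kap k.+1) * mI [set u | kap k.+1 < `|f u|].
  apply: I1_supp => //; [exact: mset01_dist|exact: ltW|].
  move=> u _ /= /negP; rewrite -leNgt => h; apply/eqP; rewrite -normr_le0.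
  by rewrite (le_trans (hb u)) // (ltNge (kap k.+1)) h mulr0.
have h3 : mI [set u | kap k.+1 < `|f u|] <= 2 ^+ k.+1 * t by exact: dist_rearr_le.
have h4 := ch_ge k.
have h5 : (ch (248 * k.+1%:R / 8) - 1) * mI [set u | 248 * k.+1%:R * (kap k - kap k.+1) <= `|tr (c k \- c k.+1) u|] <= 2 ^+ k.+1 * t.
  apply: (le_trans h1); rewrite ler_pdivrMl //; apply: (le_trans h2).
  by rewrite ler_pM2l.
apply: (le_trans (dist_le_mI _ (mfun01_trans _ _ _))).
move: h5; set m := mI _ => h5.
have m0 : 0 <= m by exact: mI_ge0.
have h6 : 8 * 4 ^+ k * m <= 2 ^+ k.+1 * t.
  apply: le_trans h5; rewrite ler_wpM2r //.
  by rewrite lerBrDr.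
have p0 : 0 < 8 * 4 ^+ k :> R by rewrite mulr_gt0 // exprn_gt0.
rewrite -(ler_pM2l p0); apply: (le_trans h6); rewrite le_eqVlt; apply/orP; left; apply/eqP.
rewrite (_ : (4 : R) = 2 * 2) ?exprMn; last by lra.
rewrite !exprS exprVn; set p := (2 : R) ^+ k.
have pp : p * p^-1 = 1 by rewrite mulfV // expf_neq0.
have -> : 8 * (p * p) * (2^-1 * p^-1 * (t / 2)) = 2 * p * (p * p^-1) * t by lra.
by rewrite pp mulr1.
Qed.

Lemma dist_layers n (s s0 : R) : dist (tr (f \- c 0%N)) s0 <= t / 2 ->
  dist (tr f) (s0 + 248 * \sum_(0 <= k < n) k.+1%:R * (kap k - kap k.+1) + s) <=
  t / 2 + \sum_(0 <= k < n) 2^-1 ^+ k.+1 * (t / 2) + dist (tr (c n)) s.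
Proof.
move=> h0; elim: n s => [|n IH] s.
  rewrite !big_geq // mulr0 !addr0.
  have -> : tr f = tr ((f \- c 0%N) \+ c 0%N).
    by congr tr; apply/funext => u /=; rewrite subrK.
  by apply: (le_trans (dist_transD _ _ _ _ _ _)); [exact: L1B|exact: ci|rewrite lerD2r].
rewrite !big_nat_recr //= mulrDr.
have := IH (248 * (n.+1%:R * (kap n - kap n.+1)) + s); rewrite !addrA => /le_trans; apply.
rewrite -[leRHS]addrA lerD2l.
have -> : tr (c n) = tr ((c n \- c n.+1) \+ c n.+1).
  by congr tr; apply/funext => u /=; rewrite subrK.
apply: (le_trans (dist_transD _ _ _ _ _ _)); [exact: L1B|exact: ci|].
by rewrite lerD2r mulrA; exact: dist_layer.
Qed.

(** Abel summation: the linear weights are exactly what turns differences of levels back into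
    levels. *)
Lemma sum_by_parts n : \sum_(0 <= k < n) k.+1%:R * (kap k - kap k.+1) =
  \sum_(0 <= k < n) kap k - n%:R * kap n.
Proof.
elim: n => [|n IH]; first by rewrite !big_geq // mul0r subrr.
by rewrite !big_nat_recr //= IH -natr1; lra.
Qed.

(** The constant is 500 = 4 + 248 * 2: the top part costs 4 S, and the layers cost 248 times the sum
    of the levels, which is at most 2 S. Each of the two parts uses up half of t. *)
Lemma rearr_transform : rearr (tr f) t <= 500 * S.
Proof.
have mt : mfun01 (tr f) by exact: mfun01_trans.
apply/ler_addgt0Pr => e e0.
have pos : 0 <= 500 * S + e.
  by apply: addr_ge0; [apply: mulr_ge0; [exact: ler0n|exact: S0]|exact: ltW].
rewrite (rearr_leP mt t0 pos).
pose a := I1 (fun u => `|(f \- c 0%N) u|).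
have a0 : 0 <= a by apply: I1_ge0.
have fci : L1 (f \- c 0%N) by exact: L1B.
(* The weak bound 2 a / s0 is at most t/2 once s0 >= 4 a / t; adding e makes the level positive even
   when a = 0. *)
pose s0 := 4 / t * a + e.
have s00 : 0 < s0 by rewrite ltr_wpDl // mulr_ge0 // divr_ge0 // ltW.
have h0 : dist (tr (f \- c 0%N)) s0 <= t / 2.
  apply: (le_trans (dist_le_mI _ (mfun01_trans _ _ _))).
  have := @trans_weak _ _ _ th N _ (step_averages (f \- c 0%N)) (mfun01_trans _ _ _) fci s00.
  move=> /le_trans; apply; rewrite -/a mulrAC ler_pdivrMr // /s0.
  have -> : t / 2 * (4 / t * a + e) = 2 * a * (t * t^-1) + t * e / 2 by lra.
  rewrite mulfV ?gt_eqF // mulr1 lerDl divr_ge0 // mulr_ge0 // ltW //.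
have [n hn] := @geom_small _ 2^-1 1 t ltac:(by apply/andP; split; lra) t0.
have kn : kap n = 0.
  apply: rearr_ge1 => //; move: hn; rewrite mul1r exprVn => hn.
  by rewrite mulrC -ler_pdivrMr ?exprn_gt0 // div1r ltW.
have := @dist_layers n 0 s0 h0; rewrite addr0 sum_by_parts kn mulr0 subr0.
have -> : c n = cst 0 by apply/funext => u; rewrite /c kn clip0.
have -> : dist (tr (cst 0)) 0 = 0.
  by apply: dist_ae0 => //; [exact: mfun01_trans|apply: aeW => u _; exact: trans0].
rewrite addr0 => h; have h1 := @sum_half R (t / 2) n ltac:(by rewrite divr_ge0 // ltW).
have h2 := sum_kap n.
have h3 : 4 / t * a <= 4 * S.
  by rewrite mulrAC ler_pdivrMr // -mulrA ler_pM2l // mulrC; exact: clip_top.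
have h4 : t / 2 + t / 2 = t by rewrite [RHS]splitr.
have h5 : s0 + 248 * \sum_(0 <= k < n) kap k <= 500 * S + e.
  exact: layer_arith h2 h3.
apply: (le_trans (le_dist mt h5)); apply: (le_trans h).
by rewrite -[leRHS]h4 lerD2l.
Qed.

End Layers.

End CalderonEstimate.

(** * The martingale transform maps E boundedly into S_E *)

Section Boundedness.
Context {R : realType} (E : fspace R) (qE : is_qB_symmetric E).
Context (EL1 : fs_set E `<=` @L1 R).
Notation mu := (@lebesgue_measure R).
#[local] Opaque rearr calderon calderon_space.

Lemma martingale_transform_bounded :
  bounded_operator (@martingale_transform R) E (calderon_space E).
Proof.
have [K [K0 HK]] : exists K : R, 0 <= K /\ forall f t th N, L1 f -> L1 (rearr f) ->
    I01 R t -> rearr (trans th (step f) N) t <= K * calderon (rearr f) t.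
  by exists 500; split; [exact: ler0n|move=> *; exact: rearr_transform].
exists (2 * K) => f Ef.
have fi : L1 f by exact: EL1.
have [Er Nr] := fs_rearr qE Ef.
have ri : L1 (rearr f) by exact: EL1.
have mh n : mfun01 (partial_transf (step f) n).
  by apply: mfun01_partial_transf; exact: mfun01_step.
have [g [mg hg]] := measure_cauchy_limit mh (fun e e0 => partial_cauchy fi e0).
have hn n t : I01 R t -> rearr (partial_transf (step f) n) t <= K * calderon (rearr f) t.
  move=> It; have /andP[t0 _] : 0 < t < 1 by exact/in_I01.
  apply: le_trans (HK f t (window 0 n) n.*2 fi ri It).
  apply: rearr_ae_le => //; first exact: mfun01_trans.
  apply: aeW => u Iu; rewrite -partial_window //.
  have -> : partial_transf (step f) 0 u = 0 by rewrite /partial_transf big_geq.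
  by rewrite subr0.
(* Passing to the limit: g is a partial sum evaluated at t/2 plus an error that exceeds e on measure
   at most t/2. Returning from t/2 to t in the Calderon bound doubles the constant. *)
have gt t : I01 R t -> rearr g t <= 2 * K * calderon (rearr f) t.
  move=> It; have /andP[t0 t1] : 0 < t < 1 by exact/in_I01.
  have S0 : 0 <= calderon (rearr f) t by apply: calderon_ge0 => // s _; exact: rearr_ge0.
  apply/ler_addgt0Pr => e e0; pose e' := Num.min e (t / 2).
  have e'0 : 0 < e' by rewrite lt_min e0 divr_gt0.
  have [n /(_ n (leqnn n)) hN] := hg e' e'0.
  have K2 : 0 <= 2 * K * calderon (rearr f) t by rewrite !mulr_ge0.
  have pos : 0 <= 2 * K * calderon (rearr f) t + e by rewrite addr_ge0 // ltW.
  rewrite (rearr_leP mg t0 pos).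
  have Ih : I01 R (2^-1 * t) by apply/in_I01; lra.
  have h1 := hn n _ Ih.
  have h2 : calderon (rearr f) (2^-1 * t) <= 2 * calderon (rearr f) t.
    have := @calderon_dil R t 2^-1 (rearr f) ri It; rewrite invrK; apply.
      by apply/andP; split; lra.
    by move=> s _; exact: rearr_ge0.
  have h3 : dist (partial_transf (step f) n) (2 * K * calderon (rearr f) t) <= 2^-1 * t.
    rewrite -rearr_leP //; last by rewrite mulr_gt0.
    by apply: (le_trans h1); rewrite (mulrC 2) -mulrA ler_wpM2l.
  have mgh : mfun01 (g \- partial_transf (step f) n).
    by apply: measurable_funB; [exact: mg|exact: mh].
  have h4 : dist (g \- partial_transf (step f) n) e <= t / 2.
    apply: (@le_trans _ _ e'); last by rewrite ge_min lexx orbT.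
    apply: le_trans hN; apply: le_mI.
    - exact: mset01_dist.
    - by apply: mset01_ge; apply: mfun01_abs; apply: measurable_funB; [exact: mh|exact: mg].
    move=> u _ /= h; rewrite distrC (le_trans _ (ltW h)) // ge_min lexx //.
  have := distD (2 * K * calderon (rearr f) t) e (mh n) mgh.
  have -> : partial_transf (step f) n \+ (g \- partial_transf (step f) n) = g.
    by apply/funext => u /=; rewrite addrC subrK.
  lra.
pose y : R -> R := (2 * K) \*o rearr f.
have Ey : E y by apply: (qn_memZ (qbs_quasi_normed qE)).
have gy : calderon_dominated g y.
  move=> t It; apply: (le_trans (gt t It)).
  rewrite -calderonZ //; apply: (le_calderon_rearr qE EL1 Ey _ It).
  apply: decr01Z; first by rewrite mulr_ge0.
  by apply: decr01_rearr; exact: (fs_mfun qE).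
exists g; split.
- split => //; exists (step f); first by move=> n; exact: cond_exp_step.
  move=> e e0; apply/fine_cvgP; split.
    apply: nearW => n; have mA : mset01 [set u | e <= `|partial_transf (step f) n u - g u|].
      by apply: mset01_ge; apply: mfun01_abs; apply: measurable_funB; [exact: mh|exact: mg].
    by have := mIE mA; rewrite /partial_transf => ->.
  apply/cvgrPdist_lt => d d0; pose e' := Num.min e (d / 2).
  have e'0 : 0 < e' by rewrite lt_min e0 divr_gt0.
  have [n hN] := hg e' e'0; exists n => // m /= nm.
  rewrite sub0r normrN ger0_norm; last exact: mI_ge0.
  apply: (@le_lt_trans _ _ e'); last by rewrite gt_min; apply/orP; right; lra.
  apply: le_trans (hN m nm); apply: le_mI.
  - by apply: mset01_ge; apply: mfun01_abs; apply: measurable_funB; [exact: mh|exact: mg].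
  - by apply: mset01_ge; apply: mfun01_abs; apply: measurable_funB; [exact: mh|exact: mg].
  by move=> u _ /=; apply: le_trans; rewrite ge_min lexx.
- exact: calderon_spaceI gy.
- apply: (le_trans (NG_le qE Ey gy)).
  by rewrite (qn_homogeneous (qbs_quasi_normed qE)) // Nr ger0_norm // mulr_ge0.
Qed.

End Boundedness.

(** * Minimality *)

Section Blocks.
Context {R : realType}.
Notation mu := (@lebesgue_measure R).
Implicit Types (a : nat -> R) (k n : nat) (u : R).
Local Hint Resolve measurable_I01 measurable_I01_ocitv measurable_dyadic measurable_dyadic_ocitv : core.

(** Half-open, so that these blocks partition (0,1). The interior of block k is
    [dyadic_interval R k.+1 1], and [lo k 1] is 2^-k. *)
Definition annulus k : set R := `]lo k.+1 1, lo k 1].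

Lemma lo1_gt0 k : 0 < lo k 1 :> R.
Proof. by rewrite /lo mul1r invr_gt0 exprn_gt0. Qed.

Lemma lo1_le k n : (k <= n)%N -> lo n 1 <= lo k 1 :> R.
Proof.
by move=> kn; rewrite /lo !mul1r lef_pV2 ?posrE ?exprn_gt0 // ler_weXn2l // ler1n.
Qed.

Lemma lo1_le1 k : lo k 1 <= 1 :> R.
Proof. by rewrite -[leRHS](_ : lo 0 1 = 1) ?lo1_le // /lo expr0 divr1. Qed.

Lemma annulus_dyadic k : dyadic_interval R k.+1 1 `<=` annulus k.
Proof.
move=> u; rewrite dyadicE /annulus /= !in_itv /= => /andP[-> h] /=.
by rewrite -(lo_double k 1) ltW.
Qed.

Lemma annulus_inj k n u : annulus k u -> annulus n u -> k = n.
Proof.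
rewrite /annulus /= !in_itv /= => /andP[h1 h2] /andP[h3 h4].
apply/eqP; rewrite eqn_leq; apply/andP; split; rewrite leqNgt; apply/negP => h.
  have := @lo1_le n.+1 k h; lra.
have := @lo1_le k.+1 n h; lra.
Qed.

Lemma annulus_ex u : I01 R u -> exists k, annulus k u.
Proof.
move=> /in_I01/andP[u0 u1].
have ex : exists k, lo k.+1 1 < u.
  have [n] := @geom_small R 2^-1 1 u ltac:(by apply/andP; split; lra) u0.
  rewrite mul1r exprVn => h; exists n; apply: le_lt_trans h.
  by rewrite /lo mul1r lef_pV2 ?posrE ?exprn_gt0 // ler_weXn2l // ler1n.
exists (ex_minn ex); case: ex_minnP => k ku kmin; rewrite /annulus /= in_itv /= ku /=.
case: k ku kmin => [|k] ku kmin; first by rewrite /lo expr0 divr1 ltW.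
by rewrite leNgt; apply/negP => h; have := kmin k h; rewrite ltnn.
Qed.

Lemma annulus_sub k : dyadic_interval R k.+1 1 `<=` I01 R.
Proof. by apply: dyadic_sub; rewrite -{1}(expn0 2) ltn_exp2l. Qed.

(** The blocks are disjoint, so the series has at most one nonzero term at each point of (0,1). *)
Definition block a u : R := lims (fun k v => a k * \1_(annulus k) v) u.

Lemma mfun01_block a : mfun01 (block a).
Proof.
apply: mfun01_lims => k; apply: measurable_funM; first exact: measurable_cst.
by apply: measurable_indic; exact: measurable_itv.
Qed.

Lemma blockE a k u : annulus k u -> block a u = a k.
Proof.
move=> ku; have H j : a j * \1_(annulus j) u = if j == k then a k else 0.
  rewrite indicE; case: eqVneq => [->|jk]; first by rewrite mem_set ?mulr1.
  by rewrite memNset ?mulr0 // => ju; move/eqP: jk; apply; exact: annulus_inj ju ku.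
have : `|block a u - \sum_(0 <= j < k.+1) a j * \1_(annulus j) u| <= 0.
  apply: (@lims_tail R (fun k v => a k * \1_(annulus k) v) (fun=> 0)).
  - by move=> j kj; rewrite H gtn_eqF // normr0.
  - by move=> n _; rewrite big1.
rewrite normr_le0 subr_eq0 => /eqP ->.
rewrite big_nat_recr //= H eqxx big1_seq ?add0r // => j.
  by rewrite mem_index_iota H => /andP[_ /andP[_ jk]]; rewrite ltn_eqF.
Qed.

(** Let n be the least index with T n > s. The left function exceeds s only inside (0, 2^-(2n+1)],
    whereas the right one exceeds s on all of block 2n, whose length is also 2^-(2n+1). *)
Lemma dist_block_shift (T : nat -> R) s : (forall n, 0 <= T n) ->
  (forall n, T n <= T n.+1) -> 0 <= s ->
  dist (block (fun k => if odd k then T k./2 else 0)) s <=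
  dist (block (fun k => if odd k then 0 else T k./2)) s.
Proof.
move=> T0 Tnd s0.
have Tm : {homo T : m n / (m <= n)%N >-> m <= n}.
  by apply: homo_leq => //; exact: le_trans.
have [ex|nex] := pselect (exists n, s < T n); last first.
  apply: (@le_trans _ _ (mI (set0 : set R))); last by rewrite mI0 dist_ge0.
  apply: le_mI; [by apply: mset01_dist; exact: mfun01_block|by rewrite /mset01 setI0|].
  move=> u /annulus_ex[k ku] /=; rewrite (blockE _ ku); case: (odd k).
    by rewrite ger0_norm // => h; apply: nex; exists k./2.
  by rewrite normr0 ltNge s0.
pose n := ex_minn ex; have [hn hmin] : s < T n /\ forall m, s < T m -> (n <= m)%N.
  by rewrite /n; case: ex_minnP.
apply: (@le_trans _ _ (mI (dyadic_interval R n.*2.+1 1))); last first.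
  apply: le_mI; [by apply: mset01W; exact: measurable_dyadic|by apply: mset01_dist; exact: mfun01_block|].
  move=> u Iu /annulus_dyadic ku /=; rewrite (blockE _ ku) odd_double doubleK.
  by rewrite ger0_norm.
have n1 : (1 < 2 ^ n.*2.+1)%N by rewrite -{1}(expn0 2) ltn_exp2l.
rewrite mI_dyadic //.
have -> : (2 ^+ n.*2.+1)^-1 = mI [set u : R | u < lo n.*2.+1 1 + 0].
  by rewrite addr0 mI_itv ?(ltW (lo1_gt0 _)) ?lo1_le1 // /lo mul1r.
have mlt (c : R) : mset01 [set u | u < c].
  rewrite (_ : [set u | u < c] = `]-oo, c[%classic).
    by apply: mset01W; exact: measurable_itv.
  by apply/seteqP; split => u /=; rewrite in_itv.
apply: (@le_trans _ _ (mI ([set u | u < lo n.*2.+1 1] `|` [set lo n.*2.+1 1]))).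
  apply: le_mI; [by apply: mset01_dist; exact: mfun01_block| |].
    by apply: mset01U; [exact: mlt|exact: mset01_set1].
  move=> u /annulus_ex[k ku] /=; rewrite (blockE _ ku); case: (boolP (odd k)) => ko; last first.
    by rewrite normr0 ltNge s0.
  rewrite ger0_norm // => /hmin nk.
  have kk : (n.*2.+1 <= k)%N.
    by rewrite -[k]odd_double_half ko add1n ltnS leq_double.
  move: ku; rewrite /annulus /= in_itv /= => /andP[_ h].
  have := le_trans h (lo1_le kk); rewrite le_eqVlt => /orP[/eqP|]; [by right|by left].
by rewrite addr0 (le_trans (mI_setU (mlt _) (mset01_set1 _))) // mI_set1 addr0.
Qed.

Lemma dyadic_nested k k' j : (k' <= k)%N -> exists j',
  dyadic_interval R k j `<=` dyadic_interval R k' j'.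
Proof.
elim: k j => [|k IH] j; first by rewrite leqn0 => /eqP->; exists j.
rewrite leq_eqVlt => /orP[/eqP->|]; first by exists j.
rewrite ltnS => /(IH j./2)[j' hj]; exists j'.
exact: subset_trans (@dyadic_half R k j) hj.
Qed.

(** The dyadic endpoints of generation k in (0,1), where versions of the conditional expectations
    are uncontrolled. *)
Definition skeleton k : set R := [set u | I01 R u /\ forall j, (j < 2 ^ k)%N -> ~ dyadic_interval R k j u].

Lemma mset01_skeleton k : mset01 (skeleton k).
Proof.
rewrite /mset01 (_ : _ `&` _ = I01 R `\` \bigcup_j (if (j < 2 ^ k)%N then dyadic_interval R k j else set0)).
  apply: (measurableD measurable_I01); apply: bigcupT_measurable => j.
  by case: ifP => _; [exact: measurable_dyadic|exact: measurable0].
apply/seteqP; split => u /=.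
  by move=> [_ [Iu h]]; split => // -[j _]; case: ifPn => // jk; exact: h.
move=> [Iu h]; split => //; split => // j jk hu; apply: h; exists j => //.
by rewrite jk.
Qed.

Lemma mI_skeleton k : mI (skeleton k) = 0.
Proof.
apply/eqP; rewrite eq_le mI_ge0 andbT (le_trans (mI_cover k (mset01_skeleton k))) //.
rewrite big1_seq // => j /andP[_]; rewrite mem_index_iota /= => jk.
by rewrite (_ : _ `&` _ = set0) ?mI0 // -subset0 => u [[_ h] /h]; apply.
Qed.

End Blocks.

(** * Lower bound for the transform of a decreasing function *)

Section LowerBound.
Context {R : realType} (y : R -> R) (yi : L1 y) (y0 : forall u, 0 <= y u)
  (ynd : forall s t, 0 < s -> s <= t -> y t <= y s).
Notation mu := (@lebesgue_measure R).
Local Hint Resolve measurable_I01 measurable_I01_ocitv measurable_dyadic measurable_dyadic_ocitv : core.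

(** Each even block takes the value of y at its right end, so that monotonicity gives 0 <= f <= y
    and the ideal property keeps f in E. *)
Definition even_block (u : R) : R := block (fun k => if odd k then 0 else y (lo k 1)) u.

Let f := even_block.

Lemma even_block_le u : I01 R u -> 0 <= f u <= y u.
Proof.
move=> Iu; have [k ku] := annulus_ex Iu; rewrite /f /even_block (blockE _ ku).
case: (odd k); first by rewrite lexx y0.
rewrite y0 /=; apply: ynd; first by case/in_I01/andP : Iu.
by move: ku; rewrite /annulus /= in_itv /= => /andP[].
Qed.

Lemma L1_even_block : L1 f.
Proof.
apply: (L1_le _ yi); first exact: mfun01_block.
by move=> u /even_block_le/andP[h1 h2]; rewrite !ger0_norm.
Qed.

Let fi : L1 f := L1_even_block.

Lemma ltn_exp1 k : (1 < 2 ^ k.+1)%N.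
Proof. by rewrite -{1}(expn0 2) ltn_exp2l. Qed.

Lemma avg_even_block k : avg f k.+1 1 = if odd k then 0 else y (lo k 1).
Proof.
rewrite -[RHS](avg_cst _ k.+1 1) /avg /dint; congr (_ * _).
by apply: eq_Rintegral => u /set_mem /annulus_dyadic ku; rewrite /f /even_block (blockE _ ku).
Qed.

Lemma dint_even_block k : dint f k.+1 1 = (if odd k then 0 else y (lo k 1)) / 2 ^+ k.+1.
Proof. by rewrite -avg_even_block /avg mulrC mulKf // expf_neq0. Qed.

Lemma dint_ge0 (h : R -> R) k j : (j < 2 ^ k)%N -> (forall u, I01 R u -> 0 <= h u) -> 0 <= dint h k j.
Proof. by move=> jk h0; apply: Rintegral_ge0 => u hu; apply: h0; exact: dyadic_sub hu. Qed.

Lemma dint_annulus_le k j (c : R) : (j < 2 ^ k)%N ->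
  (forall u, dyadic_interval R k j u -> y u <= c) -> dint y k j <= c / 2 ^+ k.
Proof.
move=> jk h; have -> : c / 2 ^+ k = \int[mu]_(u in dyadic_interval R k j) (cst c u).
  by rewrite Rintegral_cst //; have := @mu_dyadic R k j => /= ->.
apply: le_Rintegral => //; first exact: L1_dyadic.
by apply: L1_dyadic => //; exact: L1_cst.
Qed.

Lemma dint_split0 (h : R -> R) k : L1 h -> dint h k 0 = dint h k.+1 0 + dint h k.+1 1.
Proof. by move=> hi; rewrite (dint_split hi) ?expn_gt0. Qed.

(** With c = y(4^-(m+1)), y is at most c on (4^-(m+1), 4^-m), of length 3 * 4^-(m+1), while f equals
    c on block 2m+2, of length half of 4^-(m+1). The ratio of the two lengths is 6. *)
Lemma dint_step m : dint y m.*2 0 - dint y m.+1.*2 0 <= 6 * dint f m.+1.*2.+1 1.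
Proof.
rewrite (dint_split0 _ yi) (dint_split0 m.*2.+1 yi) -doubleS.
rewrite dint_even_block odd_double.
set c := y _.
have h k : (k <= m.*2.+1)%N -> forall u, dyadic_interval R k.+1 1 u -> y u <= c.
  move=> km u; rewrite dyadicE /= in_itv /= => /andP[h1 _].
  apply: ynd; first exact: lo1_gt0.
  by apply: le_trans (ltW h1); apply: lo1_le; rewrite doubleS ltnS.
have h1 := @dint_annulus_le m.*2.+1 1 c (ltn_exp1 _) (h _ (leqnSn _)).
have h2 := @dint_annulus_le m.*2.+2 1 c (ltn_exp1 _) (h _ (leqnn _)).
rewrite doubleS in h2 *; rewrite exprS (exprS _ m.*2.+2 ) in h1 h2 *.
move: h1 h2; rewrite !exprS !invfM; set p := (2 ^+ m.*2)^-1; lra.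
Qed.

Let f_ge0 u : I01 R u -> 0 <= f u.
Proof. by move=> /even_block_le/andP[]. Qed.

Lemma dint_even_step m : dint f m.*2 0 = dint f m.+1.*2 0 + dint f m.*2.+1 1.
Proof.
rewrite (dint_split0 _ fi) (dint_split0 m.*2.+1 fi) -doubleS.
by rewrite [dint f m.+1.*2 1]dint_even_block /= odd_double mul0r addr0.
Qed.

Lemma dint_tele m n : dint y m.*2 0 - dint y (m + n).*2 0 <=
  6 * (dint f m.+1.*2 0 - dint f (m + n).+1.*2 0).
Proof.
elim: n => [|n IH]; first by rewrite addn0 !subrr mulr0.
have := dint_step (m + n); have := dint_even_step (m + n).+1.
by rewrite !addnS; move: IH; lra.
Qed.

Lemma dint_le_I1 (h : R -> R) k j : L1 h -> (j < 2 ^ k)%N -> dint h k j <= I1 (fun u => `|h u|).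
Proof.
move=> hi jk; have p0 : 0 < (2 : R) ^+ k by rewrite exprn_gt0.
rewrite -(ler_pM2l p0); apply: le_trans (sum_avg_norm k hi).
apply: (le_trans (ler_norm _)); rewrite -/(avg h k j).
by rewrite (bigD1_seq j) ?mem_index_iota ?iota_uniq //= lerDl sumr_ge0.
Qed.

Lemma dint_small (e : R) : 0 < e -> exists N, forall n, (N <= n)%N -> dint y n 0 <= e.
Proof.
move=> e0; have e2 : 0 < e / 2 by rewrite divr_gt0.
have [M [M0 hM]] := clip_tail yi e2.
pose y2 u := clip M (y u); pose y1 := y \- y2.
have y2i : L1 y2 by exact: L1_clip.
have y1i : L1 y1 by exact: L1B.
have [N hN] := @geom_small R 2^-1 M (e / 2) ltac:(by apply/andP; split; lra) e2.
exists N => n Nn; have n0 : (0 < 2 ^ n)%N by rewrite expn_gt0.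
have -> : dint y n 0 = dint y1 n 0 + dint y2 n 0.
  have p0 : (2 : R) ^+ n != 0 by rewrite expf_neq0.
  apply: (mulfI p0); rewrite mulrDr -/(avg _ _ _) -/(avg y1 n 0) -/(avg y2 n 0) -avgD //.
  by congr avg; apply/funext => u; rewrite /y1 /= subrK.
have h1 : dint y1 n 0 <= e / 2 by apply: (le_trans (dint_le_I1 y1i n0)); exact: ltW.
have h2 : dint y2 n 0 <= e / 2.
  have p0 : 0 < (2 : R) ^+ n by rewrite exprn_gt0.
  have h : avg y2 n 0 <= M.
    apply: (le_trans (ler_norm _)); apply: avg_bounded => // u _; exact: clip_norm.
  apply: le_trans (ltW hN); rewrite exprVn ler_pdivlMr ?exprn_gt0 //.
  apply: le_trans h; rewrite /avg mulrC ler_wpM2r //.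
    by apply: Rintegral_ge0 => u _; rewrite /y2 /clip le_max le_min M0 y0 orbT.
  by rewrite ler_weXn2l // ler1n.
by rewrite [leRHS]splitr lerD.
Qed.

(** Summing [dint_step] over all scales below 4^-m recovers the whole integral of y, since the
    remainder near 0 tends to zero by integrability. *)
Lemma dint_bound m : dint y m.*2 0 <= 6 * dint f m.*2 0.
Proof.
apply/ler_addgt0Pr => e /dint_small [N hN].
have mN : (N <= (m + N).*2)%N by rewrite -addnn (leq_trans (leq_addl m N)) ?leq_addr.
have := dint_tele m N; have := hN _ mN.
have := dint_even_step m.
have : 0 <= dint f m.*2.+1 1 by apply: dint_ge0 => //; exact: ltn_exp1.
have : 0 <= dint f (m + N).+1.*2 0 by apply: dint_ge0 => //; rewrite expn_gt0.
lra.
Qed.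

Definition half_sum n : R := (\sum_(0 <= m < n.+1) avg f m.*2 0) / 2.

Lemma avg_f_ge0 k j : (j < 2 ^ k)%N -> 0 <= avg f k j.
Proof. by move=> jk; rewrite mulr_ge0 ?exprn_ge0 // dint_ge0. Qed.

Lemma half_sum_ge0 n : 0 <= half_sum n.
Proof. by rewrite divr_ge0 // sumr_ge0 // => m _; rewrite avg_f_ge0 // expn_gt0. Qed.

Lemma half_sum_nd n : half_sum n <= half_sum n.+1.
Proof.
by rewrite ler_pM2r ?invr_gt0 // [leRHS]big_nat_recr //= lerDl avg_f_ge0 // expn_gt0.
Qed.

(** Discretization of the kernel: if u < 4^-n, the last term 4^(n+1) already suffices because w >=
    4^-(n+1). Otherwise w >= u >= 4^-n, and the claim is that for n - 1. *)
Lemma inv_le_sum n (u w : R) : u < 1 -> u <= w -> lo n.+1.*2 1 <= w ->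
  w^-1 <= \sum_(0 <= m < n.+1) (lo m.+1.*2 1)^-1 * (nat_of_bool (u < lo m.*2 1)%R)%:R.
Proof.
move=> u1 uw; have pos m : 0 < (lo m 1 : R)^-1 by rewrite invr_gt0 lo1_gt0.
elim: n => [|n IH] nw.
  rewrite big_nat1 /= [lo 0 1](_ : _ = 1) ?u1 ?mulr1; last by rewrite /lo expr0 divr1.
  by rewrite lef_pV2 ?posrE ?lo1_gt0 // (lt_le_trans (lo1_gt0 _) nw).
rewrite big_nat_recr //=; case: (ltP u) => h.
  rewrite mulr1 ler_wpDl //.
    by apply: sumr_ge0 => i _; rewrite mulr_ge0 // ltW.
  by rewrite lef_pV2 ?posrE ?lo1_gt0 // (lt_le_trans (lo1_gt0 _) nw).
by rewrite mulr0 addr0 IH // (le_trans h).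
Qed.

(** The constant is 48 = 4 * 6 * 2: 4 for rounding the kernel to 4^(m+1), 6 from [dint_bound], 2 for
    the half in [half_sum]. The condition on t covers both blocks 2n and 2n+1. *)
Lemma calderon_half_sum n t : I01 R t -> lo n.+1.*2 1 <= t ->
  calderon y t <= 48 * half_sum n.
Proof.
move=> It nt; have /andP[t0 t1] : 0 < t < 1 by exact/in_I01.
have m0 m : (0 < 2 ^ m)%N by rewrite expn_gt0.
have pi m : L1 (y \_ (dyadic_interval R m.*2 0)) by exact: L1_patch.
rewrite calderonE //.
pose F m := (lo m.+1.*2 1)^-1 \*o (y \_ (dyadic_interval R m.*2 0)).
have Fi m : L1 (F m) by exact: L1Z.
apply: (@le_trans _ _ (I1 (fun u => \sum_(0 <= m < n.+1) F m u))).
  apply: le_I1; [exact: L1_ker|exact: L1_sum|].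
  move=> u /in_I01/andP[u0 u1].
  apply: (@le_trans _ _ (y u * \sum_(0 <= m < n.+1) (lo m.+1.*2 1)^-1 * (nat_of_bool (u < lo m.*2 1)%R)%:R)).
    rewrite ler_wpM2l //; apply: inv_le_sum => //; first by rewrite le_max lexx.
    by rewrite (le_trans nt) // le_max lexx orbT.
  rewrite mulr_sumr; apply: ler_sum => m _; rewrite /F /= mulrCA ler_pM2l ?invr_gt0 ?lo1_gt0 //.
  rewrite patchE; case: (ltP u) => h; last by rewrite mulr0; case: ifP.
  by rewrite mulr1 mem_set // dyadicE /= in_itv /= lo0 u0.
rewrite I1_sum //.
have -> : 48 * half_sum n = 24 * \sum_(0 <= m < n.+1) avg f m.*2 0 by rewrite /half_sum; lra.
rewrite mulr_sumr; apply: ler_sum => m _; rewrite /F I1Z //.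
have -> : I1 (y \_ (dyadic_interval R m.*2 0)) = dint y m.*2 0.
  rewrite /I1 -Rintegral_mkcondr setIidr //; exact: dyadic_sub.
rewrite /avg mulrA /lo div1r invrK.
have -> : 24 * 2 ^+ m.*2 * dint f m.*2 0 = 2 ^+ m.+1.*2 * (6 * dint f m.*2 0).
  by rewrite doubleS !exprS; lra.
by rewrite ler_pM2l ?exprn_gt0 // dint_bound.
Qed.

Lemma dyadic_lt k j u : dyadic_interval R k j u -> I01 R u -> (j < 2 ^ k)%N.
Proof.
rewrite dyadicE /= in_itv /= => /andP[h _] /in_I01/andP[_ u1].
rewrite ltnNge; apply/negP => h2; have : (1 : R) <= lo k j.
  by rewrite -(lo1 k) /lo ler_pM2r ?invr_gt0 ?exprn_gt0 // ler_nat.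
lra.
Qed.

Lemma avg_nested n k j u : (n.*2.+1 <= k)%N -> dyadic_interval R n.*2.+1 1 u ->
  dyadic_interval R k j u -> avg f k j = y (lo n.*2 1).
Proof.
move=> nk hu hj; have [j' sub] := @dyadic_nested R _ _ j nk.
have j1 : j' = 1%N by apply: dyadic_inj hu; exact: sub.
rewrite j1 in sub; rewrite -[RHS](avg_cst _ k j) /avg /dint; congr (_ * _).
apply: eq_Rintegral => v /set_mem /sub /annulus_dyadic kv.
by rewrite /f /even_block (blockE _ kv) odd_double.
Qed.

(** On block 2n every generation up to 2n averages over an interval (0, 2^-k). From generation 2n+1
    on f is constant on the atom, so the increments with m > n vanish and the bound holds for all N
    > n. *)
Lemma partial_transf_even ce n N u : averages f ce -> (n < N)%N ->
  dyadic_interval R n.*2.+1 1 u -> ~ skeleton N.*2 u ->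
  half_sum n <= partial_transf ce N u.
Proof.
move=> fce nN hu ns.
have Iu : I01 R u by exact: annulus_sub hu.
have [j [jN hj]] : exists j, (j < 2 ^ N.*2)%N /\ dyadic_interval R N.*2 j u.
  apply: contrapT => h; apply: ns; split => // j jN hj; apply: h; by exists j.
have ce0 k : (k <= n.*2)%N -> ce k u = avg f k 0.
  move=> kn; apply: fce; first by rewrite expn_gt0.
  move: hu; rewrite !dyadicE /= !in_itv /= => /andP[_ h2].
  have /andP[u0 _] : 0 < u < 1 by exact/in_I01.
  rewrite lo0 u0 /=; apply: (lt_le_trans h2).
  by rewrite (lo_double n.*2 1); exact: lo1_le.
have cen k : (n.*2.+1 <= k <= N.*2)%N -> ce k u = y (lo n.*2 1).
  move=> /andP[nk kN]; have [j' sub] := @dyadic_nested R _ _ j kN.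
  have hj' := sub _ hj.
  rewrite (fce _ _ _ (dyadic_lt hj' Iu) hj'); exact: avg_nested nk hu hj'.
rewrite /partial_transf (big_cat_nat (n := n.+1)) //= [X in _ + X]big1_seq ?addr0; last first.
  move=> m; rewrite mem_index_iota => /andP[_ /andP[nm mN]].
  case: m nm mN => // m nm mN; rewrite /= !cen ?subrr //.
    by rewrite ltnS leq_double -ltnS nm /= ltnW // -doubleS leq_double ltnW.
  by rewrite leq_double (ltnW mN) andbT doubleS ltnS leqW // leq_double.
rewrite /half_sum [leRHS]big_nat_recl //= [X in X / 2]big_nat_recl //= subr0 mulrDl lerD //.
  (* As E_{-1} = 0, the first increment is the full average, of which half is kept. *)
  rewrite (ce0 0%N) //; have := avg_f_ge0 (ltn0Sn 0 : (0 < 2 ^ 0)%N); lra.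
rewrite mulr_suml !big_nat; apply: ler_sum => m /andP[_ mn].
have mn2 : (m.*2.+2 <= n.*2)%N by rewrite -doubleS leq_double.
rewrite (ce0 m.*2.+2) // (ce0 m.*2.+1) ?(ltnW mn2) //.
(* f vanishes on the right child, an odd block, so the average over the parent is half that over the
   left child, and the increment is the other half. *)
have := avg_mart fi (_ : (0 < 2 ^ m.*2.+1)%N); rewrite expn_gt0 => /(_ isT) ->.
rewrite double0 -doubleS (avg_even_block m.*2.+1) /= odd_double /= addr0; lra.
Qed.

(** Where |g| <= [half_sum n] - e on the block, the partial sums differ from g by at least e, up to
    a null set. Convergence in measure makes this set null for each e > 0, and e runs through
    1/(i+1). *)
Lemma transform_lower ce g n : averages f ce -> (forall k, mfun01 (ce k)) -> mfun01 g ->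
  cvg_in_measure01 (partial_transf ce) g ->
  mI (annulus n.*2 `&` [set u | `|g u| < half_sum n]) = 0.
Proof.
move=> fce mce mg cg; set T := half_sum n.
have mP N : mfun01 (partial_transf ce N) by exact: mfun01_partial_transf.
have mD : mset01 (dyadic_interval R n.*2.+1 1) by apply: mset01W; exact: measurable_dyadic.
have mG e : mset01 [set u | e <= T - `|g u|].
  apply: mset01_ge; apply: measurable_funB; [exact: measurable_cst|exact: mfun01_abs].
have key e : 0 < e -> mI (dyadic_interval R n.*2.+1 1 `&` [set u | e <= T - `|g u|]) = 0.
  move=> e0; apply/eqP; rewrite eq_le mI_ge0 andbT; apply/ler_addgt0Pr => d d0; rewrite add0r.
  have [N [nN hN]] : exists N, (n < N)%N /\ mI [set u | e <= `|partial_transf ce N u - g u|] < d.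
    have /fine_cvgP[_ /cvgrPdist_lt /(_ d d0) [N _ /(_ (maxn N n.+1))]] := cg e e0.
    rewrite /= leq_maxl => /(_ isT) h; exists (maxn N n.+1); split; first by rewrite leq_maxr.
    by move: h; rewrite sub0r normrN => /(le_lt_trans (ler_norm _)).
  have mE : mset01 [set u | e <= `|partial_transf ce N u - g u|].
    by apply: mset01_ge; apply: mfun01_abs; apply: measurable_funB; [exact: mP|exact: mg].
  apply: (@le_trans _ _ (mI ([set u | e <= `|partial_transf ce N u - g u|] `|` skeleton N.*2))).
    apply: le_mI; [exact: mset01I|by apply: mset01U => //; exact: mset01_skeleton|].
    move=> u Iu [hu /= hg]; have [h|h] := pselect (skeleton N.*2 u); [by right|left].
    have h1 := partial_transf_even fce nN hu h; rewrite -/T in h1.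
    have := ler_normB (partial_transf ce N u - g u) (- g u).
    rewrite opprK subrK normrN => h2; have := ler_norm (partial_transf ce N u).
    rewrite /=; lra.
  rewrite (le_trans (mI_setU mE (mset01_skeleton _))) // mI_skeleton addr0 ltW //.
have mK i : mset01 (dyadic_interval R n.*2.+1 1 `&` [set u | i.+1%:R^-1 <= T - `|g u|]).
  by apply: mset01I => //; exact: mG.
apply/eqP; rewrite eq_le mI_ge0 andbT.
apply: (@le_trans _ _ (mI (\bigcup_i (dyadic_interval R n.*2.+1 1 `&` [set u | i.+1%:R^-1 <= T - `|g u|]) `|` [set lo n.*2 1]))).
  apply: le_mI.
  - apply: mset01I; first by apply: mset01W; exact: measurable_itv.
    have := mset01_gt 0 (_ : mfun01 (fun u => T - `|g u|)).
    have -> : [set u | `|g u| < T] = [set u | 0 < T - `|g u|].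
      by apply/seteqP; split => u /=; rewrite subr_gt0.
    by apply; apply: measurable_funB; [exact: measurable_cst|exact: mfun01_abs].
  - by apply: mset01U; [exact: mset01_bigcup|exact: mset01_set1].
  move=> u Iu [+ /= hg]; rewrite /annulus /= in_itv /= => /andP[h1].
  rewrite le_eqVlt => /orP[/eqP->|h2]; [by right|left].
  have d0 : 0 < T - `|g u| by rewrite subr_gt0.
  exists (Num.bound (T - `|g u|)^-1) => //; split.
    by rewrite dyadicE /= in_itv /= h1 (lo_double n.*2 1).
  rewrite /= invf_ple ?posrE // ltW // (lt_trans (archi_boundP _)) ?ltr_nat //.
  by rewrite invr_ge0 ltW.
rewrite (le_trans (mI_setU (mset01_bigcup mK) (mset01_set1 _))) // mI_set1 addr0.
apply: (@mI_bigcup _ _ (fun=> 0)) => //.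
  by move=> i; rewrite key // invr_gt0.
by move=> N; rewrite big1.
Qed.

End LowerBound.

(** * S_E is contained in every symmetric receptacle *)

Section Optimality.
Context {R : realType} (E F : fspace R) (qE : is_qB_symmetric E) (qF : is_qB_symmetric F).
Context (EL1 : fs_set E `<=` @L1 R).
Notation mu := (@lebesgue_measure R).
#[local] Opaque rearr calderon.

Lemma fs_rearr_le x y : F x -> mfun01 y ->
  (forall t, I01 R t -> rearr y t <= rearr x t) -> F y.
Proof.
move=> Fx my h; have [Fr _] := fs_rearr qF Fx.
have mr := mfun01_rearr my.
have [Fy _] : F (rearr y) /\ fs_norm F (rearr y) <= fs_norm F (rearr x).
  apply: (qbs_ideal qF) => //; apply: aeW => u Iu.
  by rewrite !ger0_norm ?rearr_ge0 // h.
have [//] : F y /\ fs_norm F y = fs_norm F (rearr y).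
apply: (qbs_symmetric qF) => // t /in_I01/andP[t0 _].
by rewrite rearr_rearr.
Qed.

Lemma calderon_space_minimal :
  bounded_operator (@martingale_transform R) E F -> fs_set (calderon_space E) `<=` fs_set F.
Proof.
move=> [C HC] x /calderon_spaceE[mx [y' [Ey' xy]]].
pose y := rearr y'.
have my' := fs_mfun qE Ey'.
have Ey : E y by exact: (fs_rearr qE Ey').1.
have yi : L1 y by exact: EL1.
have y0 u : 0 <= y u by exact: rearr_ge0.
have ynd s t : 0 < s -> s <= t -> y t <= y s by move=> *; exact: le_rearr.
pose f := even_block y.
have [Ef _] : E f /\ fs_norm E f <= fs_norm E y.
  apply: (qbs_ideal qE) => //; first exact: mfun01_block.
  by apply: aeW => u Iu; have /andP[h1 h2] := even_block_le y0 ynd Iu; rewrite !ger0_norm.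
have [g [[fi mg [ce Hce cg]] Fg _]] := HC f Ef.
have fce := cond_exp_averages Hce.
have mce k : mfun01 (ce k) by apply: L1_mfun; have [] := Hce k.
have low n := @transform_lower R y yi y0 ynd ce g n fce mce mg cg.
pose T := half_sum y.
have T0 n : 0 <= T n by exact: half_sum_ge0.
have Tnd n : T n <= T n.+1 by exact: half_sum_nd.
(* z1 is the minorant of |g| on the even blocks and lies in F by the ideal property; z2 carries the
   same values on the odd blocks and lies in F by comparison of rearrangements with z1. *)
pose z1 := block (fun k => if odd k then 0 else T k./2).
pose z2 := block (fun k => if odd k then T k./2 else 0).
have mz1 : mfun01 z1 by exact: mfun01_block.
have mz2 : mfun01 z2 by exact: mfun01_block.
pose B n := annulus n.*2 `&` [set u | `|g u| < T n].
have mB n : mset01 (B n).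
  apply: mset01I; first by apply: mset01W; exact: measurable_itv.
  have := mset01_gt 0 (_ : mfun01 (fun u => T n - `|g u|)).
  have -> : [set u | `|g u| < T n] = [set u | 0 < T n - `|g u|].
    by apply/seteqP; split => u /=; rewrite subr_gt0.
  by apply; apply: measurable_funB; [exact: measurable_cst|exact: mfun01_abs].
have Fz1 : F z1.
  have [//] : F z1 /\ fs_norm F z1 <= fs_norm F g.
  apply: (qbs_ideal qF) => //; exists (I01 R `&` \bigcup_n B n); split.
  - exact: mset01_bigcup.
  - rewrite mIE; last exact: mset01_bigcup.
    congr EFin; apply/eqP; rewrite eq_le mI_ge0 andbT.
    apply: (@mI_bigcup _ _ (fun=> 0)) => //; first by move=> i; rewrite low.
    by move=> N; rewrite big1.
  move=> u /= h; apply: contrapT => h'; apply: h => Iu.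
  have [k ku] := annulus_ex Iu; rewrite /z1 (blockE _ ku).
  case: (boolP (odd k)) => ko; first by rewrite normr0.
  have kE : k = k./2.*2 by rewrite -{1}[k]odd_double_half (negbTE ko).
  rewrite (ger0_norm (T0 _)) leNgt; apply/negP => hlt; apply: h'; split => //.
  by exists k./2 => //; split => //; rewrite -kE.
have Fz2 : F z2.
  apply: (fs_rearr_le Fz1 mz2) => t /in_I01/andP[t0 _].
  by apply: rearr_dist_le => // s s0; exact: dist_block_shift.
pose w : R -> R := 48 \*o (z1 \+ z2).
have Fw : F w.
  apply: (qn_memZ (qbs_quasi_normed qF)); exact: (qn_memD (qbs_quasi_normed qF)).
have [Fr _] : F (rearr x) /\ fs_norm F (rearr x) <= fs_norm F w.
  apply: (qbs_ideal qF) => //; first exact: mfun01_rearr.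
  apply: aeW => u Iu; rewrite (ger0_norm (rearr_ge0 _ _)).
  apply: (le_trans (xy u Iu)); apply: le_trans (ler_norm _).
  have [k ku] := annulus_ex Iu.
  have -> : w u = 48 * T k./2.
    by rewrite /w /z1 /z2 /= !(blockE _ ku); case: (odd k); rewrite ?addr0 ?add0r.
  (* For u in block k one has u > 2^-(k+1), and k + 1 is at most twice [k./2.+1], whatever the
     parity of k. *)
  apply: calderon_half_sum => //.
  move: ku; rewrite /annulus /= in_itv /= => /andP[h _].
  apply: le_trans (ltW h); apply: lo1_le.
  by rewrite doubleS ltnS -[leqLHS]odd_double_half -addn1 addnC leq_add2l; case: (odd k).
have [//] : F x /\ fs_norm F x = fs_norm F (rearr x).
apply: (qbs_symmetric qF) => // t /in_I01/andP[t0 _].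
by rewrite rearr_rearr.
Qed.

End Optimality.

Theorem corollary17 (R : realType) (E : fspace R)
  (qbsE : is_qB_symmetric E) (E_sub_L1 : fs_set E `<=` @L1 R) :
  optimal_symmetric_range (@martingale_transform R) E (calderon_space E).
Proof.
split; [exact: calderon_space_qB_symmetric|exact: martingale_transform_bounded|].
by move=> F qF; exact: calderon_space_minimal.
Qed.
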